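(* Let the structural assumption on $(\sigma,F,L,(u_t)_{t\ge 0})$ (stated in the context) hold with exponent $p\ge1$, and let $T>0$, $q>p$. Let $(X_t^i)_{t\ge0,\,1\le i\le N}$ be the solution of the particle system $$\mathrm{d}X_t^{i}=\sigma\,\mathrm{d}B_t^{i}-F(X_t^{i})\,\mathrm{d}t+\int_0^t L\Big(t,s,X_t^{i},\frac1N\sum_{j=1}^N\delta_{X_s^{j}}\Big)u_t(\mathrm{d}s)\,\mathrm{d}t,\qquad i=1,\dots,N,$$ with $\mathcal F_0$-measurable initial conditions having a finite $m$-th moment for some $m\ge\max(p,2)$, and let $\bar X_t^i$, $i=1,\dots,N$, be $N$ solutions of the McKean–Vlasov equation $$\mathrm{d}\bar X_t^i=\sigma\,\mathrm{d}B_t^i-F(\bar X_t^i)\,\mathrm{d}t+\int_0^t L(t,s,\bar X_t^i,\mu_s)\,u_t(\mathrm{d}s)\,\mathrm{d}t,\qquad \mu_t=\mathrm{Law}(\bar X_t^i),$$ driven by the same $N$ independent Brownian motions $(B^i)_{1\le i\le N}$ as the particle system, with i.i.d. $\mathcal F_0$-measurable initial conditions having a finite $q$-th moment. For $\varepsilon,\tilde\varepsilon>0$ set $$\alpha(t):=p(H_t^1-\kappa)+H_t^2(\varepsilon+\tilde\varepsilon)(p-1),\qquad \beta(t,s):=\frac{1}{\tilde\varepsilon^{\,p-1}}h^2(t,s),\qquad C(t):=\frac{H_t^2}{p\,\varepsilon^{p-1}}\sup_{0\le r\le T}\mathbb E(|\bar X_r^1|^q)^{p/q}.$$ If $x:\mathbb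 R_+\to\mathbb R_+$ is a solution to $$\begin{cases}x'(t)=\alpha(t)x(t)+\displaystyle\int_0^t\beta(t,s)x(s)\,u_t(\mathrm ds)+v(N)\,C(t)\quad\text{for all }0\le t\le T,\\[2mm] x(0)=\displaystyle\frac1N\sum_{i=1}^N\frac{\mathbb E|X_0^i-\bar X_0^i|^p}{p},\end{cases}$$ then for all $0\le t\le T$, $$\frac1N\sum_{i=1}^N\frac{\mathbb E|X_t^i-\bar X_t^i|^p}{p}\le x(t).$$
   Context: Setting. Work on a filtered probability space with filtration $(\mathcal F_t)_{t\ge0}$; $B^1,\dots,B^N$ are independent $k$-dimensional Brownian motions, independent of the initial conditions; $\sigma\in\mathcal M_{d,k}(\mathbb R)$; $u_t$ is, for each $t\ge0$, a measure on $(\mathbb R_+,\mathcal B(\mathbb R_+))$; $F:\mathbb R^d\to\mathbb R^d$ is measurable; $L:\mathbb R_+\times\mathbb R_+\times\mathbb R^d\times\mathcal P_p(\mathbb R^d)\to\mathbb R^d$ is measurable. $\mathcal P_p(\mathbb R^d)$ is the set of probability measures on $\mathbb R^d$ with finite $p$-th moment and $W_p$ is the $p$-Wasserstein distance. $\int_0^t g(s)\,u_t(\mathrm ds)$ denotes the integral over the closed interval $[0,t]$. Structural assumption: (1.1) for all $t\ge 0$, $u_t$ is a finite measure with support in $[0,t]$ and $s\mapsto L(t,s,x,\mu)$ is $u_t$-integrable for all $x\in\mathbb R^d$, $\mu\in\mathcal P_p(\mathbb R^d)$; (1.2) there are $p\ge1$ and measurable $h^1,h^2:\mathbb R_+\times\mathbb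 R_+\to\mathbb R_+$ such that for all $t,s\in\mathbb R_+$, $x,y\in\mathbb R^d$, $\mu,\nu\in\mathcal P_p(\mathbb R^d)$: $|L(t,s,x,\mu)-L(t,s,y,\mu)|\le h^1(t,s)|x-y|$ and $|L(t,s,x,\mu)-L(t,s,x,\nu)|\le h^2(t,s)W_p(\mu,\nu)$; (1.3) for all $t\ge0$, $H_t^1:=\int_0^t h^1(t,s)u_t(\mathrm ds)<\infty$ and $H_t^2:=\int_0^t h^2(t,s)u_t(\mathrm ds)<\infty$, and for every $T$ there is $0\le D_T<\infty$ with $H_t^1\le D_T$ and $H_t^2\le D_T$ for all $0\le t\le T$; (1.4) $t\mapsto\int_0^tL(t,s,x,\mu(s))u_t(\mathrm ds)$ is measurable and continuous for every $x\in\mathbb R^d$ and $\mu\in\mathcal C(\mathbb R_+,\mathcal P_p(\mathbb R^d))$; (1.5) $F$ is locally Lipschitz and there is $\kappa\in\mathbb R$ with $\langle x-y,F(x)-F(y)\rangle\ge\kappa|x-y|^2$ for all $x,y\in\mathbb R^d$. Rate. For $p\ge1$, $d\ge1$, $q>p$, $$v(N):=C_0\times\begin{cases}N^{-1/2}+N^{-(q-p)/q}&\text{if }p>d/2,\ q\ne2p,\\ N^{-1/2}\log(1+N)+N^{-(q-p)/q}&\text{if }p=d/2,\ q\neq 2p,\\ N^{-p/d}+N^{-(q-p)/q}&\text{if }0<p<d/2,\ q\ne d/(d-p),\end{cases}$$ where $C_0$ is the constant, depending only on $p,d,q$, of the Fournier–Guillin theorem: for every probability measure $\mu$ on $\mathbb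 R^d$ with finite $q$-th moment and i.i.d. $Y_1,\dots,Y_N\sim\mu$, $\mathbb E[W_p^p(\frac1N\sum_i\delta_{Y_i},\mu)]\le v(N)\big(\int|x|^q\mu(\mathrm dx)\big)^{p/q}$. It is assumed that $(p,d,q)$ falls in one of these three cases. *)

(* Defs.v *)
From HB Require Import structures.
From mathcomp Require Import all_boot all_order all_algebra.
From mathcomp Require Import all_classical all_reals all_analysis.
From mathcomp Require Import measurable_realfun.
Import numFieldNormedType.Exports.
Import Order.TTheory GRing.Theory Num.Theory.

Set Implicit Arguments.
Unset Strict Implicit.
Unset Printing Implicit Defensive.

Local Open Scope classical_set_scope.
Local Open Scope ring_scope.

(* R^d is 'rV[R]_d, with its Borel sigma-algebra.  The library norm `|x| on
   matrices is the sup norm, so the Euclidean norm is introduced separately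
   (both induce the same topology). *)

Definition borel_mx_display : measure_display. Proof. exact. Qed.

Section borel_mx.
Context (R : realType) (m n : nat).

Definition borel_mx : set (set 'M[R]_(m, n)) := <<s [set A | open A] >>.

Let borel_mx0 : borel_mx set0. Proof. exact: sigma_algebra0. Qed.
Let borel_mxC A : borel_mx A -> borel_mx (~` A).
Proof. exact: sigma_algebraC. Qed.
Let borel_mxU (A : (set 'M[R]_(m, n))^nat) :
  (forall i, borel_mx (A i)) -> borel_mx (\bigcup_i A i).
Proof. exact: sigma_algebra_bigcup. Qed.

HB.instance Definition _ := @isMeasurable.Build borel_mx_display
  'M[R]_(m, n) borel_mx borel_mx0 borel_mxC borel_mxU.
End borel_mx.

Section euclidean.
Context (R : realType) (d : nat).
Implicit Types x y : 'rV[R]_d.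

Definition edot x y : R := \sum_(j < d) x 0 j * y 0 j.
Definition enorm x : R := Num.sqrt (edot x x).

Lemma enorm_continuous : continuous enorm.
Proof.
have cdot : continuous (fun x : 'rV[R]_d => edot x x).
  apply: continuous_big => [|j _ y]; first exact: add_continuous.
  have cj := @coord_continuous R 1 d 0 j y.
  exact: (cvgM cj cj).
by move=> x; apply: continuous_comp; [exact: cdot|exact: sqrt_continuous].
Qed.

Lemma measurable_enorm : measurable_fun [set: 'rV[R]_d] enorm.
Proof.
apply: (measurability _ (RGenOpens.measurableE R)) => _ [_ [a [b ->]] <-].
rewrite setTI; apply: sub_sigma_algebra => /=.
by move/continuousP : enorm_continuous; apply; exact: interval_open.
Qed.

Definition vintegrable (disp : measure_display) (T : measurableType disp)
    (m : {measure set T -> \bar R}) (D : set T) (f : T -> 'rV[R]_d) : Prop :=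
  forall j, m.-integrable D (fun s => (f s 0 j)%:E).
Definition vintegral (disp : measure_display) (T : measurableType disp)
    (m : {measure set T -> \bar R}) (D : set T) (f : T -> 'rV[R]_d)
    : 'rV[R]_d :=
  \row_j (\int[m]_(s in D) (f s 0 j)).
End euclidean.

Section wasserstein.
Context (R : realType) (d : nat).
Local Notation V := 'rV[R]_d.
Implicit Types mu nu : probability V R.

Definition moment (p : R) mu : \bar R := (\int[mu]_y (enorm y `^ p)%:E)%E.

Definition coupling mu nu : set (probability (V * V)%type R) :=
  [set pi | forall A, measurable A ->
     pi (A `*` setT) = mu A /\ pi (setT `*` A) = nu A].

Definition Wp (p : R) mu nu : \bar R :=
  (ereal_inf [set \int[pi]_z (enorm (z.1 - z.2) `^ p)%:E |
                pi in coupling mu nu] `^ p^-1)%E.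
End wasserstein.

Section empirical_probability.
Context (R : realType) (d n : nat) (hn : (0 < n)%N) (x : 'I_n -> 'rV[R]_d).

(* (1/n) \sum_i \delta_(x i); the proof hn that n is positive only serves to
   make this a probability. *)
Definition empirical_prob of (0 < n)%N := fun A : set 'rV[R]_d =>
  (((n%:R^-1)%:E : \bar R) * \sum_(i < n) \d_(x i) A)%E.

Let r : {nonneg R} := (n%:R^-1)%:nng.
Let dir (i : nat) : {measure set 'rV[R]_d -> \bar R} :=
  \d_(if insub i is Some j then x j else 0).

Lemma empirical_probE : empirical_prob hn = mscale r (msum dir n).
Proof.
apply/funext => A; rewrite /empirical_prob /mscale /= /msum.
congr (_ * _)%E; apply: eq_bigr => i _.
by rewrite /dir; case: insubP => [j _ /val_inj ->//|]; rewrite ltn_ord.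
Qed.

Let empirical0 : empirical_prob hn set0 = 0%E.
Proof. by rewrite empirical_probE measure0. Qed.
Let empirical_ge0 A : (0 <= empirical_prob hn A)%E.
Proof. by rewrite empirical_probE. Qed.
Let empirical_sigma_additive : semi_sigma_additive (empirical_prob hn).
Proof. by rewrite empirical_probE; exact: measure_semi_sigma_additive. Qed.

HB.instance Definition _ := isMeasure.Build _ _ _ (empirical_prob hn)
  empirical0 empirical_ge0 empirical_sigma_additive.

Let empirical_setT : empirical_prob hn setT = 1%E.
Proof.
rewrite /empirical_prob (eq_bigr (fun=> 1%:E)); last first.
  by move=> i _; rewrite diracT.
by rewrite sumEFin big_const_ord iter_addr_0 -EFinM mulVf// pnatr_eq0 -lt0n.
Qed.

HB.instance Definition _ :=
  Measure_isProbability.Build _ _ _ (empirical_prob hn) empirical_setT.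

Lemma empirical_moment (p : R) : (moment p (empirical_prob hn) < +oo)%E.
Proof.
have mf : measurable_fun [set: 'rV[R]_d] (EFin \o (fun y => enorm y `^ p)).
  apply/measurable_EFinP.
  by apply: (measurableT_comp (measurable_powR _)); exact: measurable_enorm.
have f0 (y : 'rV[R]_d) : [set: 'rV[R]_d] y -> (0 <= (enorm y `^ p)%:E)%E.
  by rewrite lee_fin powR_ge0.
have -> : moment p (empirical_prob hn) =
    (\int[mscale r (msum dir n)]_y (enorm y `^ p)%:E)%E.
  by apply: eq_measure_integral => A mA _; rewrite /= empirical_probE.
rewrite ge0_integral_mscale// ge0_integral_measure_sum//.
under eq_bigr do rewrite integral_dirac// diracT mul1e.
by rewrite sumEFin -EFinM ltry.
Qed.
End empirical_probability.

Section Pp.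
Context (R : realType) (d : nat) (p : R).

Record Pp := MkPp {
  Pp_val :> probability 'rV[R]_d R ;
  Pp_moment : (moment p Pp_val < +oo)%E }.

Lemma dirac0_moment :
  (moment p (\d_(0%R : 'rV[R]_d) : probability 'rV[R]_d R) < +oo)%E.
Proof.
rewrite /moment integral_dirac//; first by rewrite diracT mul1e ltry.
apply/measurable_EFinP.
by apply: (measurableT_comp (measurable_powR _)); exact: measurable_enorm.
Qed.

HB.instance Definition _ := gen_eqMixin Pp.
HB.instance Definition _ := gen_choiceMixin Pp.
HB.instance Definition _ := isPointed.Build Pp (MkPp dirac0_moment).

(* Wp is only a pseudodistance on Pp: two probabilities that agree on all
   measurable sets need not be equal as functions on all sets. *)
Definition Wp_open (A : set Pp) : Prop := forall mu, A mu ->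
  exists2 e : R, 0 < e & forall nu : Pp, (Wp p mu nu < e%:E)%E -> A nu.

Definition borel_Pp : set (set Pp) := <<s Wp_open >>.

Let borel_Pp0 : borel_Pp set0. Proof. exact: sigma_algebra0. Qed.
Let borel_PpC A : borel_Pp A -> borel_Pp (~` A).
Proof. exact: sigma_algebraC. Qed.
Let borel_PpU (A : (set Pp)^nat) :
  (forall i, borel_Pp (A i)) -> borel_Pp (\bigcup_i A i).
Proof. exact: sigma_algebra_bigcup. Qed.

Definition borel_Pp_display : measure_display. Proof. exact. Qed.

HB.instance Definition _ := @isMeasurable.Build borel_Pp_display
  Pp borel_Pp borel_Pp0 borel_PpC borel_PpU.

Definition empirical (n : nat) (hn : (0 < n)%N) (x : 'I_n -> 'rV[R]_d) : Pp :=
  MkPp (empirical_moment hn x p).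

Definition Pp_continuous (mu : R -> Pp) : Prop := forall t, 0 <= t ->
  Wp p (mu s) (mu t) @[s --> within `[0, +oo[ (nbhs t)] --> 0%E.
End Pp.

Section structural_assumption.
Context (R : realType) (d : nat) (p : R).
Local Notation V := 'rV[R]_d.

Definition Hker (u : R -> {measure set R -> \bar R}) (h : R -> R -> R) (t : R)
  : R := \int[u t]_(s in `[0, t]) h t s.

(* R_+ is represented inside R: u_t and L(t, s, ., .) matter only for
   t, s >= 0, and a measure on R_+ is one on R that does not charge the
   complement of R_+. *)
Record structural_assumption (F : V -> V) (L : R -> R -> V -> Pp d p -> V)
    (u : R -> {measure set R -> \bar R}) (h1 h2 : R -> R -> R) (kappa : R)
    : Prop := StructuralAssumption {
  sa_F_measurable : measurable_fun setT F ;
  sa_L_measurable :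
    measurable_fun [set z : R * R * V * Pp d p | 0 <= z.1.1.1 /\ 0 <= z.1.1.2]
      (fun z : R * R * V * Pp d p => L z.1.1.1 z.1.1.2 z.1.2 z.2) ;
  sa_u_finite : forall t : R, 0 <= t -> (u t setT < +oo)%E ;
  sa_u_support : forall t : R, 0 <= t -> u t (~` `[0, t]) = 0%E ;
  sa_L_integrable : forall (t : R) x (mu : Pp d p), 0 <= t ->
    vintegrable (u t) `[0, t] (fun s => L t s x mu) ;
  sa_p_ge1 : 1 <= p ;
  sa_h1_measurable : measurable_fun [set z : R * R | 0 <= z.1 /\ 0 <= z.2]
    (fun z => h1 z.1 z.2) ;
  sa_h2_measurable : measurable_fun [set z : R * R | 0 <= z.1 /\ 0 <= z.2]
    (fun z => h2 z.1 z.2) ;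
  sa_h1_ge0 : forall t s : R, 0 <= t -> 0 <= s -> 0 <= h1 t s ;
  sa_h2_ge0 : forall t s : R, 0 <= t -> 0 <= s -> 0 <= h2 t s ;
  sa_L_lipschitz_x : forall (t s : R) x y (mu : Pp d p), 0 <= t -> 0 <= s ->
    enorm (L t s x mu - L t s y mu) <= h1 t s * enorm (x - y) ;
  sa_L_lipschitz_mu : forall (t s : R) x (mu nu : Pp d p), 0 <= t -> 0 <= s ->
    ((enorm (L t s x mu - L t s x nu))%:E <= (h2 t s)%:E * Wp p mu nu)%E ;
  sa_H1_finite : forall t : R, 0 <= t ->
    (\int[u t]_(s in `[0%R, t]) (h1 t s)%:E < +oo)%E ;
  sa_H2_finite : forall t : R, 0 <= t ->
    (\int[u t]_(s in `[0%R, t]) (h2 t s)%:E < +oo)%E ;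
  sa_H_bounded : forall T : R, exists2 D : R, 0 <= D &
    forall t : R, 0 <= t <= T -> Hker u h1 t <= D /\ Hker u h2 t <= D ;
  sa_L_time_measurable : forall (x : V) (mu : R -> Pp d p), Pp_continuous mu ->
    measurable_fun (`[0, +oo[%classic : set R)
      (fun t => vintegral (u t) `[0, t] (fun s => L t s x (mu s))) ;
  sa_L_time_continuous : forall (x : V) (mu : R -> Pp d p), Pp_continuous mu ->
    {within `[0, +oo[, continuous
      (fun t : R => vintegral (u t) `[0, t] (fun s => L t s x (mu s)))} ;
  sa_F_locally_lipschitz : forall x : V, exists2 U, nbhs x U &
    [lipschitz F y | y in U] ;
  sa_F_monotone : forall x y : V,
    kappa * enorm (x - y) ^+ 2 <= edot (x - y) (F x - F y) }.
End structural_assumption.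

Section probability.
Context (disp : measure_display) (Omega : measurableType disp) (R : realType)
  (P : probability Omega R).

Record filtration (Ft : R -> set (set Omega)) : Prop := Filtration {
  filtration_sigma_algebra : forall t, 0 <= t -> sigma_algebra setT (Ft t) ;
  filtration_measurable : forall t, 0 <= t -> Ft t `<=` measurable ;
  filtration_nondecreasing : forall s t, 0 <= s -> s <= t -> Ft s `<=` Ft t }.

Definition mutually_independent (I : finType) (G : I -> set (set Omega))
    : Prop :=
  forall (J : {set I}) (E : I -> set Omega),
    (forall i, i \in J -> G i (E i)) ->
    P (\bigcap_(i in [set` J]) E i) = (\prod_(i in J) P (E i))%E.

Definition adapted (n : nat) (Ft : R -> set (set Omega))
    (X : R -> Omega -> 'rV[R]_n) : Prop :=
  forall t, 0 <= t -> g_sigma_algebra_preimage (X t) `<=` Ft t.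

Definition continuous_paths (n : nat) (X : R -> Omega -> 'rV[R]_n) : Prop :=
  {ae P, forall w, {within `[0, +oo[, continuous (fun t => X t w)}}.

Definition process_sigma_algebra (n : nat) (X : R -> Omega -> 'rV[R]_n)
    : set (set Omega) :=
  <<s \bigcup_(t in `[0, +oo[) g_sigma_algebra_preimage (X t) >>.

Definition has_law (n : nat) (Y : Omega -> 'rV[R]_n)
    (mu : probability 'rV[R]_n R) : Prop :=
  forall A, measurable A -> P (Y @^-1` A) = mu A.

Definition iid (n k : nat) (Y : 'I_k -> Omega -> 'rV[R]_n) : Prop :=
  mutually_independent (fun i => g_sigma_algebra_preimage (Y i)) /\
  forall i j A, measurable A -> P (Y i @^-1` A) = P (Y j @^-1` A).

(* Standard k-dimensional Brownian motion relative to Ft.  The second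
   argument of normal_prob is the standard deviation. *)
Record brownian_motion (k : nat) (Ft : R -> set (set Omega))
    (B : R -> Omega -> 'rV[R]_k) : Prop := BrownianMotion {
  bm_adapted : adapted Ft B ;
  bm_start : {ae P, forall w, B 0 w = 0} ;
  bm_continuous : continuous_paths B ;
  bm_independent : forall s t G A, 0 <= s -> s <= t -> Ft s G -> measurable A ->
    P (G `&` [set w | A (B t w - B s w)%R]) =
    (P G * P [set w | A (B t w - B s w)%R])%E ;
  bm_gaussian : forall s t (A : 'I_k -> set R), 0 <= s -> s < t ->
    (forall j, measurable (A j)) ->
    P [set w | forall j, A j ((B t w - B s w)%R 0%R j)] =
    (\prod_(j < k) normal_prob 0 (Num.sqrt (t - s)) (A j))%E }.

Definition drift (d : nat) (p : R) (F : 'rV[R]_d -> 'rV[R]_d)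
    (L : R -> R -> 'rV[R]_d -> Pp d p -> 'rV[R]_d)
    (u : R -> {measure set R -> \bar R}) (nu : R -> Pp d p) (t : R)
    (x : 'rV[R]_d) : 'rV[R]_d :=
  - F x + vintegral (u t) `[0, t] (fun s => L t s x (nu s)).

(* dX_t = sigma dB_t - F(X_t) dt + \int_0^t L(t, s, X_t, nu_s) u_t(ds) dt, in
   integral form; nu is a random flow of measures.  As sigma is constant, the
   stochastic integral is sigma B_t (here in row-vector form). *)
Record sde_solution (d k : nat) (p : R) (Ft : R -> set (set Omega))
    (sigma : 'M[R]_(d, k)) (F : 'rV[R]_d -> 'rV[R]_d)
    (L : R -> R -> 'rV[R]_d -> Pp d p -> 'rV[R]_d)
    (u : R -> {measure set R -> \bar R}) (B : R -> Omega -> 'rV[R]_k)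
    (nu : Omega -> R -> Pp d p) (X : R -> Omega -> 'rV[R]_d) : Prop :=
  SdeSolution {
  sde_adapted : adapted Ft X ;
  sde_continuous : continuous_paths X ;
  sde_inner_integrable : {ae P, forall w, forall t, 0 <= t ->
    vintegrable (u t) `[0, t] (fun s => L t s (X t w) (nu w s))} ;
  sde_drift_integrable : {ae P, forall w, forall t, 0 <= t ->
    vintegrable (@lebesgue_measure R) `[0, t]
      (fun s => drift F L u (nu w) s (X s w))} ;
  sde_equation : {ae P, forall w, forall t, 0 <= t ->
    X t w = X 0 w + B t w *m sigma^T +
      vintegral (@lebesgue_measure R) `[0, t]
        (fun s => drift F L u (nu w) s (X s w))} }.
End probability.

Section rate.
Context (R : realType).

Definition rate_case (p : R) (d : nat) (q : R) : Prop :=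
  [\/ d%:R / 2 < p /\ q <> 2 * p,
      p = d%:R / 2 /\ q <> 2 * p |
      0 < p < d%:R / 2 /\ q <> d%:R / (d%:R - p)].

Definition rate (C0 p : R) (d : nat) (q : R) (n : nat) : R :=
  C0 * (if d%:R / 2 < p then n%:R `^ (- 2^-1) + n%:R `^ (- ((q - p) / q))
        else if p == d%:R / 2
        then n%:R `^ (- 2^-1) * ln (1 + n%:R) + n%:R `^ (- ((q - p) / q))
        else n%:R `^ (- (p / d%:R)) + n%:R `^ (- ((q - p) / q))).

(* The Fournier-Guillin theorem asserts that such a C0 exists in each of the
   cases of rate_case. *)
Definition fournier_guillin_constant (p : R) (d : nat) (q C0 : R) : Prop :=
  forall (disp : measure_display) (Omega : measurableType disp)
    (P : probability Omega R) (mu : probability 'rV[R]_d R)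
    (n : nat) (hn : (0 < n)%N) (Y : 'I_n -> Omega -> 'rV[R]_d),
    (moment q mu < +oo)%E ->
    (forall i, measurable_fun setT (Y i)) ->
    (forall i, has_law P (Y i) mu) -> iid P Y ->
    (\int[P]_w (Wp p (empirical_prob (fun i => Y i w) hn) mu `^ p)
       <= (rate C0 p d q n)%:E * moment q mu `^ (p / q))%E.

(* The derivative is one-sided at an endpoint of an interval D. *)
Definition derivative_within (D : set R) (x : R -> R) (t l : R) : Prop :=
  (x s - x t) / (s - t) @[s --> within D t^'] --> l.
End rate.

(* Main.v *)
From HB Require Import structures.
Require Import Defs.
From mathcomp Require Import all_boot all_order all_algebra.
From mathcomp Require Import all_classical all_reals all_analysis.
From mathcomp Require Import measurable_realfun ring lra.
Import numFieldNormedType.Exports.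
Import Order.TTheory GRing.Theory Num.Theory.

Set Implicit Arguments.
Unset Strict Implicit.
Unset Printing Implicit Defensive.

Local Open Scope classical_set_scope.
Local Open Scope ring_scope.

(** Let Z = X - Xbar be the difference of a particle and its limit.  Both feel
    the same additive noise, so the paths of Z are continuously differentiable
    and |Z|^p / p has at every time the right derivative
    |Z|^(p-1) <e, drift difference>, where |e| <= 1 and |Z| e = Z
    (enorm_powR_right_derivative).  Three effects bound it (pathwise_growth).
    The monotonicity of F contributes - kappa |Z|^p.  In the memory term, one
    changes the position, then the empirical measure of the X into that of the
    Xbar, then the latter into the law; the Lipschitz bounds and two Young
    inequalities, of weights eps' and eps, turn this into H^1 |Z|^p, a
    multiple of H^2 |Z|^p, the past mean of |Z|^p, and the p-th power of the
    distance between the empirical measure of the Xbar and their law.  As the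
    Xbar are independent copies of a law, the Fournier-Guillin bound controls
    the expectation of the last term.  Hence the mean distance y satisfies
    D^+ y <= alpha y + int beta y du + v(N) C.  A function with this property
    stays below x + delta e^(lambda t) for lambda large, since at a first
    crossing it would grow too fast (comparison); let delta tend to 0.

    Four points need care.

    Expectations.  The right derivative commutes with the expectation on the
    event that the paths of Z are bounded by n and n-Lipschitz on [0, T],
    by dominated convergence (truncated_growth).  The event does not depend on
    time, so the comparison applies to the mean over it, and the events
    increase to a set of full measure (mean_distance_le).

    Derivatives.  The inequality for D^+ y is established at every time, with
    y continuous; this suits the comparison by a first crossing, because
    nothing is assumed on the regularity of H^1 and H^2 in time.

    Independence of the Xbar at a positive time.  The initial condition and
    the noise of a particle form sigma-algebras that are independent over the
    particles.  The solution is almost surely the limit of its Euler scheme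
    (euler_converges), hence measurable with respect to them up to null sets
    (sde_mutually_independent).

    The flow of laws.  Continuity of the drift in time is assumed along
    continuous flows only.  If the q-th moments of the Xbar are bounded on
    [0, T], then their laws are continuous for W_p (flow_continuous).  If not,
    C is infinite wherever H^2 > 0; the equation for x then forces H^2 = 0 on
    [0, T], as v(N) > 0 (fournier_guillin_constant_gt0), and the drift ignores
    the law, which may be replaced by a constant (same_memory_of_Hker0). *)

(** * Borel sets of matrices, and the Euclidean norm *)

Section matrix_measurability.
Context (R : realType).

Let borel_mxE (m n : nat) :
  (@measurable _ 'M[R]_(m, n)) = <<s [set A : set 'M[R]_(m, n) | open A] >>.
Proof. by []. Qed.

Lemma measurable_coord (m n : nat) (i : 'I_m) (j : 'I_n) :
  measurable_fun [set: 'M[R]_(m, n)] (fun A : 'M[R]_(m, n) => A i j).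
Proof.
apply: (measurability _ (RGenOpens.measurableE R)) => _ [_ [a [b ->]] <-].
rewrite setTI; apply: sub_sigma_algebra => /=.
by move/continuousP : (@coord_continuous R m n i j); apply; exact: interval_open.
Qed.

(** The Borel sigma-algebra of the topology is generated by the coordinates,
    because an open set is the union of the balls of rational centre and
    rational radius that it contains, and such a ball is a finite
    intersection of conditions on the entries. *)
Lemma measurable_fun_mx (m n : nat) (d : measure_display)
    (T : measurableType d) (D : set T) (f : T -> 'M[R]_(m, n)) :
  measurable D ->
  (forall i j, measurable_fun D (fun x => f x i j)) -> measurable_fun D f.
Proof.
move=> mD mf; apply: (measurability _ (borel_mxE _ _)) => _ [U oU <-].
pose c (a : 'M[rat]_(m, n) * nat) : 'M[R]_(m, n) := map_mx ratr a.1.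
pose r (a : 'M[rat]_(m, n) * nat) : R := (a.2.+1%:R)^-1.
pose S := [set a : 'M[rat]_(m, n) * nat | ball (c a) (r a) `<=` U].
have UE : U = \bigcup_(a in S) ball (c a) (r a).
  apply/seteqP; split=> [x Ux|x [a Sa xa]]; last exact: (Sa _ xa).
  have [e /= e0 eU] := (proj1 (nbhs_ballP x U)) (open_nbhs_nbhs (conj oU Ux)).
  have [k ke] : exists k : nat, (k.+1%:R : R)^-1 < e / 2.
    have e20 : 0 < (e / 2)^-1 by rewrite invr_gt0 divr_gt0.
    exists (Num.truncn (e / 2)^-1).
    rewrite -[ltRHS]invrK ltf_pV2 ?posrE//.
    by have /andP[_] := @Num.Theory.truncn_itv _ (e / 2)^-1 (ltW e20).
  have hk : (0 : R) < (k.+1%:R)^-1 by rewrite invr_gt0.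
  have ax i j : exists q : rat, ratr q \in `]x i j - k.+1%:R^-1, x i j + k.+1%:R^-1[.
    by apply: rat_in_itvoo; rewrite ltrD2l gtrN.
  pose q := \matrix_(i, j) sval (cid (ax i j)).
  have xq : ball (c (q, k)) (r (q, k)) x.
    split; first exact: hk.
    move=> i j; rewrite /ball /= !mxE; case: (cid _) => v /=.
    by rewrite in_itv/= ltr_distl.
  exists (q, k) => // y [_ yq]; apply: eU; split=> // i j.
  have := xq.2 i j; have := yq i j; rewrite /ball /= /r /= => h1 h2.
  rewrite (splitr e) (le_lt_trans (ler_distD (c (q, k) i j) _ _))// ltrD//.
    by rewrite distrC (lt_trans h2).
  by rewrite (lt_trans h1).
have mb a : measurable (D `&` f @^-1` ball (c a) (r a)).
  have -> : D `&` f @^-1` ball (c a) (r a) =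
      \bigcap_(ij in [set: 'I_m * 'I_n])
        (D `&` (fun x => f x ij.1 ij.2) @^-1` ball (c a ij.1 ij.2) (r a)) `&` D.
    apply/seteqP; split => [x [Dx [_ h]]|x [h Dx]]; split => //.
      by move=> [i j] _; split => //; exact: h.
    split; first by rewrite /r invr_gt0.
    by move=> i j; have [_] := h (i, j) Logic.I.
  apply: measurableI => //; apply: fin_bigcap_measurable => //.
  move=> [i j] _; apply: mf => //; apply: open_measurable; exact: ball_open.
rewrite UE preimage_bigcup setI_bigcupr; rewrite bigcup_mkcond.
by apply: countable_bigcupT_measurable => // a; case: ifP.
Qed.

Lemma measurable_row (d' : nat) (d : measure_display)
    (T : measurableType d) (D : set T) (f : T -> 'rV[R]_d') :
  measurable D ->
  (forall j, measurable_fun D (fun x => f x 0 j)) -> measurable_fun D f.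
Proof. by move=> mD mf; apply: measurable_fun_mx => // i j; rewrite ord1. Qed.

Lemma continuous_measurable_mx (m n m' n' : nat) (f : 'M[R]_(m, n) -> 'M[R]_(m', n')) :
  continuous f -> measurable_fun setT f.
Proof.
move=> cf; apply: (measurability _ (borel_mxE _ _)) => _ [U oU <-].
rewrite setTI; apply: sub_sigma_algebra.
by move/continuousP : cf; apply.
Qed.

Lemma cvg_mx (m n : nat) (T : Type) (F : set_system T) {FF : Filter F}
    (f : T -> 'M[R]_(m, n)) (A : 'M[R]_(m, n)) :
  (forall i j, f x i j @[x --> F] --> A i j) -> f x @[x --> F] --> A.
Proof.
move=> fA; apply/cvg_ballP => e e0.
have h : \forall x \near F, forall ij : 'I_m * 'I_n, ball (A ij.1 ij.2) e (f x ij.1 ij.2).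
  by apply: filter_forall => -[i j] /=; have /cvg_ballP := fA i j; exact.
by apply: filterS h => x h; split=> // i j; exact: (h (i, j)).
Qed.

Lemma cvg_coord (m n : nat) (T : Type) (F : set_system T) {FF : Filter F}
    (f : T -> 'M[R]_(m, n)) (A : 'M[R]_(m, n)) i j :
  f x @[x --> F] --> A -> f x i j @[x --> F] --> A i j.
Proof. by move=> fA; apply: (continuous_cvg _ (@coord_continuous R m n i j A) fA). Qed.

Lemma row_continuous (m n : nat) (i : 'I_m) : continuous (@row R m n i).
Proof.
move=> A; apply: (cvg_mx (F := nbhs A)) => k j; under eq_fun do rewrite mxE.
by rewrite mxE; exact: coord_continuous.
Qed.

End matrix_measurability.

Section euclidean_norm.
Context (R : realType) (d : nat).
Implicit Types (x y z : 'rV[R]_d) (a : R).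

Lemma edotC x y : edot x y = edot y x.
Proof. by apply: eq_bigr => j _; rewrite mulrC. Qed.

Lemma edotDl x y z : edot (x + y) z = edot x z + edot y z.
Proof. by rewrite -big_split; apply: eq_bigr => j _; rewrite mxE mulrDl. Qed.

Lemma edotZl a x y : edot (a *: x) y = a * edot x y.
Proof. by rewrite mulr_sumr; apply: eq_bigr => j _; rewrite mxE mulrA. Qed.

Lemma edotNl x y : edot (- x) y = - edot x y.
Proof. by rewrite -scaleN1r edotZl mulN1r. Qed.

Lemma edotDr x y z : edot x (y + z) = edot x y + edot x z.
Proof. by rewrite edotC edotDl !(edotC x). Qed.

Lemma edotZr a x y : edot x (a *: y) = a * edot x y.
Proof. by rewrite edotC edotZl (edotC x). Qed.

Lemma edotNr x y : edot x (- y) = - edot x y.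
Proof. by rewrite edotC edotNl (edotC x). Qed.

Lemma edot_ge0 x : 0 <= edot x x.
Proof. by apply: sumr_ge0 => j _; rewrite -expr2 sqr_ge0. Qed.

Lemma enorm_ge0 x : 0 <= enorm x.
Proof. exact: sqrtr_ge0. Qed.

Lemma enorm_sqr x : enorm x ^+ 2 = edot x x.
Proof. by rewrite sqr_sqrtr// edot_ge0. Qed.

Lemma enormZ a x : enorm (a *: x) = `|a| * enorm x.
Proof.
by rewrite /enorm edotZl edotZr mulrA -expr2 sqrtrM ?sqr_ge0// sqrtr_sqr.
Qed.

Lemma enormN x : enorm (- x) = enorm x.
Proof. by rewrite -scaleN1r enormZ normrN1 mul1r. Qed.

Lemma enorm0 : enorm (0 : 'rV[R]_d) = 0.
Proof. by rewrite -(scale0r 0) enormZ normr0 mul0r. Qed.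

Lemma enormB x y : enorm (x - y) = enorm (y - x).
Proof. by rewrite -enormN opprB. Qed.

Lemma ler_coord_enorm x j : `|x 0 j| <= enorm x.
Proof.
rewrite -ler_sqr ?nnegrE ?enorm_ge0// enorm_sqr real_normK ?num_real//.
rewrite /edot (bigD1 j)//= -expr2 lerDl; apply: sumr_ge0 => k _.
by rewrite -expr2 sqr_ge0.
Qed.

Lemma enorm_eq0 x : enorm x = 0 -> x = 0.
Proof.
move=> x0; apply/rowP => j; rewrite mxE; apply/eqP; rewrite -normr_le0.
by rewrite -x0 ler_coord_enorm.
Qed.

Lemma edot_le x y : edot x y <= enorm x * enorm y.
Proof.
have [y0|y0] := eqVneq (enorm y) 0.
  rewrite (enorm_eq0 y0) /edot big1 ?enorm0 ?mulr0// => j _.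
  by rewrite mxE mulr0.
have [x0|x0] := eqVneq (enorm x) 0.
  rewrite (enorm_eq0 x0) /edot big1 ?enorm0 ?mul0r// => j _.
  by rewrite mxE mul0r.
have xy0 : 0 < enorm x * enorm y.
  by rewrite lt_def mulf_neq0//= mulr_ge0 ?enorm_ge0.
have := edot_ge0 (enorm y *: x - enorm x *: y).
rewrite !(edotDl, edotDr, edotNl, edotNr, edotZl, edotZr) -!enorm_sqr (edotC y x).
move=> h; rewrite -(ler_pM2l xy0); nra.
Qed.

Lemma enormD x y : enorm (x + y) <= enorm x + enorm y.
Proof.
rewrite -ler_sqr ?nnegrE ?addr_ge0 ?enorm_ge0// enorm_sqr edotDl !edotDr.
have := edot_le x y; rewrite (edotC y x) -!enorm_sqr; nra.
Qed.

Lemma enorm_distD z x y : enorm (x - y) <= enorm (x - z) + enorm (z - y).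
Proof. by rewrite (le_trans _ (enormD _ _))// addrA subrK. Qed.

Lemma ler_dist_enorm x y : `|enorm x - enorm y| <= enorm (x - y).
Proof.
have h (u v : 'rV[R]_d) : enorm u - enorm v <= enorm (u - v).
  by rewrite lerBlDr -[X in enorm X <= _](subrK v u) enormD.
by rewrite ler_norml h andbT lerNl opprB enormB h.
Qed.

Lemma enorm_le_sum x : enorm x <= \sum_j `|x 0 j|.
Proof.
have {1}-> : x = \sum_j x 0 j *: 'e_j by exact: row_sum_delta.
elim/big_ind2 : _ => [|u a v b ha hb|j _].
- by rewrite enorm0.
- by rewrite (le_trans (enormD _ _))// lerD.
- rewrite enormZ /enorm /edot (bigD1 j)//= big1 => [|k kj].
    by rewrite !mxE !eqxx mulr1 addr0 sqrtr1 mulr1.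
  by rewrite !mxE eqxx (negbTE kj) mulr0.
Qed.

Lemma cvg_enorm (T : Type) (F : set_system T) {FF : Filter F}
    (f : T -> 'rV[R]_d) (v : 'rV[R]_d) :
  f x @[x --> F] --> v -> enorm (f x) @[x --> F] --> enorm v.
Proof. exact: (continuous_cvg _ (@enorm_continuous R d v)). Qed.

Lemma cvg_enormB (T : Type) (F : set_system T) {FF : Filter F}
    (f : T -> 'rV[R]_d) (v : 'rV[R]_d) :
  f x @[x --> F] --> v <-> enorm (v - f x) @[x --> F] --> 0.
Proof.
split=> [fv|fv].
  rewrite -[X in _ --> X]enorm0 -(subrr v); apply: cvg_enorm.
  by apply: cvgB => //; exact: cvg_cst.
apply: cvg_mx => i j; rewrite ord1; apply/cvgrPdist_le => e e0.
move/cvgrPdist_le : fv => /(_ e e0); apply: filterS => x.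
rewrite sub0r normrN ger0_norm ?enorm_ge0//; apply: le_trans.
by have := ler_coord_enorm (v - f x) j; rewrite !mxE.
Qed.

End euclidean_norm.

(** * Powers of nonnegative reals, and integrals of nonnegative functions *)

Section powers.
Context (R : realType).
Implicit Types a b e p : R.

Lemma cvg_powR (T : Type) (F : set_system T) {FF : Filter F} (u : T -> R) a p :
  0 <= p -> (\forall x \near F, 0 <= u x) -> u x @[x --> F] --> a -> 0 <= a ->
  u x `^ p @[x --> F] --> a `^ p.
Proof.
rewrite le_eqVlt => /predU1P[<- _ _ _|p0 u0 ua].
  by under eq_fun do rewrite powRr0; rewrite powRr0; exact: cvg_cst.
rewrite le_eqVlt => /predU1P[a0|a0]; last first.
  have ca : {for a, continuous (@powR R ^~ p)}.
    apply: differentiable_continuous.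
    by apply/derivable1_diffP/derivable_powR; rewrite in_itv/= a0.
  exact: (continuous_cvg _ ca ua).
rewrite -a0 powR0 ?gt_eqF//; apply/cvgrPdist_le => /= e e0.
have e1 : 0 < e `^ p^-1 by rewrite powR_gt0.
move/cvgrPdist_le : ua => /(_ _ e1); apply: filterS2 u0 => x ux.
rewrite -a0 !sub0r !normrN (ger0_norm ux) ger0_norm ?powR_ge0// => uxe.
have -> : e = (e `^ p^-1) `^ p by rewrite -powRrM mulVf ?gt_eqF// powRr1// ltW.
by apply: ge0_ler_powR => //; rewrite ?nnegrE ?powR_ge0 ?ltW.
Qed.

Lemma ler_powR_base a b p : 0 <= p -> 0 <= a -> a <= b -> a `^ p <= b `^ p.
Proof.
move=> p0 a0 ab; apply: ge0_ler_powR => //; rewrite nnegrE//.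
exact: le_trans ab.
Qed.

Lemma cvg_sumr (T I : Type) (F : set_system T) {FF : Filter F} (s : seq I)
    (f : I -> T -> R) (a : I -> R) :
  (forall i, f i x @[x --> F] --> a i) ->
  \sum_(i <- s) f i x @[x --> F] --> \sum_(i <- s) a i.
Proof.
move=> fa; elim: s => [|i s ih].
  by under eq_fun do rewrite big_nil; rewrite big_nil; exact: cvg_cst.
by under eq_fun do rewrite big_cons; rewrite big_cons; exact: cvgD.
Qed.

(** Young's inequality with a weight.  For [p = 1] the exponent conjugate to
    [p] is infinite and the first term vanishes, which is why the inequality
    is written with [a `^ (p - 1)] in place of a product of two powers. *)
Lemma young_weighted p e a b : 1 <= p -> 0 < e -> 0 <= a -> 0 <= b ->
  a `^ (p - 1) * b <= e * (p - 1) / p * a `^ p + b `^ p / (p * e `^ (p - 1)).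
Proof.
move=> p1 e0 a0 b0; have p0 : 0 < p by exact: lt_le_trans p1.
have [->|pn1] := eqVneq p 1.
  by rewrite subrr !powRr0 mulr0 !mul0r add0r mul1r mulr1 divr1 powRr1.
have p1' : 0 < p - 1 by rewrite subr_gt0 lt_def pn1.
pose c := e `^ ((p - 1) / p).
have c0 : 0 < c by exact: powR_gt0.
have -> : a `^ (p - 1) * b = (c * a `^ (p - 1)) * (b / c) by field; lra.
have h := @conjugate_powR R (c * a `^ (p - 1)) (b / c) (p / (p - 1)) p.
have := h (mulr_ge0 (ltW c0) (powR_ge0 _ _)) (divr_ge0 b0 (ltW c0)) (divr_gt0 p0 p1') p0.
have -> : (p / (p - 1))^-1 + p^-1 = 1 by field; lra.
move=> /(_ erefl) /le_trans; apply.
rewrite (powRM _ (ltW c0) (powR_ge0 _ _)).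
rewrite (powRM _ b0 (eqbRL (invr_ge0 _) (ltW c0))) -!powRrM.
have -> : (p - 1) / p * (p / (p - 1)) = 1 by field; lra.
have -> : (p - 1) * (p / (p - 1)) = p by field; lra.
rewrite (powRr1 (ltW e0)).
have -> : c^-1 `^ p = (e `^ (p - 1))^-1.
  rewrite -powR_inv1 ?ltW// -!powRrM mulN1r -powRN.
  by congr (_ `^ _); field; lra.
have e1 : 0 < e `^ (p - 1) by exact: powR_gt0.
by rewrite le_eqVlt; apply/orP; left; apply/eqP; field; lra.
Qed.

(** Young's inequality of weight 1 is the tangent inequality of the convex
    function [b |-> b `^ p / p]. *)
Lemma powR_tangent_le p a b : 1 <= p -> 0 <= a -> 0 <= b ->
  a `^ (p - 1) * (b - a) <= (b `^ p - a `^ p) / p.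
Proof.
move=> p1 a0 b0; have p0 : 0 < p by exact: lt_le_trans p1.
have := young_weighted p1 ltr01 a0 b0.
rewrite powR1 mulr1 mul1r mulrBr [a `^ _ * a]mulrC mulr_powRB1// => h.
have -> : (b `^ p - a `^ p) / p = (p - 1) / p * a `^ p + b `^ p / p - a `^ p.
  by field; lra.
lra.
Qed.

End powers.

Section ge0_integrals.
Local Open Scope ereal_scope.
Context (d : measure_display) (T : measurableType d) (R : realType)
  (m : {measure set T -> \bar R}).

(** The integral of a nonnegative function is a supremum over the simple
    functions below it, whence monotonicity.  It is applied to the Wasserstein
    distance of a random empirical measure. *)
Lemma ge0_le_integral_nonmeasurable (D : set T) (f g : T -> \bar R) :
  (forall x, D x -> 0 <= f x) -> (forall x, D x -> f x <= g x) ->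
  \int[m]_(x in D) f x <= \int[m]_(x in D) g x.
Proof.
move=> f0 fg; have g0 x : D x -> 0 <= g x by move=> Dx; rewrite (le_trans (f0 x Dx)) ?fg.
rewrite !ge0_integralE//; apply: le_ereal_sup => _ [h hf <-]; exists h => // x.
rewrite (le_trans (hf x))//= !patchE; case: ifPn => // xD.
by apply: fg; rewrite inE in xD.
Qed.

Lemma integral_le_ge0 (D : set T) (f g : T -> \bar R) :
  m.-integrable D f -> (forall x, D x -> 0 <= g x) -> (forall x, D x -> f x <= g x) ->
  \int[m]_(x in D) f x <= \int[m]_(x in D) g x.
Proof.
move=> intf g0 fg; rewrite integralE.
rewrite -[leRHS]sube0 leeB ?integral_ge0//.
apply: ge0_le_integral_nonmeasurable => //.
by move=> x Dx; rewrite funeposE ge_max fg//= g0.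
Qed.

End ge0_integrals.

(** * Couplings and the Wasserstein distance *)

Section wasserstein_facts.
Context (R : realType) (d : nat) (p : R) (p0 : 0 < p).
Local Notation V := 'rV[R]_d.
Implicit Types (mu nu : probability V R).

Lemma measurable_enorm_powR (dT : measure_display) (T : measurableType dT)
    (D : set T) (f : T -> V) (r : R) : measurable D -> measurable_fun D f ->
  measurable_fun D (fun t => enorm (f t) `^ r).
Proof.
move=> mD mf; apply: (measurableT_comp (measurable_powR r)).
exact: (measurableT_comp (@measurable_enorm R d) mf).
Qed.

Lemma measurable_rowB (dT : measure_display) (T : measurableType dT) (D : set T)
    (f g : T -> V) : measurable D ->
  measurable_fun D f -> measurable_fun D g -> measurable_fun D (fun t => f t - g t).
Proof.
move=> mD mf mg; apply: measurable_row => // j.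
under eq_fun do rewrite !mxE; apply: measurable_funB.
  exact: (measurableT_comp (measurable_coord 0 j) mf).
exact: (measurableT_comp (measurable_coord 0 j) mg).
Qed.

Lemma Wp_powR mu nu :
  (Wp p mu nu `^ p = ereal_inf [set \int[pi]_z (enorm (z.1 - z.2) `^ p)%:E |
                                  pi in coupling mu nu])%E.
Proof.
rewrite /Wp -poweRrM mulVf ?gt_eqF// poweRe1//; apply: le_ereal_inf_tmp.
by move=> _ [pi _ <-]; apply: integral_ge0 => z _; rewrite lee_fin powR_ge0.
Qed.

Lemma Wp_ge0 mu nu : (0 <= Wp p mu nu)%E.
Proof. exact: poweR_ge0. Qed.

Lemma Wp_le_root mu nu (c : R) : 0 <= c -> (Wp p mu nu `^ p <= c%:E)%E ->
  (Wp p mu nu <= (c `^ p^-1)%:E)%E.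
Proof.
move=> c0 h.
have -> : Wp p mu nu = ((Wp p mu nu `^ p) `^ p^-1)%E.
  by rewrite -poweRrM mulfV ?gt_eqF// poweRe1// Wp_ge0.
rewrite -poweR_EFin; apply: gt0_ler_poweR => //.
- by rewrite invr_ge0 ltW.
- by rewrite in_itv/= poweR_ge0 leey.
- by rewrite in_itv/= lee_fin c0 leey.
Qed.

(** A pair of random vectors with the prescribed laws is a coupling. *)
Lemma Wp_le_expectation mu nu (dT : measure_display) (T : measurableType dT)
    (P : probability T R) (f g : T -> V) :
  measurable_fun setT f -> measurable_fun setT g ->
  has_law P f mu -> has_law P g nu ->
  (Wp p mu nu `^ p <= \int[P]_w (enorm (f w - g w) `^ p)%:E)%E.
Proof.
move=> mf mg lf lg; rewrite Wp_powR.
have mfg : measurable_fun setT (fun w => (f w, g w)) by exact: measurable_fun_pair.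
pose Y : {RV P >-> (V * V)%type} := mfun_Sub (mem_set mfg).
apply: ge_ereal_inf; exists (\int[P]_w (enorm (f w - g w) `^ p)%:E)%E => //.
exists (distribution P Y).
  move=> A mA; split; rewrite /distribution /pushforward /=.
    by rewrite -lf//; congr (P _); apply/seteqP; split => w //= [].
  by rewrite -lg//; congr (P _); apply/seteqP; split => w //= [].
rewrite ge0_integral_distribution//; last by move=> z; rewrite lee_fin powR_ge0.
apply/measurable_EFinP; apply: measurable_enorm_powR => //.
exact: measurable_rowB.
Qed.

Lemma Wp_sym mu nu : Wp p mu nu = Wp p nu mu.
Proof.
have h (a b : probability V R) : (Wp p a b `^ p <= Wp p b a `^ p)%E.
  rewrite [X in (_ <= X)%E]Wp_powR; apply: le_ereal_inf_tmp => _ [pi hpi <-].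
  apply: le_trans (Wp_le_expectation (P := pi) measurable_snd measurable_fst _ _) _.
  - move=> A mA.
    by rewrite -(hpi A mA).2; congr (pi _); apply/seteqP; split => w //= [].
  - move=> A mA.
    by rewrite -(hpi A mA).1; congr (pi _); apply/seteqP; split => w //= [].
  - rewrite le_eqVlt; apply/orP; left; apply/eqP; apply: eq_integral => z _.
    by congr ((_ `^ _)%:E); exact: enormB.
have e : (Wp p mu nu `^ p = Wp p nu mu `^ p)%E by apply/eqP; rewrite eq_le !h.
have -> : Wp p mu nu = ((Wp p mu nu `^ p) `^ p^-1)%E.
  by rewrite -poweRrM mulfV ?gt_eqF// poweRe1// Wp_ge0.
by rewrite e -poweRrM mulfV ?gt_eqF// poweRe1// Wp_ge0.
Qed.

End wasserstein_facts.

Section empirical_facts.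
Context (R : realType) (d : nat).
Local Notation V := 'rV[R]_d.

Lemma integral_empirical (n : nat) (hn : (0 < n)%N) (x : 'I_n -> V)
    (f : V -> \bar R) : measurable_fun setT f -> (forall y, (0 <= f y)%E) ->
  (\int[empirical_prob x hn]_y f y = (n%:R^-1)%:E * \sum_(i < n) f (x i))%E.
Proof.
move=> mf f0.
pose dir (i : nat) : {measure set V -> \bar R} :=
  \d_(if insub i is Some j then x j else 0).
transitivity (\int[mscale ((n%:R^-1 : R)%:nng)%R (msum dir n)]_y f y)%E.
  by apply: eq_measure_integral => A mA _; rewrite /= (empirical_probE hn x).
rewrite ge0_integral_mscale// ge0_integral_measure_sum//; congr (_ * _)%E.
apply: eq_bigr => i _; rewrite integral_dirac// diracT mul1e.
by congr (f _); case: insubP => [j _ /val_inj ->//|]; rewrite ltn_ord.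
Qed.

End empirical_facts.

Section empirical_distance.
Context (R : realType) (d : nat) (p : R) (p0 : 0 < p).
Local Notation V := 'rV[R]_d.

(** The coupling that matches atoms of equal index.  It is realised by the
    empirical measure of the pairs, the pair being encoded as a row of
    length [d + d]. *)
Lemma Wp_empirical_le (n : nat) (hn : (0 < n)%N) (x y : 'I_n -> V) :
  (Wp p (empirical_prob x hn) (empirical_prob y hn) `^ p <=
    (n%:R^-1 * \sum_(i < n) enorm (x i - y i) `^ p)%:E)%E.
Proof.
pose P := @empirical_prob R (d + d) n (fun i => row_mx (x i) (y i)) hn.
have ml : measurable_fun [set: 'rV[R]_(d + d)] (@lsubmx R 1 d d).
  apply: measurable_row => // j; under eq_fun do rewrite mxE.
  exact: measurable_coord.
have mr : measurable_fun [set: 'rV[R]_(d + d)] (@rsubmx R 1 d d).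
  apply: measurable_row => // j; under eq_fun do rewrite mxE.
  exact: measurable_coord.
have := @Wp_le_expectation R d p p0 (empirical_prob x hn) (empirical_prob y hn) _ _ P _ _ ml mr.
have -> : (\int[P]_w (enorm (lsubmx w - rsubmx w) `^ p)%:E =
          (n%:R^-1 * \sum_(i < n) enorm (x i - y i) `^ p)%:E)%E.
  rewrite integral_empirical.
  - rewrite EFinM -sumEFin; apply: congr1; apply: eq_bigr => i _.
    by rewrite row_mxKl row_mxKr.
  - apply/measurable_EFinP; apply: measurable_enorm_powR => //.
    exact: measurable_rowB.
  - by move=> z; rewrite lee_fin powR_ge0.
apply=> A mA; rewrite /P /= /empirical_prob; congr (_ * _)%E.
  apply: eq_bigr => i _; rewrite !diracE.
  suff -> : (row_mx (x i) (y i) \in lsubmx @^-1` A) = (x i \in A) by [].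
  by apply/idP/idP; rewrite !inE /= row_mxKl.
apply: eq_bigr => i _; rewrite !diracE.
suff -> : (row_mx (x i) (y i) \in rsubmx @^-1` A) = (y i \in A) by [].
by apply/idP/idP; rewrite !inE /= row_mxKr.
Qed.

Lemma Pp_continuousP (nu : R -> Pp d p) (c : R -> R -> R) :
  (forall s t, 0 <= s -> 0 <= t -> 0 <= c s t) ->
  (forall s t, 0 <= s -> 0 <= t -> (Wp p (nu s) (nu t) `^ p <= (c s t)%:E)%E) ->
  (forall t, 0 <= t -> c s t @[s --> within `[0, +oo[ (nbhs t)] --> 0) ->
  Pp_continuous nu.
Proof.
move=> c0 h ct t t0.
have wW : \forall s \near within `[0, +oo[%classic (nbhs t), 0 <= s.
  by apply: filterS (withinT _ (nbhs_filter t)) => s /=; rewrite in_itv/= andbT.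
apply: (@squeeze_cvge _ _ _ _ (fun=> 0%E) _ (fun s => (c s t `^ p^-1)%:E)).
- apply: filterS wW => s s0; rewrite Wp_ge0/=.
  by apply: Wp_le_root => //; [exact: c0|exact: h].
- exact: cvg_cst.
- apply/cvg_EFin; first by near=> s.
  rewrite -[X in _ --> X](@powR0 R p^-1) ?invr_eq0 ?gt_eqF//.
  apply: cvg_powR => //; last exact: ct.
    by rewrite invr_ge0 ltW.
  by apply: filterS wW => s s0; exact: c0.
Unshelve. all: by end_near. Qed.

Lemma Wp_cvg_near (nu : R -> Pp d p) (t e : R) : Pp_continuous nu -> 0 <= t -> 0 < e ->
  \forall s \near within `[0, +oo[%classic (nbhs t), (Wp p (nu t) (nu s) < e%:E)%E.
Proof.
move=> cnu t0 e0; have := cnu t t0 [set u | (u < e%:E)%E].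
have e0N : nbhs (0%E : \bar R) [set u | (u < e%:E)%E].
  by apply: open_nbhs_nbhs; split; [exact: open_ereal_lt_ereal|rewrite /= lte_fin].
move=> /(_ e0N) h.
have {}h : \forall s \near within `[0, +oo[%classic (nbhs t),
  (Wp p (nu s) (nu t) < e%:E)%E by exact: h.
by apply: filterS h => s /=; rewrite Wp_sym.
Qed.

(** A set that is open for [Wp] contains a [Wp]-ball around each of its points,
    so its preimage by a continuous flow is relatively open. *)
Lemma Pp_continuous_measurable (nu : R -> Pp d p) : Pp_continuous nu ->
  measurable_fun (`[0, +oo[%classic : set R) nu.
Proof.
move=> cnu; apply: (measurability (@Wp_open R d p)) => // _ [A oA <-].
pose B := [set s | 0 <= s -> A (nu s)].
have -> : `[0, +oo[%classic `&` nu @^-1` A = `[0, +oo[%classic `&` interior B.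
  apply/seteqP; split => [t [t0 At]|t [t0 At]]; (split; first exact: t0).
    have t0' : 0 <= t by move: t0; rewrite /= in_itv/= andbT.
    have [e e0 eA] := oA _ At.
    have := Wp_cvg_near cnu t0' e0; rewrite near_withinE; apply: filterS => s /= h s0.
    by apply/eA/h; rewrite in_itv/= s0.
  apply: (interior_subset At).
  by move: t0; rewrite /= in_itv/= andbT.
apply: measurableI => //; apply: open_measurable; exact: open_interior.
Qed.

(** The atoms determine the empirical measure continuously, by the coupling of
    equal indices, so the preimage of a [Wp]-open set is open in the matrix of
    the positions. *)
Lemma measurable_empirical (n : nat) (hn : (0 < n)%N) (dT : measure_display)
    (T : measurableType dT) (X : 'I_n -> T -> V) :
  (forall i, measurable_fun setT (X i)) ->
  measurable_fun setT (fun w => empirical p hn (fun i => X i w)).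
Proof.
move=> mX; apply: (measurability (@Wp_open R d p)) => // _ [A oA <-]; rewrite setTI.
pose Y w : 'M[R]_(n, d) := \matrix_(i, j) X i w 0 j.
pose G (M : 'M[R]_(n, d)) := empirical p hn (fun i => row i M).
have -> : (fun w => empirical p hn (X^~ w)) @^-1` A = Y @^-1` (G @^-1` A).
  rewrite /preimage; apply/funext => w /=; congr (A (empirical _ _ _)).
  by apply/funext => i; apply/rowP => j; rewrite !mxE.
have mY : measurable_fun setT Y.
  apply: measurable_fun_mx => // i j; under eq_fun do rewrite mxE.
  exact: (measurableT_comp (measurable_coord 0 j) (mX i)).
rewrite -[X in measurable X]setTI; apply: mY => //; apply: sub_sigma_algebra => /=.
rewrite openE => M AM; have [e e0 eA] := oA _ AM.
pose c (M' : 'M[R]_(n, d)) := n%:R^-1 * \sum_(i < n) enorm (row i M - row i M') `^ p.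
have cM : c M' @[M' --> M] --> 0.
  have h : \sum_(i < n) enorm (row i M - row i M') `^ p @[M' --> M]
      --> \sum_(i < n) (0 : R).
    apply: (cvg_sumr (F := nbhs M)) => i; rewrite -[X in _ --> X](@powR0 R p) ?gt_eqF//.
    apply: (cvg_powR (F := nbhs M)) => //; first exact: ltW.
      by near=> M'; exact: enorm_ge0.
    by apply/(cvg_enormB (F := nbhs M)); exact: row_continuous.
  have := @cvgM R _ (nbhs M) _ (fun=> n%:R^-1) _ (n%:R^-1) _ (cvg_cst _) h.
  by rewrite big1// mulr0; apply.
have ce : \forall M' \near M, c M' < e `^ p.
  by apply: cvgr_lt cM _ _; rewrite powR_gt0.
apply: filterS ce => M' ce; apply: eA.
have c0 : 0 <= c M'.
  by rewrite mulr_ge0// sumr_ge0// => i _; rewrite powR_ge0.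
apply: le_lt_trans (Wp_le_root p0 c0 (Wp_empirical_le _ _ _)) _.
rewrite lte_fin -[ltRHS](powRr1 (ltW e0)) -(@mulfV _ p) ?gt_eqF// powRrM.
by rewrite gt0_ltr_powR ?invr_gt0// nnegrE ?powR_ge0.
Unshelve. all: by end_near. Qed.

End empirical_distance.

(** * Positivity of the Fournier-Guillin rate *)

Section rate_positivity.
Context (R : realType).

Lemma rate_gt0 (C0 p q : R) (d n : nat) : 0 < C0 -> (0 < n)%N -> 0 < rate C0 p d q n.
Proof.
move=> C00 n0; have n1 : 0 < n%:R :> R by rewrite ltr0n.
rewrite /rate mulr_gt0//; case: ifPn => _; first by rewrite addr_gt0// powR_gt0.
case: ifPn => _; rewrite addr_gt0// ?mulr_gt0// ?powR_gt0//.
by rewrite ln_gt0// ltrDl.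
Qed.

Lemma mutually_independent_ord1 (disp : measure_display)
    (Omega : measurableType disp) (P : probability Omega R)
    (G : 'I_1 -> set (set Omega)) : mutually_independent P G.
Proof.
move=> J E _; have [->|[i iJ]] := set_0Vmem J.
  rewrite big_set0 (_ : [set` finset.set0] = set0) ?bigcap_set0 ?probability_setT//.
  by apply/seteqP; split => // i /=; rewrite inE.
have -> : J = [set i]%SET.
  by apply/setP => k; rewrite inE !ord1 eqxx -(ord1 i) iJ.
rewrite big_set1 (_ : [set` [set i]%SET] = [set i]) ?bigcap_set1//.
by apply/seteqP; split => k /=; rewrite inE => /eqP.
Qed.

Lemma measurable_row_set1 (d : nat) (w : 'rV[R]_d) : measurable [set w].
Proof.
have mf : measurable_fun setT (fun y : 'rV[R]_d => enorm (y - w)).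
  apply: (measurableT_comp (@measurable_enorm R d)).
  by apply: measurable_rowB.
have -> : [set w] = setT `&` (fun y : 'rV[R]_d => enorm (y - w)) @^-1` [set 0].
  rewrite setTI; apply/seteqP; split => [y /= ->|y /= /enorm_eq0 /eqP].
    by rewrite subrr enorm0.
  by rewrite subr_eq0 => /eqP.
by apply: mf => //; exact: measurable_set1.
Qed.

(** Every coupling with a Dirac mass is the product coupling. *)
Lemma Wp_dirac_ge (d n : nat) (p : R) (hn : (0 < n)%N) (x : 'I_n -> 'rV[R]_d)
    (w : 'rV[R]_d) (h1 : (0 < 1)%N) : 0 < p ->
  ((n%:R^-1 * \sum_(i < n) enorm (w - x i) `^ p)%:E <=
   Wp p (empirical_prob (fun _ : 'I_1 => w) h1) (empirical_prob x hn) `^ p)%E.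
Proof.
move=> p0; rewrite Wp_powR//; apply: le_ereal_inf_tmp => _ [pi hpi <-].
have mcost (f : 'rV[R]_d * 'rV[R]_d -> 'rV[R]_d) : measurable_fun setT f ->
    measurable_fun setT (fun z => (enorm (f z - z.2) `^ p)%:E).
  move=> mf; apply/measurable_EFinP; apply: measurable_enorm_powR => //.
  exact: measurable_rowB.
have mw := measurable_row_set1 w.
have pi0 : pi (~` ([set w] `*` setT)) = 0%E.
  rewrite probability_setC; last exact: measurableX.
  rewrite (hpi _ mw).1 /= /empirical_prob big_ord1 diracE mem_set// invr1 mule1.
  by rewrite subee.
have -> : (\int[pi]_z (enorm (z.1 - z.2) `^ p)%:E =
           \int[pi]_z (enorm (w - z.2) `^ p)%:E)%E.
  apply: ae_eq_integral => //; [exact: mcost|exact: (mcost (fun=> w))|].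
  exists (~` ([set w] `*` setT)); split => //.
    by apply: measurableC; exact: measurableX.
  by move=> z /= h [/= zw _]; apply: h => _; rewrite zw.
pose Y : {RV pi >-> 'rV[R]_d} := mfun_Sub (mem_set (@measurable_snd _ _ 'rV[R]_d 'rV[R]_d)).
have mf : measurable_fun setT (fun y : 'rV[R]_d => (enorm (w - y) `^ p)%:E).
  by apply/measurable_EFinP; apply: measurable_enorm_powR => //; exact: measurable_rowB.
rewrite -[leRHS](@ge0_integral_distribution _ _ _ _ _ pi Y (fun y => (enorm (w - y) `^ p)%:E))//; last first.
  by move=> y; rewrite lee_fin powR_ge0.
rewrite (@eq_measure_integral _ _ _ _ (empirical_prob x hn)); last first.
  move=> A mA _; rewrite /= -(hpi A mA).2; congr (pi _).
  by apply/seteqP; split => z //= [].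
rewrite integral_empirical//; last by move=> y; rewrite lee_fin powR_ge0.
by rewrite EFinM -sumEFin.
Qed.

(** With one observation of a law that charges two points equally, the
    distance to the empirical measure is bounded away from zero, so an
    admissible constant is positive. *)
Lemma fournier_guillin_constant_gt0 (p q C0 : R) (d : nat) :
  (0 < d)%N -> 0 < p -> fournier_guillin_constant p d q C0 -> 0 < C0.
Proof.
move=> d0 p0 hC; rewrite ltNge; apply/negP => C00.
pose e : 'rV[R]_d := const_mx 1.
have e0 : 0 < enorm e.
  rewrite lt_def enorm_ge0 andbT; apply/eqP => /enorm_eq0/rowP/(_ (Ordinal d0)).
  by rewrite !mxE => /eqP; rewrite oner_eq0.
pose x (i : 'I_2) : 'rV[R]_d := if i == ord0 then 0 else e.
pose mu := @empirical_prob R d 2 x isT.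
have := hC _ _ mu mu 1%N isT (fun=> id).
move=> /(_ (@empirical_moment R d 2 isT x q)) /(_ (fun=> @measurable_id _ _ _)).
have hiid : iid mu (fun _ : 'I_1 => @id 'rV[R]_d).
  by split => [|i j A mA //]; exact: mutually_independent_ord1.
move=> /(_ (fun=> fun A _ => erefl)) /(_ hiid).
apply/negP; rewrite -ltNge.
apply: (@le_lt_trans _ _ 0%E).
  apply: mule_le0_ge0; last exact: poweR_ge0.
  have r1 := @rate_gt0 1 p q d 1 ltr01 isT.
  by move: r1; rewrite /rate mul1r lee_fin => /ltW; exact: mulr_le0_ge0.
pose g (w : 'rV[R]_d) := 2%:R^-1 * \sum_(i < 2) enorm (w - x i) `^ p.
have g0 w : 0 <= g w by rewrite mulr_ge0// sumr_ge0// => i _; rewrite powR_ge0.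
apply: (@lt_le_trans _ _ (\int[mu]_w (g w)%:E)%E); last first.
  apply: ge0_le_integral_nonmeasurable => w _; first by rewrite lee_fin.
  exact: Wp_dirac_ge.
rewrite /mu integral_empirical; last by move=> y; rewrite lee_fin.
  rewrite sumEFin -EFinM lte_fin mulr_gt0//.
  apply: lt_le_trans (_ : g (x ord0) <= _); last first.
    by rewrite big_ord_recl lerDl sumr_ge0// => i _.
  rewrite /g mulr_gt0// big_ord_recl ltr_wpDl ?powR_ge0// big_ord1 /x /= sub0r enormN.
  by rewrite powR_gt0.
apply/measurable_EFinP; apply: measurable_funM => //; apply: measurable_sum => i.
by apply: measurable_enorm_powR => //; exact: measurable_rowB.
Qed.

End rate_positivity.

(** * Locally Lipschitz fields and vector integrals *)

Section locally_lipschitz.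
Context (R : realType) (d : nat).
Local Notation V := 'rV[R]_d.
Implicit Types (F : V -> V) (x : V).

Lemma mx_norm_le_enorm x : `|x| <= enorm x.
Proof.
rewrite /Num.norm /=; have [->|/mx_norm_neq0[[i j] /= ->]] := eqVneq (mx_norm x) 0.
  exact: enorm_ge0.
by rewrite ord1 ler_coord_enorm.
Qed.

Lemma enorm_le_mx_norm x : enorm x <= d%:R * `|x|.
Proof.
rewrite (le_trans (enorm_le_sum _))// mulr_natl -[X in _ *+ X]card_ord -sumr_const.
apply: ler_sum => j _; rewrite /Num.norm /= mx_normrE.
exact: (le_bigmax _ (fun ij : 'I_1 * 'I_d => `|x ij.1 ij.2|) (0, j)).
Qed.

Definition locally_lipschitz_field F :=
  forall x, exists2 U, nbhs x U & [lipschitz F y | y in U].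

(** Finitely many of the neighbourhoods where [F] is Lipschitz cover [K]; the
    index [n] is at once a Lipschitz constant for all of them and the inverse
    of a common radius. *)
Lemma lipschitz_near_compact F (K : set V) : locally_lipschitz_field F -> compact K ->
  exists n : nat, forall x y, K x -> enorm (x - y) < n.+1%:R^-1 ->
    enorm (F x - F y) <= n.+1%:R * enorm (x - y).
Proof.
move=> lF /compact_near_coveringP cK.
pose Q (n : nat) x := forall y, enorm (x - y) < n.+1%:R^-1 ->
  enorm (F x - F y) <= n.+1%:R * enorm (x - y).
have /(_ _) h := cK nat \oo Q _.
have {}h : \forall n \near \oo, K `<=` Q n.
  apply: h => x Kx.
  have [U /nbhs_ballP[r /= r0 rU] lU] := lF x.
  have [M M0 hM] := pinfty_ex_gt0 lU.
  have r20 : 0 < r / 2 by rewrite divr_gt0.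
  exists (ball x (r / 2), [set n | (d%:R * M <= n.+1%:R) && (n.+1%:R^-1 <= r / 2)]) => /=.
    split; first exact: nbhsx_ballx.
    near=> n; apply/andP; split.
      near: n; exists (Num.truncn (d%:R * M)) => // n /= hn.
      have dM0 : 0 <= d%:R * M by apply: mulr_ge0 => //; exact: ltW.
      have /andP[_ /ltW] := Num.Theory.truncn_itv dM0.
      by move=> /le_trans; apply; rewrite ler_nat ltnS.
    near: n; exists (Num.truncn (r / 2)^-1) => // n /= hn.
    have dM0 : 0 <= (r / 2)^-1 by rewrite invr_ge0 ltW.
    have /andP[_ /ltW h1] := Num.Theory.truncn_itv dM0.
    rewrite -[leRHS]invrK lef_pV2 ?posrE ?invr_gt0//.
    by rewrite (le_trans h1)// ler_nat ltnS.
  move=> [z n] /= [xz /andP[dMn nr]] y zy.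
  have Uz : U z by apply: rU; apply: le_ball xz; rewrite ler_pdivrMr// ler_pMr// ler1n.
  have Uy : U y.
    apply: rU; rewrite [r]splitr; apply: ball_triangle xz _.
    rewrite -ball_normE /ball_ /= (le_lt_trans (mx_norm_le_enorm _))//.
    exact: (lt_le_trans zy).
  rewrite (le_trans (enorm_le_mx_norm _))//.
  have := hM (z, y) (conj Uz Uy); rewrite /= => hzy.
  rewrite (le_trans (ler_wpM2l _ hzy))// mulrA.
  have dM0 : 0 <= d%:R * M by apply: mulr_ge0 => //; exact: ltW.
  exact: (ler_pM dM0 (normr_ge0 _) dMn (mx_norm_le_enorm _)).
have [n _ hn] := h; exists n => x y Kx; apply: hn => //=.
Unshelve. all: by end_near. Qed.

Lemma locally_lipschitz_continuous F : locally_lipschitz_field F -> continuous F.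
Proof.
move=> lF x; have [n hn] := lipschitz_near_compact lF (@compact_set1 _ x).
have cx : enorm (x - y) @[y --> nbhs x] --> 0.
  by apply/(cvg_enormB (F := nbhs x)); exact: cvg_id.
apply/(cvg_enormB (F := nbhs x)).
have n0 : (0 : R) < n.+1%:R^-1 by rewrite invr_gt0.
have h1 : \forall y \near x, enorm (x - y) < n.+1%:R^-1 by exact: cvgr_lt cx _ n0.
apply: (@squeeze_cvgr _ _ _ _ (fun=> 0) (fun y => n.+1%:R * enorm (x - y))).
- by apply: filterS h1 => y hy; rewrite enorm_ge0/=; exact: hn.
- exact: cvg_cst.
- have := @cvgM R _ (nbhs x) _ (fun=> n.+1%:R) _ (n.+1%:R) _ (cvg_cst _) cx.
  by rewrite mulr0; apply.
Qed.

End locally_lipschitz.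

Section vector_integral.
Context (R : realType) (d : nat) (disp : measure_display)
  (T : measurableType disp) (m : {measure set T -> \bar R}) (D : set T)
  (mD : measurable D).
Local Notation V := 'rV[R]_d.
Implicit Types (f g : T -> V).

Lemma eq_vintegral f g : (forall s, D s -> f s = g s) ->
  vintegral m D f = vintegral m D g.
Proof.
move=> fg; apply/rowP => j; rewrite !mxE; apply: eq_Rintegral => s.
by rewrite inE => /fg ->.
Qed.

Lemma vintegrableB f g : vintegrable m D f -> vintegrable m D g ->
  vintegrable m D (fun s => f s - g s).
Proof.
move=> intf intg j; under eq_fun do rewrite !mxE EFinB.
by apply: integrableB.
Qed.

Lemma vintegralB f g : vintegrable m D f -> vintegrable m D g ->
  vintegral m D (fun s => f s - g s) = vintegral m D f - vintegral m D g.
Proof.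
move=> intf intg; apply/rowP => j; rewrite !mxE.
rewrite -RintegralB//; [|exact: intf|exact: intg].
by apply: eq_Rintegral => s _; rewrite !mxE.
Qed.

Lemma integrable_edot (e : V) f : vintegrable m D f ->
  m.-integrable D (fun s => (edot e (f s))%:E).
Proof.
move=> intf; rewrite /edot.
under eq_fun do rewrite -sumEFin.
apply: integrable_sum => // j _.
under eq_fun do rewrite EFinM; apply: integrableZl => //; exact: intf.
Qed.

Lemma edot_vintegral (e : V) f : vintegrable m D f ->
  (edot e (vintegral m D f))%:E = (\int[m]_(s in D) (edot e (f s))%:E)%E.
Proof.
move=> intf; rewrite /edot -sumEFin.
under eq_integral do rewrite -sumEFin.
rewrite integral_sum//; last first.
  move=> j; under eq_fun do rewrite EFinM; apply: integrableZl => //; exact: intf.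
apply: eq_bigr => j _; under eq_integral do rewrite EFinM.
rewrite (integralZl mD (intf j)).
rewrite EFinM mxE fineK//; apply: integrable_fin_num => //; exact: intf.
Qed.

Lemma edot_vintegral_le (e : V) f (G : T -> \bar R) : vintegrable m D f ->
  (forall s, D s -> 0 <= G s)%E -> (forall s, D s -> (edot e (f s))%:E <= G s)%E ->
  ((edot e (vintegral m D f))%:E <= \int[m]_(s in D) G s)%E.
Proof.
move=> intf G0 fG; rewrite edot_vintegral//.
by apply: integral_le_ge0 => //; exact: integrable_edot.
Qed.

(** Pair the integral with itself and use the Cauchy-Schwarz inequality under
    the integral sign. *)
Lemma enorm_vintegral_le f (g : T -> R) : vintegrable m D f ->
  m.-integrable D (EFin \o g) -> (forall s, D s -> enorm (f s) <= g s) ->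
  enorm (vintegral m D f) <= \int[m]_(s in D) g s.
Proof.
move=> intf intg fg.
have g0 s : D s -> 0 <= g s by move=> Ds; exact: le_trans (enorm_ge0 _) (fg _ Ds).
set v := vintegral m D f.
have [v0|v0] := eqVneq (enorm v) 0; first by rewrite v0 Rintegral_ge0.
have {}v0 : 0 < enorm v by rewrite lt_def v0 enorm_ge0.
rewrite -(ler_pM2l v0) -expr2 enorm_sqr -RintegralZl// -lee_fin.
have intvg : m.-integrable D (fun s => (enorm v * g s)%:E).
  by under eq_fun do rewrite EFinM; apply: integrableZl.
rewrite fineK; last exact: integrable_fin_num.
apply: edot_vintegral_le => //.
  by move=> s Ds; rewrite lee_fin mulr_ge0 ?g0// ltW.
move=> s Ds; rewrite lee_fin (le_trans (edot_le _ _))// ler_pM2l//.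
exact: fg.
Qed.

Lemma vintegrable_dominated f (g : T -> R) : measurable_fun D f ->
  m.-integrable D (EFin \o g) -> (forall s, D s -> enorm (f s) <= g s) ->
  vintegrable m D f.
Proof.
move=> mf intg fg j; apply: le_integrable intg => //.
  apply/measurable_EFinP; exact: (measurableT_comp (measurable_coord 0 j) mf).
move=> s Ds /=; rewrite lee_fin (le_trans (ler_coord_enorm _ _))//.
by rewrite (le_trans (fg s Ds))// ler_norm.
Qed.

End vector_integral.

(** * The drift along a continuous path *)

Section increments.
Context (R : realType) (d : nat).
Local Notation V := 'rV[R]_d.
Local Notation leb := (@lebesgue_measure R).
Implicit Types (b : R -> V) (c : V).

Lemma vintegral_increment b (r t : R) : 0 <= r -> r <= t ->
  vintegrable leb `[0, t] b ->
  vintegral leb `[0, t] b - vintegral leb `[0, r] b = vintegral leb `]r, t] b.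
Proof.
move=> r0 rt intb; apply/rowP => j; rewrite !mxE.
by rewrite (Rintegral_itvB (intb j)) ?bnd_simp.
Qed.

Lemma vintegral_increment_le b c (r t eta : R) : 0 <= r -> r <= t ->
  vintegrable leb `[0, t] b ->
  (forall s, r <= s <= t -> enorm (b s - c) <= eta) ->
  enorm (vintegral leb `[0, t] b - vintegral leb `[0, r] b - (t - r) *: c)
    <= eta * (t - r).
Proof.
move=> r0 rt intb hb.
have intb' : vintegrable leb `]r, t] b.
  move=> j; apply: integrableS (intb j) => //; apply: subset_itv; rewrite bnd_simp//.
have lebrt : leb `]r, t] = (t - r)%:E.
  rewrite lebesgue_measure_itv/= lte_fin; move: rt; rewrite le_eqVlt => /predU1P[->|rt].
    by rewrite ltxx subrr.
  by rewrite rt EFinB.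
have intc (a : R) : leb.-integrable `]r, t] (EFin \o (fun=> a)).
  apply/integrableP; split; first exact/measurable_EFinP.
  by rewrite (eq_integral (cst `|a|%:E))// integral_cst//= lebrt -EFinM ltry.
have cE : vintegral leb `]r, t] (fun=> c) = (t - r) *: c.
  apply/rowP => j; rewrite !mxE Rintegral_cst// mulrC; congr (_ * _).
  by rewrite -[RHS]/(fine (t - r)%:E) -lebrt.
rewrite vintegral_increment// -cE -vintegralB//; last by move=> j; exact: intc.
have -> : eta * (t - r) = \int[leb]_(s in `]r, t]) eta.
  rewrite Rintegral_cst//; congr (_ * _).
  by rewrite -[LHS]/(fine (t - r)%:E) -lebrt.
apply: enorm_vintegral_le => //.
  by apply: vintegrableB => // j; exact: intc.
move=> s; rewrite /= in_itv/= => /andP[rs st]; apply: hb.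
by rewrite (ltW rs).
Qed.

(** The derivative is taken along sequences of increments because it is later
    exchanged with an expectation by dominated convergence. *)
Lemma vintegral_right_derivative b (t T : R) (h : nat -> R) : 0 <= t ->
  (forall s : R, 0 <= s <= T -> vintegrable leb `[0, s] b) ->
  b s @[s --> within `[0, T] (nbhs t)] --> b t ->
  (forall k, 0 < h k) -> (forall k, t + h k <= T) -> h k @[k --> \oo] --> 0 ->
  (h k)^-1 *: (vintegral leb `[0, t + h k] b - vintegral leb `[0, t] b)
    @[k --> \oo] --> b t.
Proof.
move=> t0 intb cb h0 hT hk; apply/cvg_enormB; apply/cvgrPdist_le => /= e e0.
have {}cb : \forall s \near within `[0, T]%classic (nbhs t), enorm (b t - b s) < e.
  by move/cvg_enormB : cb => cb; exact: cvgr_lt cb _ e0.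
move: cb; rewrite near_withinE => /nbhs_ballP[r /= r0 hr].
have {}hk : \forall k \near \oo, h k < r by exact: cvgr_lt hk _ r0.
apply: filterS hk => k hkr; rewrite sub0r normrN ger0_norm ?enorm_ge0//.
have tk : t <= t + h k by rewrite lerDl ltW.
have tk0 : 0 <= t + h k <= T by rewrite (le_trans t0) ?hT.
have := vintegral_increment_le (c := b t) (eta := e) t0 tk (intb _ tk0).
have -> : t + h k - t = h k by rewrite addrC addKr.
move=> H.
rewrite -enormN opprB -[X in _ - X](scalerK (lt0r_neq0 (h0 k))).
rewrite -scalerBr enormZ ger0_norm ?invr_ge0 ?(ltW (h0 k))//.
rewrite ler_pdivrMl// mulrC; apply: H => s /andP[ts st].
rewrite enormB ltW//; apply: hr => /=.
  rewrite /ball/= distrC ger0_norm ?subr_ge0//.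
  by rewrite ltrBlDl (le_lt_trans st)// ltrD2l.
by rewrite in_itv/= (le_trans t0)//= (le_trans st).
Qed.

End increments.

Section structural.
Context (R : realType) (d : nat) (p : R) (F : 'rV[R]_d -> 'rV[R]_d)
  (L : R -> R -> 'rV[R]_d -> Pp d p -> 'rV[R]_d)
  (u : R -> {measure set R -> \bar R}) (h1 h2 : R -> R -> R) (kappa : R)
  (hS : structural_assumption F L u h1 h2 kappa).
Local Notation V := 'rV[R]_d.
Local Notation clip := (Num.max (0 : R)).

Lemma clip_ge0 (s : R) : 0 <= clip s.
Proof. by rewrite le_max lexx. Qed.

Lemma clip_id (s : R) : 0 <= s -> clip s = s.
Proof. by move=> s0; apply/max_idPr. Qed.

Lemma clip_continuous : continuous (clip : R -> R).
Proof. by move=> x; apply: continuous_max; [exact: cst_continuous|exact: id]. Qed.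

Lemma measurable_clip : measurable_fun setT (clip : R -> R).
Proof. exact: continuous_measurable_fun clip_continuous. Qed.

Lemma p_gt0 : 0 < p.
Proof. exact: lt_le_trans (sa_p_ge1 hS). Qed.

(** Measurability of [L] is only given for nonnegative times, hence the
    positivity of [s]. *)
Lemma measurable_L_comp (t : R) (dT : measure_display) (T : measurableType dT)
    (s : T -> R) (x : T -> V) (nu : T -> Pp d p) : 0 <= t ->
  (forall z, 0 <= s z) -> measurable_fun setT s -> measurable_fun setT x ->
  measurable_fun setT nu -> measurable_fun setT (fun z => L t (s z) (x z) (nu z)).
Proof.
move=> t0 s0 ms mx mnu.
pose f z := (t, s z, x z, nu z).
have mf : measurable_fun setT f.
  by do 3 (apply: measurable_fun_pair => //).
have mL := sa_L_measurable hS.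
apply: (@measurable_comp _ _ _ _ _ _ _ (fun z : R * R * V * Pp d p => L z.1.1.1 z.1.1.2 z.1.2 z.2) _ f _ _ mL mf).
- have -> : [set z : R * R * V * Pp d p | 0 <= z.1.1.1 /\ 0 <= z.1.1.2] =
     (fun z => z.1.1.1) @^-1` `[0, +oo[%classic `&` (fun z => z.1.1.2) @^-1` `[0, +oo[%classic.
    by apply/seteqP; split => z /=; rewrite !in_itv/= !andbT.
  apply: measurableI; rewrite -[X in measurable X]setTI.
    have m1 : measurable_fun [set: R * R * V * Pp d p] (fun z => z.1.1.1).
      apply: (measurableT_comp measurable_fst).
      by apply: (measurableT_comp measurable_fst); exact: measurable_fst.
    exact: m1.
  have m2 : measurable_fun [set: R * R * V * Pp d p] (fun z => z.1.1.2).
    apply: (measurableT_comp measurable_snd).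
    by apply: (measurableT_comp measurable_fst); exact: measurable_fst.
  exact: m2.
- by move=> _ [z _ <-] /=; split.
Qed.

Lemma measurable_flow_clip (nu : R -> Pp d p) :
  measurable_fun (`[0, +oo[%classic : set R) nu -> measurable_fun setT (nu \o clip).
Proof.
move=> mnu; apply: (@measurable_comp _ _ _ _ _ _ _ _ _ _ _ _ mnu measurable_clip) => //.
by move=> _ [s _ <-] /=; rewrite in_itv/= clip_ge0.
Qed.

Lemma measurable_L_flow (t : R) (x : V) (nu : R -> Pp d p) : 0 <= t ->
  measurable_fun (`[0, +oo[%classic : set R) nu ->
  measurable_fun (`[0, t]%classic : set R) (fun s => L t s x (nu s)).
Proof.
move=> t0 mnu.
have : measurable_fun setT (fun s => L t (clip s) x ((nu \o clip) s)).
  apply: measurable_L_comp => //; [exact: clip_ge0|exact: measurable_clip|].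
  exact: measurable_flow_clip.
move=> /(measurable_funS _ _) h; have {}h := h `[0, t]%classic measurableT (fun=> fun=> Logic.I).
apply: eq_measurable_fun h => s; rewrite inE/= in_itv/= => /andP[s0 _].
by rewrite clip_id.
Qed.

Let measurable_kernel_clip (h : R -> R -> R) (t : R) : 0 <= t ->
  measurable_fun [set z : R * R | 0 <= z.1 /\ 0 <= z.2] (fun z => h z.1 z.2) ->
  measurable_fun setT (fun s => h t (clip s)).
Proof.
move=> t0 mh; apply: (@measurable_comp _ _ _ _ _ _ _ (fun z => h z.1 z.2) _ (fun s => (t, clip s)) _ _ mh).
- have -> : [set z : R * R | 0 <= z.1 /\ 0 <= z.2] = `[0, +oo[%classic `*` `[0, +oo[%classic.
    by apply/seteqP; split => z /=; rewrite !in_itv/= !andbT.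
  exact: measurableX.
- by move=> _ [s _ <-] /=; rewrite clip_ge0.
- by apply: measurable_fun_pair => //; exact: measurable_clip.
Qed.

Let measurable_kernel (h : R -> R -> R) (t : R) : 0 <= t ->
  measurable_fun [set z : R * R | 0 <= z.1 /\ 0 <= z.2] (fun z => h z.1 z.2) ->
  measurable_fun (`[0, t]%classic : set R) (h t).
Proof.
move=> t0 mh; have := measurable_funTS (D := `[0, t]%classic) (measurable_kernel_clip t0 mh).
apply: eq_measurable_fun => s.
by rewrite inE/= in_itv/= => /andP[s0 _]; rewrite clip_id.
Qed.

Lemma measurable_h2_clip (t : R) : 0 <= t -> measurable_fun setT (fun s => h2 t (clip s)).
Proof. by move=> t0; apply: measurable_kernel_clip => //; exact: sa_h2_measurable hS. Qed.

Lemma measurable_h1 (t : R) : 0 <= t -> measurable_fun (`[0, t]%classic : set R) (h1 t).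
Proof. by move=> t0; apply: measurable_kernel => //; exact: sa_h1_measurable hS. Qed.

Lemma measurable_h2 (t : R) : 0 <= t -> measurable_fun (`[0, t]%classic : set R) (h2 t).
Proof. by move=> t0; apply: measurable_kernel => //; exact: sa_h2_measurable hS. Qed.

Lemma integrable_h1 (t : R) : 0 <= t -> (u t).-integrable `[0, t] (EFin \o h1 t).
Proof.
move=> t0; apply/integrableP; split.
  by apply/measurable_EFinP; exact: measurable_h1.
rewrite (eq_integral (fun s => (h1 t s)%:E)); first exact: (sa_H1_finite hS t0).
move=> s; rewrite inE/= in_itv/= => /andP[s0 _].
by rewrite ger0_norm// (sa_h1_ge0 hS).
Qed.

Lemma integrable_h2 (t : R) : 0 <= t -> (u t).-integrable `[0, t] (EFin \o h2 t).
Proof.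
move=> t0; apply/integrableP; split.
  by apply/measurable_EFinP; exact: measurable_h2.
rewrite (eq_integral (fun s => (h2 t s)%:E)); first exact: (sa_H2_finite hS t0).
move=> s; rewrite inE/= in_itv/= => /andP[s0 _].
by rewrite ger0_norm// (sa_h2_ge0 hS).
Qed.

Lemma Hker_fin1 (t : R) : 0 <= t ->
  (\int[u t]_(s in `[0%R, t]) (h1 t s)%:E)%E = (Hker u h1 t)%:E.
Proof. by move=> t0; rewrite fineK//; apply: integrable_fin_num => //; exact: integrable_h1. Qed.

Lemma Hker_fin2 (t : R) : 0 <= t ->
  (\int[u t]_(s in `[0%R, t]) (h2 t s)%:E)%E = (Hker u h2 t)%:E.
Proof. by move=> t0; rewrite fineK//; apply: integrable_fin_num => //; exact: integrable_h2. Qed.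

(** Integrability in the memory variable at one point of space propagates to
    all points, since [L] is Lipschitz in space with integrable constant. *)
Lemma vintegrable_L_transfer (t : R) (x y : V) (nu : R -> Pp d p) : 0 <= t ->
  measurable_fun (`[0, +oo[%classic : set R) nu ->
  vintegrable (u t) `[0, t] (fun s => L t s x (nu s)) ->
  vintegrable (u t) `[0, t] (fun s => L t s y (nu s)).
Proof.
move=> t0 mnu intx.
have -> : (fun s => L t s y (nu s)) =
    (fun s => L t s x (nu s) - (L t s x (nu s) - L t s y (nu s))).
  by apply/funext => s; rewrite opprB addrC subrK.
apply: vintegrableB => //.
apply: (@vintegrable_dominated _ _ _ _ _ _ _ _ (fun s => h1 t s * enorm (x - y))) => //.
- by apply: measurable_rowB => //; exact: measurable_L_flow.
- under [X in _.-integrable _ X]eq_fun do rewrite /= EFinM.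
  by apply: integrableZr => //; exact: integrable_h1.
- move=> s; rewrite /= in_itv/= => /andP[s0 _].
  exact: (sa_L_lipschitz_x hS).
Qed.

Lemma memory_lipschitz (t : R) (x y : V) (nu : R -> Pp d p) : 0 <= t ->
  vintegrable (u t) `[0, t] (fun s => L t s x (nu s)) ->
  vintegrable (u t) `[0, t] (fun s => L t s y (nu s)) ->
  enorm (vintegral (u t) `[0, t] (fun s => L t s x (nu s)) -
         vintegral (u t) `[0, t] (fun s => L t s y (nu s)))
    <= Hker u h1 t * enorm (x - y).
Proof.
move=> t0 intx inty; rewrite -vintegralB// /Hker -RintegralZr//; last exact: integrable_h1.
apply: enorm_vintegral_le => //.
- exact: vintegrableB.
- under [X in _.-integrable _ X]eq_fun do rewrite /= EFinM.
  by apply: integrableZr => //; exact: integrable_h1.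
- move=> s; rewrite /= in_itv/= => /andP[s0 _].
  exact: (sa_L_lipschitz_x hS).
Qed.

(** The memory term is assumed continuous in time at a fixed position; moving
    the position costs at most [H^1] times the displacement, and [H^1] is
    bounded on [[0, T]]. *)
Lemma drift_path_continuous (nu : R -> Pp d p) (Y : R -> V) (T : R) :
  Pp_continuous nu ->
  (forall t : R, 0 <= t <= T -> Y s @[s --> within `[0, T] (nbhs t)] --> Y t) ->
  (forall t : R, 0 <= t <= T ->
     vintegrable (u t) `[0, t] (fun s => L t s (Y t) (nu s))) ->
  forall t : R, 0 <= t <= T ->
  drift F L u nu s (Y s) @[s --> within `[0, T] (nbhs t)] --> drift F L u nu t (Y t).
Proof.
move=> cnu cY intY t tT; have /andP[t0 _] := tT.
have mnu := Pp_continuous_measurable p_gt0 cnu.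
have cYt := cY t tT.
have cF := locally_lipschitz_continuous (sa_F_locally_lipschitz hS).
apply: cvgD; first by apply: cvgN; exact: (continuous_cvg _ (cF (Y t)) cYt).
pose I (s : R) (y : V) := vintegral (u s) `[0, s] (fun r => L s r y (nu r)).
have At : (`[0, +oo[%classic : set R) t by rewrite /= in_itv/= t0.
have cI : I s (Y t) @[s --> within `[0, T] (nbhs t)] --> I t (Y t).
  have /subspace_continuousP := @sa_L_time_continuous _ _ _ _ _ _ _ _ _ hS (Y t) nu cnu.
  move=> /(_ t At); apply: cvg_trans; apply: cvg_app; apply: within_subset.
  by move=> s /=; rewrite !in_itv/= andbT => /andP[].
have [D D0 hD] := sa_H_bounded hS T.
apply/cvg_enormB.
apply: (@squeeze_cvgr _ _ _ _ (fun=> 0)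
  (fun s => enorm (I t (Y t) - I s (Y t)) + D * enorm (Y t - Y s))).
- have w0 : \forall s \near within `[0, T]%classic (nbhs t), 0 <= s <= T.
    by apply: filterS (withinT _ (nbhs_filter t)) => s /=; rewrite in_itv/=.
  apply: filterS w0 => s sT; have /andP[s0 _] := sT; rewrite enorm_ge0/=.
  rewrite (le_trans (enorm_distD (I s (Y t)) _ _))// lerD2l.
  have := memory_lipschitz s0 (vintegrable_L_transfer (Y t) s0 mnu (intY s sT)) (intY s sT).
  move=> /le_trans; apply; rewrite ler_wpM2r ?enorm_ge0//.
  by have [] := hD s sT.
- exact: cvg_cst.
- rewrite -[X in _ --> X]addr0; apply: cvgD; first exact/cvg_enormB.
  rewrite -[X in _ --> X](mulr0 D); apply: cvgM; first exact: cvg_cst.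
  exact/cvg_enormB.
Qed.

End structural.

Section same_memory.
Context (R : realType) (d : nat).
Local Notation V := 'rV[R]_d.

Lemma vintegral_ae_eq (disp : measure_display) (T : measurableType disp)
    (m : {measure set T -> \bar R}) (D : set T) (f g : T -> V) : measurable D ->
  vintegrable m D f -> measurable_fun D g ->
  {ae m, forall s, D s -> f s = g s} ->
  vintegrable m D g /\ vintegral m D f = vintegral m D g.
Proof.
move=> mD intf mg fg.
have mgj j : measurable_fun D (fun s => (g s 0 j)%:E).
  by apply/measurable_EFinP; exact: (measurableT_comp (measurable_coord 0 j) mg).
have fgj j : ae_eq m D (fun s => (f s 0 j)%:E) (fun s => (g s 0 j)%:E).
  by apply: filterS fg => s fg Ds; rewrite fg.
have mfj j := measurable_int _ (intf j).
split; last first.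
  by apply/rowP => j; rewrite !mxE; congr fine; apply: ae_eq_integral.
move=> j; apply/integrableP; split => //.
have <- : (\int[m]_(s in D) `|(f s 0 j)%:E| = \int[m]_(s in D) `|(g s 0 j)%:E|)%E.
  apply: ae_eq_integral => //; [exact: measurableT_comp|exact: measurableT_comp|].
  by apply: filterS (fgj j) => s h Ds; rewrite h.
by have /integrableP[] := intf j.
Qed.

(** The drift reads the flow of laws only through [L], at the times charged by
    the memory; there a flow may be replaced by another one that [L] cannot
    distinguish, in particular by one that is continuous for [Wp]. *)
Definition same_memory (p : R) (L : R -> R -> V -> Pp d p -> V)
    (u : R -> {measure set R -> \bar R}) (T : R) (mu nu : R -> Pp d p) : Prop :=
  forall t, 0 <= t <= T ->
    {ae u t, forall s, 0 <= s <= t -> forall x, L t s x (mu s) = L t s x (nu s)}.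

Context (p : R) (F : V -> V) (L : R -> R -> V -> Pp d p -> V)
  (u : R -> {measure set R -> \bar R}) (h1 h2 : R -> R -> R) (kappa : R)
  (hS : structural_assumption F L u h1 h2 kappa).

Lemma same_memory_drift (T : R) (mu nu : R -> Pp d p) (t : R) (x : V) :
  same_memory L u T mu nu -> Pp_continuous nu -> 0 <= t <= T ->
  vintegrable (u t) `[0, t] (fun s => L t s x (mu s)) ->
  vintegrable (u t) `[0, t] (fun s => L t s x (nu s)) /\
  drift F L u mu t x = drift F L u nu t x.
Proof.
move=> smn cnu tT intx; have /andP[t0 _] := tT.
have mnu := Pp_continuous_measurable (p_gt0 hS) cnu.
have mg := measurable_L_flow hS x t0 mnu.
have h : {ae u t, forall s, s \in `[0, t] -> L t s x (mu s) = L t s x (nu s)}.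
  by apply: filterS (smn t tT) => s h; rewrite in_itv/= => /h.
by have [? E] := vintegral_ae_eq (measurable_itv _) intx mg h; split => //; rewrite /drift E.
Qed.

End same_memory.

Lemma continuous_path_segment (R : realType) (n : nat) (f : R -> 'rV[R]_n) (T : R) :
  {within `[0, +oo[, continuous f} ->
  forall t : R, 0 <= t <= T -> f s @[s --> within `[0, T] (nbhs t)] --> f t.
Proof.
move=> /subspace_continuousP cX t /andP[t0 tT].
have At : (`[0, +oo[%classic : set R) t by rewrite /= in_itv/= t0.
apply: cvg_trans (cX t At); apply: cvg_app; apply: within_subset.
by move=> s /=; rewrite !in_itv/= andbT => /andP[].
Qed.

Section solution_paths.
Context (R : realType) (d : nat) (p : R) (F : 'rV[R]_d -> 'rV[R]_d)
  (L : R -> R -> 'rV[R]_d -> Pp d p -> 'rV[R]_d)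
  (u : R -> {measure set R -> \bar R}) (h1 h2 : R -> R -> R) (kappa : R)
  (hS : structural_assumption F L u h1 h2 kappa) (T : R).
Local Notation V := 'rV[R]_d.
Local Notation leb := (@lebesgue_measure R).
Implicit Types (b x y : R -> V) (nu : R -> Pp d p).

(** One path of the equation on [[0, T]], with [b] the path of the noise. *)
Record solves_on b nu x : Prop := SolvesOn {
  solves_continuous : forall t : R, 0 <= t <= T -> x s @[s --> within `[0, T] (nbhs t)] --> x t ;
  solves_inner : forall t : R, 0 <= t <= T ->
    vintegrable (u t) `[0, t] (fun s => L t s (x t) (nu s)) ;
  solves_drift : forall t : R, 0 <= t <= T ->
    vintegrable leb `[0, t] (fun s => drift F L u nu s (x s)) ;
  solves_equation : forall t : R, 0 <= t <= T ->
    x t = x 0 + b t + vintegral leb `[0, t] (fun s => drift F L u nu s (x s)) }.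

Lemma solves_on_same_memory b mu nu x : Pp_continuous nu -> same_memory L u T mu nu ->
  solves_on b mu x -> solves_on b nu x.
Proof.
move=> cnu smn [cx intx intdx eqx].
have driftE t : 0 <= t <= T ->
    vintegrable (u t) `[0, t] (fun s => L t s (x t) (nu s)) /\
    drift F L u mu t (x t) = drift F L u nu t (x t).
  by move=> tT; apply: (same_memory_drift hS smn cnu tT); exact: intx.
split.
- exact: cx.
- by move=> t /driftE[].
- move=> t /andP[t0 tT] j; have t0T : 0 <= t <= T by rewrite t0.
  have := intdx t t0T j; apply: eq_integrable => // s.
  rewrite inE/= in_itv/= => /andP[s0 st]; congr EFin.
  by rewrite (driftE s _).2// s0 (le_trans st).
- move=> t tT; rewrite (eqx t tT).
  have -> // : vintegral leb `[0, t] (fun s => drift F L u mu s (x s)) =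
    vintegral leb `[0, t] (fun s => drift F L u nu s (x s)).
  apply: eq_vintegral => s.
  rewrite /= in_itv/= => /andP[s0 st]; rewrite (driftE s _).2// s0 (le_trans st)//.
  by case/andP: tT.
Qed.

Lemma solves_on_eq b nu nu' x x' : (forall s, 0 <= s -> nu s = nu' s) ->
  (forall s, 0 <= s -> x s = x' s) -> solves_on b nu x -> solves_on b nu' x'.
Proof.
move=> nuE xE [cx intx intdx eqx].
have driftE s : 0 <= s -> drift F L u nu s (x s) = drift F L u nu' s (x' s).
  move=> s0; rewrite /drift -xE//.
  have -> // : vintegral (u s) `[0, s] (fun r => L s r (x s) (nu r)) =
    vintegral (u s) `[0, s] (fun r => L s r (x s) (nu' r)).
  by apply: eq_vintegral => r; rewrite /= in_itv/= => /andP[r0 _]; rewrite nuE.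
split.
- move=> t tT; have /andP[t0 _] := tT; rewrite -(xE t t0); apply: cvg_trans (cx t tT).
  apply: near_eq_cvg; apply: filterS (withinT _ (nbhs_filter t)) => s /=.
  by rewrite in_itv/= => /andP[s0 _]; rewrite xE.
- move=> t tT j; have /andP[t0 _] := tT; have := intx t tT j; apply: eq_integrable => // s.
  by rewrite inE/= in_itv/= => /andP[s0 _]; rewrite xE// nuE.
- move=> t tT j; have := intdx t tT j; apply: eq_integrable => // s.
  by rewrite inE/= in_itv/= => /andP[s0 _]; rewrite driftE.
- move=> t tT; have /andP[t0 _] := tT; rewrite -!xE// (eqx t tT).
  have -> // : vintegral leb `[0, t] (fun s => drift F L u nu s (x s)) =
    vintegral leb `[0, t] (fun s => drift F L u nu' s (x' s)).
  by apply: eq_vintegral => s; rewrite /= in_itv/= => /andP[s0 _]; exact: driftE.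
Qed.

Lemma solves_drift_continuous b nu x : Pp_continuous nu -> solves_on b nu x ->
  forall t : R, 0 <= t <= T ->
  drift F L u nu s (x s) @[s --> within `[0, T] (nbhs t)] --> drift F L u nu t (x t).
Proof.
move=> cnu [cx intx _ _]; exact: (drift_path_continuous hS).
Qed.

Context (k : nat) (disp : measure_display) (Omega : measurableType disp)
  (P : probability Omega R) (Ft : R -> set (set Omega)) (sigma : 'M[R]_(d, k)).

Lemma sde_solves_on (B : R -> Omega -> 'rV[R]_k) (mu : Omega -> R -> Pp d p)
    (X : R -> Omega -> V) : sde_solution P Ft sigma F L u B mu X ->
  {ae P, forall w, {within `[0, +oo[, continuous (fun t => X t w)} /\
    solves_on (fun t => B t w *m sigma^T) (mu w) (fun t => X t w)}.
Proof.
move=> hX.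
apply: filterS3 (sde_continuous hX) (filterI (sde_inner_integrable hX) (sde_drift_integrable hX))
  (sde_equation hX) => w cX [intX intdX] eqX; split=> //; split.
- exact: continuous_path_segment.
- by move=> t /andP[t0 _]; exact: intX.
- by move=> t /andP[t0 _]; exact: intdX.
- by move=> t /andP[t0 _]; exact: eqX.
Qed.

End solution_paths.

(** * Euler scheme *)

Section euler.
Context (R : realType) (d : nat).
Local Notation V := 'rV[R]_d.
Local Notation leb := (@lebesgue_measure R).

(** Heine's theorem, with the modulus given by an integer. *)
Lemma uniformly_continuous_segment (g : R -> V) (T eta : R) : 0 < eta ->
  (forall t : R, 0 <= t <= T -> g s @[s --> within `[0, T] (nbhs t)] --> g t) ->
  exists n : nat, forall s r : R, 0 <= s <= T -> 0 <= r <= T -> `|s - r| < n.+1%:R^-1 ->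
    enorm (g s - g r) <= eta.
Proof.
move=> eta0 cg.
have /compact_near_coveringP cK := @segment_compact R 0 T.
pose Q (n : nat) s := forall r : R, 0 <= r <= T -> `|s - r| < n.+1%:R^-1 ->
  enorm (g s - g r) <= eta.
have {cK}h := cK nat \oo (fun n s => 0 <= s <= T -> Q n s) _.
have {}h : \forall n \near \oo, `[0, T] `<=` (fun s => 0 <= s <= T -> Q n s).
  apply: h => x /=; rewrite in_itv/= => x0.
  have e20 : 0 < eta / 2 by rewrite divr_gt0.
  have : \forall s \near within `[0, T]%classic (nbhs x), enorm (g x - g s) < eta / 2.
    by have /cvg_enormB cx := cg x x0; exact: cvgr_lt cx _ e20.
  rewrite near_withinE => /nbhs_ballP[r /= r0 hr].
  have r20 : 0 < r / 2 by rewrite divr_gt0.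
  exists (ball x (r / 2), [set n | n.+1%:R^-1 <= r / 2]) => /=.
    split; first exact: nbhsx_ballx.
    near=> n; near: n; exists (Num.truncn (r / 2)^-1) => // n /= hn.
    have dM0 : 0 <= (r / 2)^-1 by rewrite invr_ge0 ltW.
    have /andP[_ /ltW h1] := Num.Theory.truncn_itv dM0.
    rewrite -[leRHS]invrK lef_pV2 ?posrE ?invr_gt0//.
    by rewrite (le_trans h1)// ler_nat ltnS.
  move=> [z n] /= [xz nr] z0 y y0 zy.
  have xy : ball x r y.
    rewrite [r]splitr; apply: ball_triangle xz _.
    by rewrite /ball/=; exact: lt_le_trans zy nr.
  have xz' : ball x r z by apply: le_ball xz; rewrite ler_pdivrMr// ler_pMr// ler1n.
  have hz := hr z xz'; have hy := hr y xy; rewrite !in_itv/= in hz hy.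
  rewrite (le_trans (enorm_distD (g x) _ _))// [leRHS]splitr lerD//.
    by rewrite enormB ltW// hz.
  by rewrite ltW// hy.
have [n _ hn] := h; exists n => s r s0; apply: (hn n) => //=.
Unshelve. all: by end_near. Qed.

(** Explicit Euler scheme of step [h] for [dX = b(t, X) dt + dW]. *)
Fixpoint euler (b : R -> V -> V) (x0 : V) (W : R -> V) (h : R) (k : nat) : V :=
  if k is k'.+1 then
    euler b x0 W h k' + h *: b (k'%:R * h) (euler b x0 W h k') +
      (W (k'.+1%:R * h) - W (k'%:R * h))
  else x0.

Lemma measurable_euler (dS : measure_display) (S : measurableType dS)
    (b : R -> V -> V) (x0 : S -> V) (W : R -> S -> V) (h : R) (k : nat) : 0 <= h ->
  (forall j, (j < k)%N -> continuous (b (j%:R * h))) ->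
  measurable_fun setT x0 -> (forall t : R, 0 <= t -> measurable_fun setT (W t)) ->
  measurable_fun setT (fun w => euler b (x0 w) (W ^~ w) h k).
Proof.
move=> h0 + mx mW; elim: k => //= k ih cb.
have {}ih := ih (fun j jk => cb j (ltnW jk)).
have mD (f g : S -> V) : measurable_fun setT f -> measurable_fun setT g ->
    measurable_fun setT (fun w => f w + g w).
  move=> mf mg; apply: measurable_row => // j; under eq_fun do rewrite mxE.
  by apply: measurable_funD; apply: (measurableT_comp (measurable_coord 0 j)).
apply: (mD); last by apply: measurable_rowB => //; apply: mW; rewrite mulr_ge0.
apply: (mD) => //; apply: measurable_row => // j; under eq_fun do rewrite mxE.
apply: measurable_funM => //; apply: (measurableT_comp (measurable_coord 0 j)).
exact: (measurableT_comp (continuous_measurable_mx (cb k (ltnSn k)))).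
Qed.

(** Explicit Euler converges for a field that is merely locally Lipschitz
    because an exact solution is given: the scheme stays in the tube around
    its compact range on which a single Lipschitz constant is valid.  The
    local errors, of size [eta] times the step, accumulate at an exponential
    rate at most. *)
Lemma euler_converges (b : R -> V -> V) (X W : R -> V) (T delta ell : R) :
  0 < T -> 0 < delta -> 0 <= ell ->
  (forall t : R, 0 <= t <= T -> b s (X s) @[s --> within `[0, T] (nbhs t)] --> b t (X t)) ->
  (forall t : R, 0 <= t <= T -> vintegrable leb `[0, t] (fun s => b s (X s))) ->
  (forall t : R, 0 <= t <= T -> X t = X 0 + W t + vintegral leb `[0, t] (fun s => b s (X s))) ->
  (forall (s : R) y, 0 <= s <= T -> enorm (X s - y) < delta ->
     enorm (b s (X s) - b s y) <= ell * enorm (X s - y)) ->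
  euler b (X 0) W (T / m.+1%:R) m.+1 @[m --> \oo] --> X T.
Proof.
move=> T0 d0 l0 cb intb Xeq lipb.
apply/cvg_enormB/cvgrPdist_le => e e0.
set E := expR (ell * T).
have E0 : 0 < E by exact: expR_gt0.
(* [T * E] bounds the amplification of the local errors; the accumulated error
   then stays below [e], and below the radius [delta] of the tube *)
pose eta := Num.min e (delta / 2) / (T * E).
have TE0 : 0 < T * E by rewrite mulr_gt0.
have eta0 : 0 < eta by rewrite divr_gt0// lt_min e0 divr_gt0.
have etaE : eta * (T * E) = Num.min e (delta / 2) by rewrite divfK// gt_eqF.
have [n hn] := uniformly_continuous_segment (g := fun s => b s (X s)) eta0 cb.
exists (Num.truncn (T * n.+1%:R)) => // m hm; rewrite /= in hm.
set h := T / m.+1%:R.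
have h0 : 0 < h by rewrite divr_gt0.
have hh : h < n.+1%:R^-1.
  rewrite /h ltr_pdivrMr// [ltRHS]mulrC ltr_pdivlMr//.
  have TM0 : 0 <= T * n.+1%:R by rewrite mulr_ge0 ?ltW.
  have /andP[_ H] := Num.Theory.truncn_itv TM0.
  by rewrite (lt_le_trans H)// ler_nat ltnS.
have mh : m.+1%:R * h = T by rewrite /h mulrC divfK// pnatr_eq0.
pose x k := euler b (X 0) W h k.
pose g s := b s (X s).
have kT k : (k <= m.+1)%N -> 0 <= k%:R * h <= T.
  by move=> km; rewrite mulr_ge0 ?(ltW h0)//= -mh ler_wpM2r ?(ltW h0)// ler_nat.
have main k : (k <= m.+1)%N ->
    enorm (X (k%:R * h) - x k) <= eta * (k%:R * h) * expR (ell * (k%:R * h)).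
  elim: k => [_|k ih km]; first by rewrite mulr0n !(mul0r, mulr0) subrr enorm0.
  have {}ih := ih (ltnW km).
  have /andP[kh0 khT] := kT k (ltnW km); have /andP[kh0' khT'] := kT k.+1 km.
  set Ek := expR (ell * (k%:R * h)) in ih.
  have Ek1 : Ek <= E by rewrite ler_expR ler_wpM2l.
  have near : enorm (X (k%:R * h) - x k) < delta.
    rewrite (le_lt_trans ih)// (@le_lt_trans _ _ (eta * (T * E)))//.
      by rewrite -mulrA ler_wpM2l ?(ltW eta0)// ler_pM// expR_ge0.
    by rewrite etaE gt_min ltr_pdivrMr// ltr_pMr// ltr1n orbT.
  have lip := lipb _ _ (kT k (ltnW km)) near.
  have khS : k.+1%:R * h - k%:R * h = h by rewrite -mulrBl -natrB// subSnn mul1r.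
  have khle : k%:R * h <= k.+1%:R * h by rewrite -subr_ge0 khS ltW.
  have := vintegral_increment_le (c := g (k%:R * h)) (eta := eta) kh0 khle (intb _ (kT k.+1 km)).
  rewrite khS => /(_ _) inc.
  have {}inc : enorm (vintegral leb `[0, k.+1%:R * h] g - vintegral leb `[0, k%:R * h] g
      - h *: g (k%:R * h)) <= eta * h.
    apply: inc => s /andP[s1 s2]; apply: hn.
    - by rewrite (le_trans kh0)//= (le_trans s2).
    - exact: kT (ltnW km).
    - rewrite ger0_norm ?subr_ge0// (le_lt_trans _ hh)// -[leRHS]khS.
      by rewrite lerB.
  (* local error of one step, then the propagation of the previous error *)
  have -> : X (k.+1%:R * h) - x k.+1 =
      (vintegral leb `[0, k.+1%:R * h] g - vintegral leb `[0, k%:R * h] g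
        - h *: g (k%:R * h)) +
      ((X (k%:R * h) - x k) + h *: (g (k%:R * h) - b (k%:R * h) (x k))).
    rewrite (Xeq _ (kT _ km)) (Xeq _ (kT _ (ltnW km))) /= -/(x k) -/g scalerBr; apply/rowP => j; rewrite !mxE.
    ring.
  rewrite (le_trans (enormD _ _))//.
  have h2 : enorm ((X (k%:R * h) - x k) + h *: (g (k%:R * h) - b (k%:R * h) (x k)))
      <= (1 + ell * h) * (eta * (k%:R * h) * Ek).
    rewrite (le_trans (enormD _ _))// enormZ (gtr0_norm h0).
    rewrite (@le_trans _ _ ((1 + ell * h) * enorm (X (k%:R * h) - x k)))//.
      have lip' := ler_wpM2l (ltW h0) lip.
      by rewrite mulrDl mul1r lerD2l (le_trans lip')// mulrA [h * ell]mulrC.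
    by rewrite ler_wpM2l// addr_ge0// mulr_ge0// ltW.
  rewrite (le_trans (lerD inc h2))//.
  have Ek' : (1 + ell * h) * Ek <= expR (ell * (k.+1%:R * h)).
    have -> : ell * (k.+1%:R * h) = ell * h + ell * (k%:R * h).
      by rewrite -mulrDr -natr1; congr (_ * _); ring.
    by rewrite expRD ler_wpM2r ?expR_ge0// expR_ge1Dx.
  have E1 : 1 <= expR (ell * (k.+1%:R * h)) by rewrite (le_trans _ (expR_ge1Dx _))// lerDl mulr_ge0.
  have -> : (1 + ell * h) * (eta * (k%:R * h) * Ek) = eta * (k%:R * h) * ((1 + ell * h) * Ek).
    ring.
  have -> : eta * (k.+1%:R * h) = eta * h + eta * (k%:R * h) by rewrite -natr1; ring.
  rewrite [leRHS]mulrDl lerD//; first by rewrite ler_peMr// mulr_ge0 ?ltW.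
  by rewrite ler_wpM2l// mulr_ge0// ltW.
have := main m.+1 (leqnn _); rewrite mh sub0r normrN ger0_norm ?enorm_ge0// => /le_trans.
by apply; rewrite -mulrA etaE ge_min lexx.
Qed.

End euler.

(** * Mutual independence *)

Section independence.
Context (disp : measure_display) (Omega : measurableType disp) (R : realType)
  (P : probability Omega R).

Lemma measure_eq_ae (A B : set Omega) : measurable A -> measurable B ->
  {ae P, forall w, A w <-> B w} -> P A = P B.
Proof.
move=> mA mB [N [mN PN0 sN]].
have PD C : measurable C -> P C = P (C `&` ~` N).
  move=> mC; apply/eqP; rewrite eq_le; apply/andP; split; last first.
    by apply: le_measure; rewrite ?inE//; exact: measurableI mC (measurableC mN).
  have CE : C = (C `&` ~` N) `|` (C `&` N) by rewrite -setIUr setUC setUv setIT.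
  have mCN := measurableI _ _ mC mN; have mCN' := measurableI _ _ mC (measurableC mN).
  rewrite {1}CE (le_trans (measureU2 _ mCN' mCN))//.
  have : (P (C `&` N) <= P N)%E by apply: le_measure; rewrite ?inE.
  by rewrite PN0 => PCN; rewrite -[leRHS]adde0 leeD2l.
rewrite (PD A)// (PD B)//; congr (P _); apply/seteqP; split => w [Aw Nw]; split => //.
  have [h _] : A w <-> B w by apply: contrapT => nAB; apply: Nw; exact: sN.
  exact: h.
have [_ h] : A w <-> B w by apply: contrapT => nAB; apply: Nw; exact: sN.
exact: h.
Qed.

Lemma bigcap_finset_measurable (I : finType) (J : {set I}) (E : I -> set Omega) :
  (forall i, i \in J -> measurable (E i)) -> measurable (\bigcap_(i in [set` J]) E i).
Proof. by move=> mE; apply: fin_bigcap_measurable => // i iJ; exact: mE. Qed.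

Section generators.
Context (I : finType) (C : I -> set (set Omega)).
Context (CI : forall i, setI_closed (C i)) (CT : forall i, C i setT)
  (Cm : forall i, C i `<=` measurable).

Let sCm i : <<s C i >> `<=` measurable.
Proof. by apply: smallest_sub => //; exact: sigma_algebra_measurable. Qed.

(** Independence passes from pi-systems to the sigma-algebras that they
    generate, one index at a time: with the other events fixed, both sides of
    the product formula are finite measures of the remaining one. *)
Lemma mutually_independent_generated : mutually_independent P C ->
  mutually_independent P (fun i => <<s C i >>).
Proof.
move=> indC J.
suff main (s : seq I) (E : I -> set Omega) :
    (forall i, i \in s -> <<s C i >> (E i)) ->
    (forall i, i \in J -> i \notin s -> C i (E i)) ->
    (forall i, i \in s -> i \in J) -> uniq s ->
    P (\bigcap_(i in [set` J]) E i) = (\prod_(i in J) P (E i))%E.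
  move=> E hE; apply: (main (enum J)) => [i|i iJ|i|].
  - by rewrite mem_enum; exact: hE.
  - by rewrite mem_enum iJ.
  - by rewrite mem_enum.
  - exact: enum_uniq.
elim: s E => [|k s ih] E hE1 hE2 sJ us; first by apply: indC => i iJ; exact: hE2.
have kJ : k \in J by apply: sJ; rewrite mem_head.
have /andP[ks us'] : (k \notin s) && uniq s by [].
have mE i : i \in J -> measurable (E i).
  move=> iJ; have [/hE1/sCm//|] := boolP (i \in k :: s); by move=> /(hE2 _ iJ)/Cm.
pose D := \bigcap_(i in [set` (J :\ k)%SET]) E i.
have mD : measurable D.
  by apply: bigcap_finset_measurable => i; rewrite !inE => /andP[_ /mE].
pose c := (\prod_(i in (J :\ k)%SET) fine (P (E i)))%R.
have c0 : 0 <= c by apply: prodr_ge0 => i _; rewrite fine_ge0.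
have cE : (\prod_(i in (J :\ k)%SET) P (E i))%E = c%:E.
  rewrite /c -prodEFin; apply: eq_bigr => i; rewrite !inE => /andP[_ /mE mEi].
  by rewrite fineK// fin_num_measure.
have split_cap A : \bigcap_(i in [set` J]) (if i == k then A else E i) = A `&` D.
  apply/seteqP; split => w.
    move=> h; split; first by have := h k kJ; rewrite eqxx.
    move=> i /=; rewrite !inE => /andP[ik iJ].
    by have := h i iJ; rewrite (negbTE ik).
  move=> [Aw Dw] i /= iJ; case: eqP => [//|/eqP ik].
  by apply: (Dw i) => /=; rewrite !inE ik.
have split_prod A : (\prod_(i in J) P (if i == k then A else E i) = P A * c%:E)%E.
  rewrite (big_setD1 k kJ) /= eqxx -cE; congr (_ * _)%E.
  by apply: eq_bigr => i; rewrite !inE => /andP[/negbTE ->].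
have Ek i : (if i == k then E k else E i) = E i by case: eqP => [->|].
have -> : (\prod_(i in J) P (E i) = P (E k) * c%:E)%E.
  by rewrite -split_prod; apply: eq_bigr => i _; rewrite Ek.
have -> : \bigcap_(i in [set` J]) E i = E k `&` D.
  by rewrite -split_cap; apply: eq_bigcapr => i _; rewrite Ek.
rewrite muleC.
apply: (@g_sigma_algebra_measure_unique _ R Omega (C k) (@Cm k) (fun=> setT) _ _
  (mrestr P mD) (mscale (NngNum c0) P) (@CI k) _ _ (E k)).
- by move=> _; exact: CT.
- by apply/seteqP; split => // w _; exists 0%N.
- move=> A CA.
  transitivity (P (A `&` D)); first by [].
  transitivity (P A * c%:E)%E; last by rewrite muleC.
  rewrite -split_cap -split_prod.
  apply: ih => [i is_|i iJ is_|i is_|//].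
  + case: eqP => [ik|_]; first by move: ks; rewrite -ik is_.
    by apply: hE1; rewrite inE is_ orbT.
  + case: eqP => [->//|/eqP ik]; apply: hE2 => //.
    by rewrite inE negb_or ik.
  + by apply: sJ; rewrite inE is_ orbT.
- move=> _; apply: (@le_lt_trans _ _ (P setT)); last by rewrite probability_setT ltry.
  by apply: le_measure; rewrite ?inE//; exact: measurableI.
- by apply: hE1; rewrite mem_head.
Qed.

End generators.

(** Independence is insensitive to null sets, so a version [Z] of [Y] may be
    used to place [Y] in independent sigma-algebras. *)
Lemma mutually_independent_ae (I : finType) (G : I -> set (set Omega)) (n : nat)
    (Y Z : I -> Omega -> 'rV[R]_n) :
  (forall i, G i `<=` measurable) -> mutually_independent P G ->
  (forall i, measurable_fun setT (Y i)) ->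
  (forall i, g_sigma_algebra_preimage (Z i) `<=` G i) ->
  (forall i, {ae P, forall w, Y i w = Z i w}) ->
  mutually_independent P (fun i => g_sigma_algebra_preimage (Y i)).
Proof.
move=> Gm indG mY ZG YZ J E hE.
have /choice[A hA] : forall i, exists A : set 'rV[R]_n, measurable A /\
    (i \in J -> E i = Y i @^-1` A).
  move=> i; have [iJ|iJ] := boolP (i \in J); last by exists set0.
  by have [A mA <-] := hE i iJ; exists A; rewrite setTI.
have mYA i : measurable (Y i @^-1` A i).
  by rewrite -[X in measurable X]setTI; apply: mY => //; exact: (hA i).1.
have GZA i : G i (Z i @^-1` A i).
  by apply: ZG; exists (A i); [exact: (hA i).1|rewrite setTI].
have PYZ i : P (Y i @^-1` A i) = P (Z i @^-1` A i).
  apply: measure_eq_ae => //; first exact: Gm (GZA i).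
  by apply: filterS (YZ i) => w /= ->.
have -> : (\prod_(i in J) P (E i) = \prod_(i in J) P (Z i @^-1` A i))%E.
  by apply: eq_bigr => i iJ; rewrite (hA i).2// PYZ.
rewrite -indG; last by move=> i _; exact: GZA.
apply: measure_eq_ae.
- by apply: bigcap_finset_measurable => i iJ; rewrite (hA i).2.
- by apply: bigcap_finset_measurable => i iJ; exact: Gm (GZA i).
- have : {ae P, forall w, forall i, Y i w = Z i w}.
    by apply: (@filter_forall Omega I (fun i w => Y i w = Z i w)).
  apply: filterS => w YZw; split => h i iJ.
    by have := h i iJ; rewrite (hA i).2//= YZw.
  by have := h i iJ; rewrite (hA i).2//= YZw.
Qed.

(** The upper limit of the coordinates is measurable everywhere, and agrees
    with the limit where that exists. *)
Lemma measurable_limit (dS : measure_display) (S : measurableType dS) (n : nat)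
    (f : nat -> S -> 'rV[R]_n) : (forall m, measurable_fun setT (f m)) ->
  exists2 Z : S -> 'rV[R]_n, measurable_fun setT Z &
    forall w y, f m w @[m --> \oo] --> y -> y = Z w.
Proof.
move=> mf.
exists (fun w => \row_j fine (limn_esup (fun m => (f m w 0 j)%:E))).
  apply: measurable_row => // j; under eq_fun do rewrite mxE.
  apply: (measurableT_comp (f := @fine R)) => //.
  apply: measurable_fun_limn_esup => m; apply/measurable_EFinP.
  exact: (measurableT_comp (measurable_coord 0 j) (mf m)).
move=> w y fy; apply/rowP => j; rewrite mxE.
have h : (f m w 0 j)%:E @[m --> \oo] --> (y 0 j)%:E.
  by apply/cvg_EFin; [exact: nearW|exact: (@cvg_coord R 1 n nat \oo _ (f ^~ w) y 0 j fy)].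
by rewrite (cvg_limn_einf_sup h).2.
Qed.

End independence.

(** * Independence of the limit particles *)

Lemma sigma_algebra_bigcap_finset (T : pointedType) (G : set (set T)) (I : finType)
    (J : {set I}) (A : I -> set T) : sigma_algebra setT G ->
  (forall i, i \in J -> G (A i)) -> G (\bigcap_(i in [set` J]) A i).
Proof.
move=> sG hA; rewrite -(sigma_algebra_id sG).
apply: (@fin_bigcap_measurable _ (g_sigma_algebraType G)) => // i iJ.
by apply: sub_sigma_algebra; exact: hA.
Qed.

Lemma sigma_algebra_setI (T : pointedType) (G : set (set T)) :
  sigma_algebra setT G -> setI_closed G.
Proof.
move=> sG A D GA GD; rewrite -(sigma_algebra_id sG).
by apply: (@measurableI _ (g_sigma_algebraType G)); exact: sub_sigma_algebra.
Qed.

Section ae_facts.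
Context (disp : measure_display) (Omega : measurableType disp) (R : realType)
  (P : probability Omega R).

Lemma ae_witness (Q : Omega -> Prop) : {ae P, forall w, Q w} -> exists w, Q w.
Proof.
move=> [N [mN PN0 sN]]; apply: contrapT => nQ.
have : (P setT <= P N)%E.
  apply: le_measure; rewrite ?inE// => w _; apply: sN => Qw.
  by apply: nQ; exists w.
by rewrite PN0 probability_setT leNgt lte01.
Qed.

End ae_facts.

Section particles_independent.
Context (R : realType) (d k N : nat) (p : R)
  (disp : measure_display) (Omega : measurableType disp)
  (P : probability Omega R) (Ft : R -> set (set Omega)) (hFt : filtration Ft)
  (sigma : 'M[R]_(d, k)) (F : 'rV[R]_d -> 'rV[R]_d)
  (L : R -> R -> 'rV[R]_d -> Pp d p -> 'rV[R]_d)
  (u : R -> {measure set R -> \bar R}) (h1 h2 : R -> R -> R) (kappa : R)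
  (hS : structural_assumption F L u h1 h2 kappa).
Local Notation V := 'rV[R]_d.
Local Notation leb := (@lebesgue_measure R).

Lemma adapted_measurable (n : nat) (X : R -> Omega -> 'rV[R]_n) (t : R) :
  adapted Ft X -> 0 <= t -> measurable_fun setT (X t).
Proof.
move=> aX t0 _ A mA; rewrite setTI.
apply: (filtration_measurable hFt t0); apply: aX => //.
by exists A => //; rewrite setTI.
Qed.

(** Along almost every path the solution is the limit of the Euler scheme
    driven by the same noise, hence a measurable function of the initial
    condition and of the noise. *)
Lemma sde_euler_limit (B : R -> Omega -> 'rV[R]_k) (X : R -> Omega -> V)
    (mu nu : R -> Pp d p) (T : R) : 0 < T ->
  sde_solution P Ft sigma F L u B (fun=> mu) X ->
  Pp_continuous nu -> same_memory L u T mu nu ->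
  {ae P, forall w, euler (drift F L u nu) (X 0 w) (fun t => B t w *m sigma^T)
    (T / m.+1%:R) m.+1 @[m --> \oo] --> X T w}.
Proof.
move=> T0 hX cnu smn; have mnu := Pp_continuous_measurable (p_gt0 hS) cnu.
apply: filterS (sde_solves_on T hX) => w [_ /(solves_on_same_memory hS cnu smn) sX].
have cXT := solves_continuous sX.
have compactX : compact [set X s w | s in `[0, T]].
  apply: continuous_compact; last exact: segment_compact.
  by apply/subspace_continuousP => s; rewrite /= in_itv/=; exact: cXT.
have [n hn] := lipschitz_near_compact (sa_F_locally_lipschitz hS) compactX.
have [D D0 hD] := sa_H_bounded hS T.
apply: (@euler_converges R d (drift F L u nu) (X ^~ w) (fun t => B t w *m sigma^T) T
  n.+1%:R^-1 (n.+1%:R + D)) => //.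
- by rewrite addr_ge0.
- exact: (solves_drift_continuous hS cnu sX).
- exact: solves_drift sX.
- exact: solves_equation sX.
- move=> s y sT near; have /andP[s0 _] := sT.
  rewrite /drift opprD addrACA (le_trans (enormD _ _))// mulrDl lerD//.
    have Xs : [set X s w | s in `[0, T]] (X s w) by exists s => //; rewrite /= in_itv.
    by rewrite -opprD enormN; exact: hn Xs near.
  have int1 := solves_inner sX sT.
  rewrite (le_trans (memory_lipschitz hS s0 int1 (vintegrable_L_transfer hS y s0 mnu int1)))//.
  by rewrite ler_wpM2r ?enorm_ge0//; have [] := hD s sT.
Qed.

Lemma drift_continuous (nu : R -> Pp d p) (t : R) : 0 <= t -> Pp_continuous nu ->
  (exists x, vintegrable (u t) `[0, t] (fun s => L t s x (nu s))) ->
  continuous (drift F L u nu t).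
Proof.
move=> t0 cnu [x0 int0] x.
have mnu := Pp_continuous_measurable (p_gt0 hS) cnu.
have inty y := vintegrable_L_transfer hS y t0 mnu int0.
have cF := locally_lipschitz_continuous (sa_F_locally_lipschitz hS).
rewrite /continuous_at /drift.
have cx : enorm (x - y) @[y --> nbhs x] --> 0.
  by apply/(cvg_enormB (F := nbhs x)); exact: cvg_id.
apply: (@cvgD _ _ _ (nbhs x)); first by apply: (@cvgN _ _ _ (nbhs x)); exact: cF.
apply/(cvg_enormB (F := nbhs x)).
apply: (@squeeze_cvgr _ _ _ _ (fun=> 0) (fun y => Hker u h1 t * enorm (x - y))).
- by near=> y; rewrite enorm_ge0/=; exact: (memory_lipschitz hS).
- exact: cvg_cst.
- have := @cvgM R _ (nbhs x) _ (fun=> Hker u h1 t) _ (Hker u h1 t) _ (cvg_cst _) cx.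
  by rewrite mulr0; apply.
Unshelve. all: by end_near. Qed.

Context (B : 'I_N -> R -> Omega -> 'rV[R]_k)
  (hB : forall i, brownian_motion P Ft (B i))
  (G0 : set (set Omega)) (Xbar : 'I_N -> R -> Omega -> V) (mu nu : R -> Pp d p)
  (hindep : mutually_independent P (fun o : option 'I_N =>
     if o is Some i then process_sigma_algebra (B i) else G0))
  (hG0 : sigma_algebra setT G0)
  (hG0X : forall i, g_sigma_algebra_preimage (Xbar i 0) `<=` G0)
  (hXbar : forall i, sde_solution P Ft sigma F L u (B i) (fun=> mu) (Xbar i))
  (hXbar0 : mutually_independent P (fun i => g_sigma_algebra_preimage (Xbar i 0))).

Let g0 i := g_sigma_algebra_preimage (Xbar i 0).
Let C i := [set E | exists A D, [/\ g0 i A, process_sigma_algebra (B i) D & E = A `&` D]].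

Let g0_sigma i : sigma_algebra setT (g0 i).
Proof. by apply: sigma_algebra_preimage; exact: sigma_algebra_measurable. Qed.

Let pB_sigma i : sigma_algebra setT (process_sigma_algebra (B i)).
Proof. exact: smallest_sigma_algebra. Qed.

Let sigmaT (G : set (set Omega)) : sigma_algebra setT G -> G setT.
Proof. by move=> [G00 GC _]; have := GC set0 G00; rewrite setD0. Qed.

Let pB_measurable i : process_sigma_algebra (B i) `<=` measurable.
Proof.
apply: smallest_sub; first exact: sigma_algebra_measurable.
move=> A [t /=]; rewrite in_itv/= andbT => t0 [E mE <-].
exact: (adapted_measurable (bm_adapted (hB i)) t0).
Qed.

Let g0_measurable i : g0 i `<=` measurable.
Proof.
move=> A [E mE <-].
exact: (adapted_measurable (sde_adapted (hXbar i)) (lexx 0)).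
Qed.

Let noise_independent (J : {set 'I_N}) (A : set Omega) (D : 'I_N -> set Omega) :
  G0 A -> (forall i, process_sigma_algebra (B i) (D i)) ->
  P (A `&` \bigcap_(i in [set` J]) D i) = (P A * \prod_(i in J) P (D i))%E.
Proof.
move=> GA pD.
pose K : {set option 'I_N} := (None |: [set Some i | i in J])%SET.
pose E' (o : option 'I_N) := if o is Some i then D i else A.
have := hindep (J := K) (E := E'); rewrite big_setU1 /=; last first.
  by apply/imsetP => -[].
rewrite big_imset /=; last by move=> i j _ _ [].
move=> <-; last by move=> [i|] _ /=; [exact: pD|].
congr (P _); apply/seteqP; split => [w [Aw Dw] [i|] /=|w h].
- by rewrite !inE /= => /imsetP[j jJ [->]]; exact: Dw.
- by [].
- split; first by apply: (h None) => /=; rewrite !inE.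
  move=> i /= iJ; apply: (h (Some i)) => /=; rewrite !inE /=.
  by apply/imsetP; exists i.
Qed.

Let C_independent : mutually_independent P C.
Proof.
move=> J E hE.
have /choice[A hA] : forall i, exists A, g0 i A /\ exists D,
    process_sigma_algebra (B i) D /\ (i \in J -> E i = A `&` D).
  move=> i; have [iJ|iJ] := boolP (i \in J).
    by have [A [D [gA pD ->]]] := hE i iJ; exists A; split => //; exists D.
  exists setT; split; first exact: sigmaT (g0_sigma i).
  by exists setT; split => //; exact: sigmaT (pB_sigma i).
have /choice[D hD] := fun i => (hA i).2.
have pD i := (hD i).1.
pose AJ := \bigcap_(i in [set` J]) A i.
have G0AJ : G0 AJ.
  apply: sigma_algebra_bigcap_finset => // i _; apply: (@hG0X i); exact: (hA i).1.
have -> : \bigcap_(i in [set` J]) E i = AJ `&` \bigcap_(i in [set` J]) D i.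
  apply/seteqP; split => [w h|w [Aw Dw] i /= iJ].
    by split => i /= iJ; have := h i iJ; rewrite (hD i).2// => -[].
  by rewrite (hD i).2//; split; [exact: Aw|exact: Dw].
rewrite noise_independent// hXbar0; last by move=> i _; exact: (hA i).1.
rewrite -big_split /=; apply: eq_bigr => i iJ.
rewrite (hD i).2//.
have := noise_independent [set i]%SET (hG0X (hA i).1) pD.
rewrite big_set1 => <-; congr (P (_ `&` _)).
by apply/seteqP; split => [w h|w Dw j /=]; [apply: h; rewrite /= inE|rewrite inE => /eqP ->].
Qed.

(** The intersections of an event of the initial condition with an event of
    the noise of particle [i] form a pi-system, independent over [i] because
    the initial conditions are, and because the noises are independent of each
    other and of all the initial conditions.  The Euler scheme of the particle is measurable for the
    generated sigma-algebra, and so is its limit up to a null set. *)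
Lemma sde_mutually_independent (T : R) : 0 < T ->
  Pp_continuous nu -> same_memory L u T mu nu ->
  mutually_independent P (fun i => g_sigma_algebra_preimage (Xbar i T)).
Proof.
move=> T0 cnu smn.
have CT i : C i setT.
  exists setT, setT; split; [exact: sigmaT (g0_sigma i)|exact: sigmaT (pB_sigma i)|].
  by rewrite setTI.
have CI i : setI_closed (C i).
  move=> _ _ [A [D [gA pD ->]]] [A' [D' [gA' pD' ->]]].
  exists (A `&` A'), (D `&` D'); split; last by rewrite setIACA.
    exact: sigma_algebra_setI (g0_sigma i) _ _ gA gA'.
  exact: sigma_algebra_setI (pB_sigma i) _ _ pD pD'.
have Cm i : C i `<=` measurable.
  move=> _ [A [D [gA pD ->]]]; apply: measurableI; first exact: g0_measurable gA.
  exact: pB_measurable pD.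
pose S i : measurableType _ := g_sigma_algebraType (C i).
have mX0 i : @measurable_fun _ _ (S i) V setT (Xbar i 0).
  move=> _ A mA; rewrite setTI; apply: sub_sigma_algebra.
  exists (Xbar i 0 @^-1` A), setT; split; last by rewrite setIT.
    by exists A => //; rewrite setTI.
  exact: sigmaT (pB_sigma i).
have mB i t : 0 <= t -> @measurable_fun _ _ (S i) _ setT (B i t).
  move=> t0 _ A mA; rewrite setTI; apply: sub_sigma_algebra.
  exists setT, (B i t @^-1` A); split; last by rewrite setTI.
    exact: sigmaT (g0_sigma i).
  apply: sub_sigma_algebra; exists t; first by rewrite /= in_itv/= t0.
  by exists A => //; rewrite setTI.
have mBs i t : 0 <= t -> @measurable_fun _ _ (S i) V setT (fun w => B i t w *m sigma^T).
  move=> t0; apply: measurable_row => // j; under eq_fun do rewrite mxE.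
  apply: measurable_sum => l; apply: measurable_funM => //.
  exact: (measurableT_comp (measurable_coord 0 l) (mB i t t0)).
have cb (i : 'I_N) (t : R) : 0 <= t <= T -> continuous (drift F L u nu t).
  move=> tT; have /andP[t0 _] := tT; apply: drift_continuous => //.
  have [w intw] := ae_witness (sde_inner_integrable (hXbar i)).
  exists (Xbar i t w); exact: (same_memory_drift hS smn cnu tT (intw t t0)).1.
have /choice[Z hZ] : forall i, exists Z : Omega -> V, @measurable_fun _ _ (S i) V setT Z /\
    forall w y, euler (drift F L u nu) (Xbar i 0 w) (fun t => B i t w *m sigma^T)
      (T / m.+1%:R) m.+1 @[m --> \oo] --> y -> y = Z w.
  move=> i.
  have mf m : @measurable_fun _ _ (S i) V setT (fun w => euler (drift F L u nu) (Xbar i 0 w)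
      (fun t => B i t w *m sigma^T) (T / m.+1%:R) m.+1).
    apply: (@measurable_euler R d _ (S i) (drift F L u nu) (Xbar i 0)
      (fun t w => B i t w *m sigma^T)) => //.
    - by rewrite divr_ge0 // ltW.
    - move=> j jm; apply: (cb i); rewrite mulr_ge0//=; last by rewrite divr_ge0// ltW.
      by rewrite mulrCA ler_piMr ?(ltW T0)// ler_pdivrMr// mul1r ler_nat ltnW.
    - exact: mBs.
  by have [Zi mZ hZ] := measurable_limit mf; exists Zi.
apply: (@mutually_independent_ae _ _ R P _ (fun i => <<s C i >>) d (fun i => Xbar i T) Z).
- by move=> i; apply: smallest_sub; [exact: sigma_algebra_measurable|exact: Cm].
- exact: mutually_independent_generated.
- by move=> i; apply: (adapted_measurable (sde_adapted (hXbar i))); exact: ltW.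
- by move=> i A [E mE <-]; exact: (hZ i).1.
- move=> i; apply: filterS (sde_euler_limit T0 (hXbar i) cnu smn) => w.
  exact: (hZ i).2.
Qed.

End particles_independent.

(** * Continuity of the flow of laws *)

Section uniform_integrability.
Context (R : realType) (d : nat) (disp : measure_display)
  (Omega : measurableType disp) (P : probability Omega R).
Local Notation V := 'rV[R]_d.

Lemma cvg_within_seq (D : set R) (f : R -> R) (t l : R) :
  (forall s : nat -> R, (forall k, D (s k)) -> s k @[k --> \oo] --> t ->
     f (s k) @[k --> \oo] --> l) ->
  f s @[s --> within D (nbhs t)] --> l.
Proof.
move=> h; apply/cvgrPdist_lt => e e0; rewrite near_withinE; apply: contrapT => nh.
have /choice[s hs] : forall k : nat, exists s, [/\ D s, `|t - s| < k.+1%:R^-1 &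
    e <= `|l - f s|].
  move=> k; apply: contrapT => ns; apply: nh; apply/nbhs_ballP.
  exists k.+1%:R^-1; first by rewrite /= invr_gt0.
  move=> s ts Ds; rewrite ltNge; apply/negP => es; apply: ns.
  by exists s; split.
have st : s k @[k --> \oo] --> t.
  apply/cvgrPdist_lt => r r0; near=> k; have [_ + _] := hs k.
  move=> /lt_trans; apply; near: k; exact: near_infty_natSinv_lt (PosNum r0).
have /cvgrPdist_lt /(_ e e0)[k _ /(_ k (leqnn k))] := h s (fun k => let: And3 Ds _ _ := hs k in Ds) st.
by rewrite ltNge; have [_ _ ->] := hs k.
Unshelve. all: by end_near. Qed.

Lemma cvg_within_comp_seq (U : topologicalType) (f : R -> U) (D : set R) (t : R) (l : U)
    (s : nat -> R) :
  f r @[r --> within D (nbhs t)] --> l -> (forall k, D (s k)) ->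
  s k @[k --> \oo] --> t -> f (s k) @[k --> \oo] --> l.
Proof.
move=> fl Ds st; apply: (cvg_comp _ _ _ fl) => B hB.
have {}st : \forall k \near \oo, D (s k) -> B (s k) := st _ hB.
by change (\forall k \near \oo, B (s k)); apply: filterS st => k; apply; exact: Ds.
Qed.

(** A bound on a higher moment gives uniform integrability: truncate
    [|Z|^p] at height [K^p], and pay [K^(p - q)] times the [q]-th moment. *)
Lemma expectation_cvg0 (p q A : R) (Z : nat -> Omega -> V) : 0 < p -> p < q -> 0 <= A ->
  (forall k, measurable_fun setT (Z k)) ->
  {ae P, forall w, enorm (Z k w) @[k --> \oo] --> 0} ->
  (forall k, \int[P]_w (enorm (Z k w) `^ q)%:E <= A%:E)%E ->
  (forall k, \int[P]_w (enorm (Z k w) `^ p)%:E \is a fin_num)%E /\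
  fine (\int[P]_w (enorm (Z k w) `^ p)%:E) @[k --> \oo] --> 0.
Proof.
move=> p0 pq A0 mZ Z0 ZA.
have mZr k r : measurable_fun setT (fun w => enorm (Z k w) `^ r).
  exact: measurable_enorm_powR.
have bound (K : R) k : 0 < K -> (\int[P]_w (enorm (Z k w) `^ p)%:E <=
    \int[P]_w (Num.min (enorm (Z k w) `^ p) (K `^ p))%:E + (K `^ (p - q) * A)%:E)%E.
  move=> K0.
  have mmin : measurable_fun setT (fun w => (Num.min (enorm (Z k w) `^ p) (K `^ p))%:E).
    by apply/measurable_EFinP; exact: measurable_minr.
  have mq : measurable_fun setT (fun w => ((K `^ (p - q))%:E * (enorm (Z k w) `^ q)%:E)%E).
    by apply: emeasurable_funM => //; apply/measurable_EFinP.
  apply: (@le_trans _ _ (\int[P]_w ((Num.min (enorm (Z k w) `^ p) (K `^ p))%:E +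
      (K `^ (p - q))%:E * (enorm (Z k w) `^ q)%:E))%E).
    apply: ge0_le_integral => //.
    - by move=> w _; rewrite lee_fin powR_ge0.
    - by apply/measurable_EFinP.
    - exact: emeasurable_funD.
    - move=> w _; rewrite -EFinM -EFinD lee_fin.
      have [zK|Kz] := leP (enorm (Z k w)) K.
        rewrite min_l ?lerDl ?mulr_ge0 ?powR_ge0//.
        exact: ler_powR_base (ltW p0) (enorm_ge0 _) zK.
      have z0 : 0 < enorm (Z k w) by exact: lt_trans Kz.
      rewrite (@le_trans _ _ (K `^ (p - q) * enorm (Z k w) `^ q))//; last first.
        by rewrite lerDr le_min !powR_ge0.
      have -> : enorm (Z k w) `^ p = enorm (Z k w) `^ (p - q) * enorm (Z k w) `^ q.
        by rewrite -powRD ?subrK//; apply/implyP => _; rewrite gt_eqF.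
      rewrite ler_wpM2r ?powR_ge0// -[p - q]opprB !powRN lef_pV2 ?posrE ?powR_gt0//.
      by apply: ler_powR_base; rewrite ?subr_ge0 ltW.
  rewrite ge0_integralD//; last 2 first.
  - by move=> w _; rewrite lee_fin le_min !powR_ge0.
  - by move=> w _; rewrite -EFinM lee_fin mulr_ge0 ?powR_ge0.
  rewrite leeD2l// ge0_integralZl//; last 3 first.
  - by apply/measurable_EFinP.
  - by move=> w _; rewrite lee_fin powR_ge0.
  - by rewrite lee_fin powR_ge0.
  by rewrite EFinM lee_wpmul2l// lee_fin powR_ge0.
have min_le (K : R) k : (\int[P]_w (Num.min (enorm (Z k w) `^ p) (K `^ p))%:E <= (K `^ p)%:E)%E.
  rewrite -[leRHS]mule1 -(@probability_setT _ _ _ P) -integral_cst//.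
  apply: ge0_le_integral => //.
  - by move=> w _; rewrite lee_fin le_min !powR_ge0.
  - by apply/measurable_EFinP; exact: measurable_minr.
  - by move=> w _; rewrite lee_fin ge_min lexx orbT.
have Ege0 k : (0 <= \int[P]_w (enorm (Z k w) `^ p)%:E)%E.
  by apply: integral_ge0 => w _; rewrite lee_fin powR_ge0.
have fin k : (\int[P]_w (enorm (Z k w) `^ p)%:E \is a fin_num)%E.
  rewrite ge0_fin_numE// (le_lt_trans (bound 1 k ltr01))//.
  by rewrite (le_lt_trans (leeD2r _ (min_le 1 k)))// ltry.
split=> //; apply/cvgrPdist_le => /= e e0.
(* the tail beyond height [K] costs at most [K `^ (p - q) * A = A / c < e / 2] *)
pose c := 2 * A / e + 1.
have c0 : 0 < c by rewrite ltr_wpDl// divr_ge0 ?(ltW e0)// mulr_ge0.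
pose K := c `^ (q - p)^-1.
have K0 : 0 < K by exact: powR_gt0.
have KA : K `^ (p - q) * A <= e / 2.
  have -> : K `^ (p - q) = c^-1.
    rewrite /K -powRrM -[p - q]opprB mulrN mulVf ?subr_eq0 ?gt_eqF//.
    by rewrite powR_inv1// ltW.
  rewrite mulrC ler_pdivrMr// /c mulrDr mulr1 (_ : e / 2 * (2 * A / e) = A).
    by rewrite lerDl divr_ge0// ltW.
  by field; rewrite gt_eqF.
have cvgmin : (\int[P]_w (Num.min (enorm (Z k w) `^ p) (K `^ p))%:E @[k --> \oo] --> 0)%E.
  have [] := @dominated_convergence _ _ _ P setT measurableT
    (fun k w => (Num.min (enorm (Z k w) `^ p) (K `^ p))%:E) (cst 0%E) (cst (K `^ p)%:E).
  - by move=> k; apply/measurable_EFinP; exact: measurable_minr.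
  - exact: measurable_cst.
  - apply: filterS Z0 => w Zw _; apply/cvg_EFin; first exact: nearW.
    have h1 : enorm (Z k w) `^ p @[k --> \oo] --> 0.
      rewrite -[X in _ --> X](@powR0 R p) ?gt_eqF//; apply: cvg_powR => //.
        exact: ltW.
      by apply: nearW => k; exact: enorm_ge0.
    apply: (@squeeze_cvgr _ _ _ _ (fun=> 0) (fun k => enorm (Z k w) `^ p)) => //.
      by apply: nearW => k; rewrite le_min !powR_ge0 ge_min lexx.
    exact: cvg_cst.
  - by apply/integrableP; split => //; rewrite (eq_integral (cst (K `^ p)%:E)) ?integral_cst//=;
      [rewrite probability_setT mule1 ltry|move=> w _; rewrite /= ger0_norm ?powR_ge0].
  - apply: aeW => w k _; rewrite lee_fin ger0_norm ?le_min ?powR_ge0//.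
    by rewrite ge_min lexx orbT.
  by move=> _ _; rewrite integral0.
have : \forall k \near \oo, (\int[P]_w (Num.min (enorm (Z k w) `^ p) (K `^ p))%:E < (e / 2)%:E)%E.
  have e20 : 0 < e / 2 by rewrite divr_gt0.
  have hN : nbhs (0%E : \bar R) [set x | (x < (e / 2)%:E)%E].
    by apply: open_nbhs_nbhs; split; [exact: open_ereal_lt_ereal|rewrite /= lte_fin].
  exact: (cvgmin _ hN).
apply: filterS => k hk; rewrite sub0r normrN ger0_norm ?fine_ge0//.
rewrite -lee_fin fineK// (le_trans (bound K k K0))// [e]splitr EFinD leeD// ?lee_fin//.
exact: ltW.
Qed.

End uniform_integrability.

Section flow_continuity.
Context (R : realType) (d : nat) (p q : R) (p0 : 0 < p) (pq : p < q)
  (disp : measure_display) (Omega : measurableType disp) (P : probability Omega R).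
Local Notation V := 'rV[R]_d.

Lemma ge0_integral_has_law (Y : Omega -> V) (nu : probability V R) (f : V -> \bar R) :
  measurable_fun setT Y -> has_law P Y nu ->
  measurable_fun setT f -> (forall y, 0 <= f y)%E ->
  (\int[P]_w f (Y w) = \int[nu]_y f y)%E.
Proof.
move=> mY lY mf f0.
pose Z : {RV P >-> V} := mfun_Sub (mem_set mY).
have := @ge0_integral_distribution _ _ _ _ _ P Z f mf f0.
rewrite /comp /= => <-; apply: eq_measure_integral => A mA _.
exact: (lY A mA).
Qed.

Lemma moment_has_law (Y : Omega -> V) (nu : probability V R) (r : R) :
  measurable_fun setT Y -> has_law P Y nu ->
  (\int[P]_w (enorm (Y w) `^ r)%:E = moment r nu)%E.
Proof.
move=> mY lY.
rewrite (@ge0_integral_has_law Y nu (fun y => (enorm y `^ r)%:E))//.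
  by apply/measurable_EFinP; apply: measurable_enorm_powR => //; exact: measurable_id.
by move=> y; rewrite lee_fin powR_ge0.
Qed.

Lemma moment_dist_le (Y Z : Omega -> V) (r A : R) : 0 < r ->
  measurable_fun setT Y -> measurable_fun setT Z ->
  (\int[P]_w (enorm (Y w) `^ r)%:E <= A%:E)%E ->
  (\int[P]_w (enorm (Z w) `^ r)%:E <= A%:E)%E ->
  (\int[P]_w (enorm (Y w - Z w) `^ r)%:E <= (2 `^ r * (A + A))%:E)%E.
Proof.
move=> r0 mY mZ YA ZA.
have mf (U : Omega -> V) : measurable_fun setT U ->
    measurable_fun setT (fun w => (enorm (U w) `^ r)%:E).
  by move=> mU; apply/measurable_EFinP; exact: measurable_enorm_powR.
have pt (a b : V) : enorm (a - b) `^ r <= 2 `^ r * (enorm a `^ r + enorm b `^ r).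
  have h (x y : V) : enorm y <= enorm x ->
      enorm (x - y) `^ r <= 2 `^ r * (enorm x `^ r + enorm y `^ r).
    move=> yx; apply: (@le_trans _ _ ((2 * enorm x) `^ r)).
      apply: ler_powR_base; [exact: ltW|exact: enorm_ge0|].
      by rewrite (le_trans (enormD _ _))// enormN mulr_natl mulr2n lerD2l.
    by rewrite powRM ?enorm_ge0// ler_wpM2l ?powR_ge0// lerDl powR_ge0.
  have [ab|/ltW ba] := leP (enorm b) (enorm a); first exact: h.
  by rewrite enormB [X in _ * X]addrC; exact: h.
apply: (@le_trans _ _ (\int[P]_w ((2 `^ r)%:E * ((enorm (Y w) `^ r)%:E + (enorm (Z w) `^ r)%:E)))%E).
  apply: ge0_le_integral => //.
  - by move=> w _; rewrite lee_fin powR_ge0.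
  - by apply: mf; exact: measurable_rowB.
  - by apply: emeasurable_funM => //; apply: emeasurable_funD; exact: mf.
  - by move=> w _; rewrite -EFinD -EFinM lee_fin.
rewrite ge0_integralZl//; [|exact: emeasurable_funD (mf _ mY) (mf _ mZ)|].
- rewrite EFinM lee_wpmul2l ?lee_fin ?powR_ge0// EFinD ge0_integralD//.
  + exact: (leeD YA ZA).
  + by move=> w _; rewrite lee_fin powR_ge0.
  + exact: mf.
  + by move=> w _; rewrite lee_fin powR_ge0.
  + exact: mf.
- by move=> w _; rewrite -EFinD lee_fin addr_ge0 ?powR_ge0.
Qed.

(** Convergence of the paths together with bounded [q]-th moments, [q > p],
    is convergence in mean of order [p], which bounds the distance of the
    laws. *)
Lemma flow_continuous (X : R -> Omega -> V) (mu : R -> Pp d p) (T A : R) : 0 < T ->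
  0 <= A ->
  (forall s, 0 <= s -> measurable_fun setT (X s)) -> continuous_paths P X ->
  (forall s, 0 <= s -> has_law P (X s) (mu s)) ->
  (forall s, 0 <= s <= T -> (moment q (mu s) <= A%:E)%E) ->
  Pp_continuous (fun s => mu (Num.min s T)).
Proof.
move=> T0 A0 mX cX lX XA.
have minT s : 0 <= s -> 0 <= Num.min s T <= T.
  by move=> s0; rewrite le_min s0 (ltW T0) ge_min lexx orbT.
have q0 : 0 < q by exact: lt_trans pq.
have mXT s : 0 <= s -> measurable_fun setT (X (Num.min s T)).
  by move=> s0; apply: mX; case/andP: (minT s s0).
have lXT s : 0 <= s -> has_law P (X (Num.min s T)) (mu (Num.min s T)).
  by move=> s0; apply: lX; case/andP: (minT s s0).
have XqA s : 0 <= s -> (\int[P]_w (enorm (X (Num.min s T) w) `^ q)%:E <= A%:E)%E.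
  by move=> s0; rewrite (moment_has_law _ (mXT s s0) (lXT s s0)); exact: XA (minT s s0).
pose I s t := (\int[P]_w (enorm (X (Num.min s T) w - X (Num.min t T) w) `^ p)%:E)%E.
have Ifin s t : 0 <= s -> 0 <= t -> (I s t \is a fin_num)%E.
  move=> s0 t0; rewrite ge0_fin_numE; last first.
    by apply: integral_ge0 => w _; rewrite lee_fin powR_ge0.
  pose M := Num.max (fine (moment p (mu (Num.min s T)))) (fine (moment p (mu (Num.min t T)))).
  have m0 r : (0 <= moment p (mu r))%E.
    by apply: integral_ge0 => w _; rewrite lee_fin powR_ge0.
  have mfin r : (moment p (mu r))%E = (fine (moment p (mu r)))%:E.
    by rewrite fineK// ge0_fin_numE//; exact: Pp_moment.
  apply: (@le_lt_trans _ _ (2 `^ p * (M + M))%:E); last exact: ltry.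
  apply: moment_dist_le => //; [exact: mXT|exact: mXT| |].
    by rewrite (moment_has_law _ (mXT s s0) (lXT s s0)) mfin lee_fin le_max lexx.
  by rewrite (moment_has_law _ (mXT t t0) (lXT t t0)) mfin lee_fin le_max lexx orbT.
apply: (@Pp_continuousP R d p p0 _ (fun s t => fine (I s t))).
- by move=> s t _ _; rewrite fine_ge0// integral_ge0// => w _; rewrite lee_fin powR_ge0.
- move=> s t s0 t0; rewrite fineK ?Ifin//.
  by apply: Wp_le_expectation => //; [exact: mXT|exact: mXT|exact: lXT|exact: lXT].
- move=> t t0; apply: cvg_within_seq => s s0 st.
  have {}s0 k : 0 <= s k by have := s0 k; rewrite /= in_itv/= andbT.
  have [] // := @expectation_cvg0 R d disp Omega P p q (2 `^ q * (A + A))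
    (fun k w => X (Num.min (s k) T) w - X (Num.min t T) w) p0 pq.
  + by rewrite mulr_ge0 ?powR_ge0 ?addr_ge0.
  + by move=> k; apply: measurable_rowB => //; exact: mXT.
  + have sT : Num.min (s k) T @[k --> \oo] --> Num.min t T.
      have cmin : {for t, continuous (fun s => Num.min s T)}.
        by apply: continuous_min; [exact: cvg_id|exact: cvg_cst].
      exact: (continuous_cvg _ cmin st).
    apply: filterS cX => w /subspace_continuousP cX.
    have tD : (`[0, +oo[%classic : set R) (Num.min t T).
      by rewrite /= in_itv/= andbT; case/andP: (minT t t0).
    have h : X (Num.min (s k) T) w @[k --> \oo] --> X (Num.min t T) w.
      apply: (cvg_within_comp_seq (cX _ tD)) => // k.
      by rewrite /= in_itv/= andbT; case/andP: (minT (s k) (s0 k)).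
    by move/cvg_enormB : h; under eq_fun do rewrite enormB.
  + by move=> k; apply: moment_dist_le => //; [exact: mXT|exact: mXT|exact: XqA|exact: XqA].
Unshelve. all: by end_near. Qed.

End flow_continuity.
(** * Joint measurability of continuous processes *)

Section joint_measurability.
Context (R : realType) (disp : measure_display) (T : measurableType disp).

(** A process with continuous paths is the limit of processes that are
    piecewise constant in time. *)
Lemma measurable_continuous_process (g : R -> T -> R) :
  (forall s, measurable_fun setT (g s)) -> (forall w, continuous (g ^~ w)) ->
  measurable_fun setT (fun z : R * T => g z.1 z.2).
Proof.
move=> mg cg.
pose a (m : nat) (s : R) : R := (Num.floor (s * m.+1%:R))%:~R / m.+1%:R.
apply: (@measurable_fun_cvg _ _ _ _ (fun m z => g (a m z.1) z.2)) => [m|[s w] _ /=].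
  move=> _ Y mY; rewrite setTI.
  have -> : (fun z : R * T => g (a m z.1) z.2) @^-1` Y =
      \bigcup_(i in [set: int]) ([set s : R | Num.floor (s * m.+1%:R) = i] `*`
         (g (i%:~R / m.+1%:R) @^-1` Y)).
    apply/seteqP; split => [[s w] /= gY|[s w] [i _ [/= <-]]]//.
    by exists (Num.floor (s * m.+1%:R)).
  apply: countable_bigcupT_measurable => // i; apply: measurableX; last first.
    by rewrite -[X in measurable X]setTI; exact: mg.
  have -> : [set s : R | Num.floor (s * m.+1%:R) = i] =
      `[i%:~R / m.+1%:R, (i + 1)%:~R / m.+1%:R[%classic.
    apply/seteqP; split => s /=; rewrite in_itv/= ler_pdivrMr// ltr_pdivlMr//.
      by move=> <-; exact: Num.Theory.floor_itv.
    exact: Num.Theory.floor_def.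
  exact: measurable_itv.
have as_ : a m s @[m --> \oo] --> s.
  apply/cvgrPdist_lt => e e0; near=> m.
  have m0 : (0 : R) < m.+1%:R by rewrite ltr0n.
  rewrite ger0_norm; last first.
    by rewrite subr_ge0 /a ler_pdivrMr// Num.Theory.floor_le.
  apply: (@lt_trans _ _ m.+1%:R^-1).
    have /andP[_] := Num.Theory.floor_itv (s * m.+1%:R); rewrite intrD => H.
    by rewrite ltrBlDl -[X in _ + X]mul1r /a -mulrDl ltr_pdivlMr.
  by near: m; exact: near_infty_natSinv_lt (PosNum e0).
exact: (continuous_cvg _ (cg w s) as_).
Unshelve. all: by end_near. Qed.

End joint_measurability.

Section tonelli_restricted.
Local Open Scope ereal_scope.
Context (R : realType) (d1 d2 : measure_display) (T1 : measurableType d1)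
  (T2 : measurableType d2).

(** The finite measure [m] again, as a carrier for the structure of finite
    measures under which Tonelli's theorem is stated. *)
Definition finite_copy (m : {measure set T1 -> \bar R}) of (m setT < +oo) :
  set T1 -> \bar R := m.

Section instances.
Context (m : {measure set T1 -> \bar R}) (hm : m setT < +oo).
HB.instance Definition _ := Measure.on (finite_copy hm).
Let finite_copy_fin : fin_num_fun (finite_copy hm).
Proof.
move=> A mA; rewrite ge0_fin_numE//; apply: (le_lt_trans _ hm).
by apply: le_measure; rewrite ?inE.
Qed.
HB.instance Definition _ := Measure_isFinite.Build _ _ _ (finite_copy hm) finite_copy_fin.
End instances.

(** Tonelli's theorem for the product of [f] with the indicator of [D * A]. *)
Lemma tonelli_restricted (m : {measure set T1 -> \bar R}) (P : probability T2 R)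
    (D : set T1) (A : set T2) (f : T1 * T2 -> \bar R) : m setT < +oo ->
  measurable D -> measurable A -> measurable_fun setT f -> (forall z, 0 <= f z) ->
  \int[P]_(w in A) \int[m]_(s in D) f (s, w) = \int[m]_(s in D) \int[P]_(w in A) f (s, w).
Proof.
move=> hm mD mA mf f0.
pose g := f \_ (D `*` A).
have mg : measurable_fun setT g.
  by apply/(measurable_restrict f _ _ ) => //; [exact: measurableX|exact: measurable_funTS].
have g0 z : 0 <= g z by rewrite /g patchE; case: ifP.
have := @fubini_tonelli _ _ _ _ _ (finite_copy hm) P g mg g0.
have gE s w : g (s, w) = if (s \in D) && (w \in A) then f (s, w) else 0.
  rewrite /g patchE; congr (if _ then _ else _).
  by apply/idP/andP; [rewrite !inE => -[]|rewrite !inE => -[]].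
have -> : \int[P]_y \int[finite_copy hm]_x g (x, y) = \int[P]_(w in A) \int[m]_(s in D) f (s, w).
  rewrite [RHS]integral_mkcond; apply: eq_integral => w _; rewrite patchE.
  case: ifPn => wA.
    rewrite [RHS]integral_mkcond; apply: eq_integral => s _.
    by rewrite gE wA andbT patchE.
  by rewrite integral0_eq// => s _; rewrite gE (negbTE wA) andbF.
move=> <-; rewrite [RHS]integral_mkcond; apply: eq_integral => s _; rewrite patchE.
case: ifPn => sD.
  rewrite [RHS]integral_mkcond; apply: eq_integral => w _.
  by rewrite gE sD patchE.
by rewrite integral0_eq// => w _; rewrite gE (negbTE sD).
Qed.

Lemma measurable_section_integral (P : probability T2 R) (A : set T2) (f : T1 * T2 -> \bar R) :
  measurable A -> measurable_fun setT f -> (forall z, 0 <= f z) ->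
  measurable_fun setT (fun s => \int[P]_(w in A) f (s, w)).
Proof.
move=> mA mf f0.
pose g := f \_ (setT `*` A).
have mg : measurable_fun setT g.
  by apply/(measurable_restrict f _ _ ) => //; [exact: measurableX|exact: measurable_funTS].
have g0 z : 0 <= g z by rewrite /g patchE; case: ifP.
have -> : (fun s => \int[P]_(w in A) f (s, w)) = fubini_F P g.
  apply/funext => s; rewrite integral_mkcond; apply: eq_integral => w _.
  rewrite /g !patchE; congr (if _ then _ else _).
  by apply/idP/idP; rewrite !inE => // -[].
exact: measurable_fun_fubini_tonelli_F.
Qed.

End tonelli_restricted.

(** * Growth of the distance along a path *)

Section norm_derivative.
Context (R : realType) (d : nat).
Local Notation V := 'rV[R]_d.

Lemma cvg_edot (T : Type) (G : set_system T) {FG : Filter G} (f g : T -> V) (a b : V) :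
  f x @[x --> G] --> a -> g x @[x --> G] --> b -> edot (f x) (g x) @[x --> G] --> edot a b.
Proof.
move=> fa gb; apply: cvg_sumr => j; apply: cvgM; first exact: cvg_coord fa.
exact: cvg_coord gb.
Qed.

(** The Euclidean norm has one-sided directional derivatives everywhere: at
    the origin the derivative in the direction [b] is [enorm b], which is
    also of the form [edot e b] for a unit vector [e]. *)
Lemma enorm_right_derivative (v : nat -> V) (v0 b : V) (h : nat -> R) :
  (forall k, 0 < h k) -> h k @[k --> \oo] --> 0 ->
  (h k)^-1 *: (v k - v0) @[k --> \oo] --> b ->
  exists e : V, [/\ enorm e <= 1, enorm v0 *: e = v0 &
    (h k)^-1 * (enorm (v k) - enorm v0) @[k --> \oo] --> edot e b].
Proof.
move=> h0 hk vb.
have [v00|v0n] := eqVneq v0 0.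
  have nb : (h k)^-1 * (enorm (v k) - enorm v0) @[k --> \oo] --> enorm b.
    have -> : (fun k => (h k)^-1 * (enorm (v k) - enorm v0)) =
        (fun k => enorm ((h k)^-1 *: (v k - v0))).
      by apply/funext => k; rewrite v00 enorm0 !subr0 enormZ ger0_norm// invr_ge0 ltW.
    exact: cvg_enorm vb.
  have [b0|bn] := eqVneq (enorm b) 0.
    exists 0; split; [by rewrite enorm0|by rewrite scaler0 v00|].
    by rewrite (enorm_eq0 b0) /edot big1 => [|j _]; [rewrite -b0|rewrite !mxE mul0r].
  exists ((enorm b)^-1 *: b); split.
  - by rewrite enormZ ger0_norm ?invr_ge0 ?enorm_ge0// mulVf.
  - by rewrite v00 enorm0 scale0r.
  - by rewrite edotZl -enorm_sqr expr2 mulKf.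
have nv0 : 0 < enorm v0.
  by rewrite lt_def enorm_ge0 andbT; apply: contra_neq v0n => /enorm_eq0.
exists ((enorm v0)^-1 *: v0); split.
- by rewrite enormZ ger0_norm ?invr_ge0 ?enorm_ge0// mulVf ?gt_eqF.
- by rewrite scalerA mulfV ?scale1r// gt_eqF.
have vv0 : v k @[k --> \oo] --> v0.
  have : h k *: ((h k)^-1 *: (v k - v0)) + v0 @[k --> \oo] --> 0 *: b + v0.
    by apply: cvgD; [exact: cvgZ|exact: cvg_cst].
  rewrite scale0r add0r; apply: cvg_trans; apply: near_eq_cvg; apply: nearW => k.
  by rewrite scalerA mulfV ?gt_eqF// scale1r subrK.
have -> : edot ((enorm v0)^-1 *: v0) b = edot (v0 + v0) b / (enorm v0 + enorm v0).
  by rewrite edotZl edotDl; field; rewrite !gt_eqF// addr_gt0.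
have : edot (v k + v0) ((h k)^-1 *: (v k - v0)) / (enorm (v k) + enorm v0) @[k --> \oo]
    --> edot (v0 + v0) b / (enorm v0 + enorm v0).
  apply: cvgM; first by apply: cvg_edot => //; apply: cvgD => //; exact: cvg_cst.
  apply: cvgV; first by rewrite gt_eqF// addr_gt0.
  by apply: cvgD; [exact: cvg_enorm|exact: cvg_cst].
apply: cvg_trans; apply: near_eq_cvg; apply: nearW => k.
have vk0 : enorm (v k) + enorm v0 != 0.
  by rewrite gt_eqF// ltr_wpDl ?enorm_ge0.
rewrite edotZr edotDl !edotDr !edotNr (edotC v0 (v k)) -!enorm_sqr.
by field; rewrite vk0 gt_eqF.
Qed.

(** By convexity a difference quotient of [a |-> a `^ p / p] lies between the
    slopes at its two ends; this includes [p = 1] and a path through the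
    origin. *)
Lemma powR_quotient_bounds (p a b h : R) : 1 <= p -> 0 <= a -> 0 <= b -> 0 < h ->
  a `^ (p - 1) * (h^-1 * (b - a)) <= h^-1 * ((b `^ p - a `^ p) / p) <=
  b `^ (p - 1) * (h^-1 * (b - a)).
Proof.
move=> p1 a0 b0 h0; have ih : 0 <= h^-1 by rewrite invr_ge0 ltW.
have H1 := powR_tangent_le p1 a0 b0.
have := powR_tangent_le p1 b0 a0; rewrite -(opprB b a) -(opprB (b `^ p)) mulrN mulNr lerN2 => H2.
by rewrite mulrCA [X in _ && (_ <= X)]mulrCA !(ler_wpM2l ih).
Qed.

Lemma enorm_powR_right_derivative (p : R) (v : nat -> V) (v0 b : V) (h : nat -> R) :
  1 <= p -> (forall k, 0 < h k) -> h k @[k --> \oo] --> 0 ->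
  (h k)^-1 *: (v k - v0) @[k --> \oo] --> b ->
  exists e : V, [/\ enorm e <= 1, enorm v0 *: e = v0 &
    (h k)^-1 * ((enorm (v k) `^ p - enorm v0 `^ p) / p) @[k --> \oo] -->
      enorm v0 `^ (p - 1) * edot e b].
Proof.
move=> p1 h0 hk vb.
have [e [e1 ev0 he]] := enorm_right_derivative h0 hk vb.
exists e; split => //.
have nvv0 : enorm (v k) @[k --> \oo] --> enorm v0.
  have : h k * ((h k)^-1 * (enorm (v k) - enorm v0)) + enorm v0 @[k --> \oo]
      --> 0 * edot e b + enorm v0.
    by apply: cvgD; [exact: cvgM|exact: cvg_cst].
  rewrite mul0r add0r; apply: cvg_trans; apply: near_eq_cvg; apply: nearW => k.
  by rewrite mulVKf ?subrK// gt_eqF.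
apply: (@squeeze_cvgr _ _ _ _
  (fun k => enorm v0 `^ (p - 1) * ((h k)^-1 * (enorm (v k) - enorm v0)))
  (fun k => enorm (v k) `^ (p - 1) * ((h k)^-1 * (enorm (v k) - enorm v0)))).
- by apply: nearW => k; apply: powR_quotient_bounds => //; exact: enorm_ge0.
- by apply: cvgM => //; exact: cvg_cst.
- apply: cvgM => //; apply: cvg_powR => //; last exact: enorm_ge0.
    by rewrite subr_ge0.
  by apply: nearW => k; exact: enorm_ge0.
Qed.

End norm_derivative.

Section pathwise.
Context (R : realType) (d N : nat) (hN : (0 < N)%N) (p : R) (F : 'rV[R]_d -> 'rV[R]_d)
  (L : R -> R -> 'rV[R]_d -> Pp d p -> 'rV[R]_d)
  (u : R -> {measure set R -> \bar R}) (h1 h2 : R -> R -> R) (kappa : R)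
  (hS : structural_assumption F L u h1 h2 kappa).
Local Notation V := 'rV[R]_d.

(** [h2 t s] times the [p]-th power of the ratio [l / h2 t s]: the part of the
    defect [l] that Young's inequality leaves, weighted like the rest of the
    memory.  It vanishes with [h2 t s], as [l] does. *)
Definition defect (t s l : R) : R := h2 t s * (l / h2 t s) `^ p.

Lemma defect_ge0 t s l : 0 <= t -> 0 <= s -> 0 <= defect t s l.
Proof. by move=> t0 s0; rewrite mulr_ge0 ?powR_ge0// (sa_h2_ge0 hS). Qed.

Lemma dissipation (e x y : V) : enorm (x - y) *: e = x - y ->
  edot e (- F x + F y) <= - kappa * enorm (x - y).
Proof.
move=> exy; have [xy0|xyn] := eqVneq (enorm (x - y)) 0.
  have := enorm_eq0 xy0 => /eqP; rewrite subr_eq0 => /eqP ->.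
  by rewrite addrC subrr /edot big1 => [|j _]; rewrite ?mxE ?mulr0// subrr enorm0 mulr0.
have xy0 : 0 < enorm (x - y) by rewrite lt_def xyn enorm_ge0.
rewrite -(ler_pM2l xy0) -edotZl exy.
have := sa_F_monotone hS x y.
have -> : - F x + F y = - (F x - F y) by rewrite opprB addrC.
by rewrite edotNr => h; rewrite mulrCA -expr2 mulNr lerN2.
Qed.

(** Pass from [L t s x mx] to [L t s y nu] by changing the position, then [mx]
    into [my], then [my] into [nu].  The second increment meets Young's
    inequality with weight [eps'], the third with weight [eps]. *)
Lemma memory_term_le (t s : R) (x y : V) (mx my nu : Pp d p) (a m eps eps' : R) :
  0 <= t -> 0 <= s -> 0 < eps -> 0 < eps' -> 0 <= m ->
  (Wp p mx my `^ p <= m%:E)%E ->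
  a = enorm (x - y) ->
  a `^ (p - 1) * enorm (L t s x mx - L t s y nu) <=
    h1 t s * a `^ p + h2 t s * ((eps + eps') * (p - 1) / p * a `^ p) +
    (h2 t s * (m / (p * eps' `^ (p - 1))) +
     defect t s (enorm (L t s y my - L t s y nu)) / (p * eps `^ (p - 1))).
Proof.
move=> t0 s0 eps0 eps0' m0 Wm aE.
have p1 := sa_p_ge1 hS; have p0 := p_gt0 hS.
have a0 : 0 <= a by rewrite aE enorm_ge0.
have h20 := sa_h2_ge0 hS t0 s0.
set l := enorm (L t s y my - L t s y nu).
have l0 : 0 <= l := enorm_ge0 _.
have W0 : 0 <= m `^ p^-1 := powR_ge0 _ _.
have split3 : enorm (L t s x mx - L t s y nu) <= h1 t s * a + h2 t s * m `^ p^-1 + l.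
  rewrite (le_trans (enorm_distD (L t s y my) _ _))// lerD2r.
  rewrite (le_trans (enorm_distD (L t s y mx) _ _))// lerD//.
    by rewrite aE; exact: (sa_L_lipschitz_x hS).
  rewrite -lee_fin (le_trans (sa_L_lipschitz_mu hS _ _ _ t0 s0))// EFinM.
  by rewrite lee_wpmul2l ?lee_fin// Wp_le_root.
have ap : a `^ (p - 1) * a = a `^ p by rewrite mulrC mulr_powRB1.
have y1 : a `^ (p - 1) * (h2 t s * m `^ p^-1) <=
    h2 t s * (eps' * (p - 1) / p * a `^ p + m / (p * eps' `^ (p - 1))).
  rewrite mulrCA ler_wpM2l//; have := young_weighted p1 eps0' a0 W0.
  by rewrite -powRrM mulVf ?gt_eqF// powRr1.
have y2 : a `^ (p - 1) * l <= h2 t s * (eps * (p - 1) / p * a `^ p) +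
    defect t s l / (p * eps `^ (p - 1)).
  have [h2z|h2n] := eqVneq (h2 t s) 0.
    have -> : l = 0.
      apply/eqP; rewrite eq_le l0 andbT -lee_fin.
      have := sa_L_lipschitz_mu hS y my nu t0 s0.
      by rewrite h2z mul0e.
    by rewrite /defect h2z !mul0r mulr0 addr0.
  have h2p : 0 < h2 t s by rewrite lt_def h2n.
  have lE : l = h2 t s * (l / h2 t s) by rewrite mulrC divfK.
  have r0 : 0 <= l / h2 t s by rewrite divr_ge0.
  have := ler_wpM2l h20 (young_weighted p1 eps0 a0 r0).
  by rewrite mulrCA -lE mulrDr /defect -(mulrA (h2 t s) (_ `^ _)).
rewrite (le_trans (ler_wpM2l (powR_ge0 _ _) split3))//.
rewrite !mulrDr [a `^ _ * (h1 _ _ * _)]mulrCA ap.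
rewrite -!addrA lerD2l (le_trans (lerD y1 y2))//.
rewrite le_eqVlt; apply/orP; left; apply/eqP.
by field; rewrite !gt_eqF// powR_gt0.
Qed.

(** The right-hand side keeps the past under the integral: its expectation is
    taken before it is integrated against the memory. *)
Lemma pathwise_growth (t : R) (i : 'I_N) (X Y : 'I_N -> R -> V) (nu : R -> Pp d p)
    (e : V) (a eps eps' : R) :
  0 <= t -> 0 < eps -> 0 < eps' ->
  vintegrable (u t) `[0, t] (fun s => L t s (X i t) (empirical p hN (fun j => X j s))) ->
  vintegrable (u t) `[0, t] (fun s => L t s (Y i t) (nu s)) ->
  measurable_fun (`[0, t]%classic : set R) (fun s => \sum_j enorm (X j s - Y j s) `^ p) ->
  measurable_fun (`[0, t]%classic : set R) (fun s => defect t s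
     (enorm (L t s (Y i t) (empirical p hN (fun j => Y j s)) - L t s (Y i t) (nu s)))) ->
  enorm e <= 1 -> enorm (X i t - Y i t) *: e = X i t - Y i t ->
  a = enorm (X i t - Y i t) ->
  ((a `^ (p - 1) * edot e
      (drift F L u (fun s => empirical p hN (fun j => X j s)) t (X i t) -
       drift F L u nu t (Y i t)))%:E <=
   ((Hker u h1 t - kappa + Hker u h2 t * ((eps + eps') * (p - 1) / p)) * a `^ p)%:E +
   \int[u t]_(s in `[0%R, t])
     (h2 t s * (N%:R^-1 * (\sum_j enorm (X j s - Y j s) `^ p) / (p * eps' `^ (p - 1))) +
      defect t s (enorm (L t s (Y i t) (empirical p hN (fun j => Y j s)) -
                         L t s (Y i t) (nu s))) / (p * eps `^ (p - 1)))%:E)%E.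
Proof.
move=> t0 eps0 eps0' intX intY mW ml e1 ea aE.
have p1 := sa_p_ge1 hS; have p0 := p_gt0 hS.
have a0 : 0 <= a by rewrite aE enorm_ge0.
have ap : a `^ (p - 1) * a = a `^ p by rewrite mulrC mulr_powRB1.
pose W s := \sum_j enorm (X j s - Y j s) `^ p.
pose l s := enorm (L t s (Y i t) (empirical p hN (fun j => Y j s)) - L t s (Y i t) (nu s)).
pose rest s := h2 t s * (N%:R^-1 * W s / (p * eps' `^ (p - 1))) +
  defect t s (l s) / (p * eps `^ (p - 1)).
have sge (s : R) : (`[0, t]%classic : set R) s -> 0 <= s by rewrite /= in_itv/= => /andP[].
have W0 s : 0 <= W s by apply: sumr_ge0 => j _; exact: powR_ge0.
have mh2 := measurable_h2 hS t0.
have rest0 s : (`[0, t]%classic : set R) s -> 0 <= rest s.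
  move=> /sge s0; rewrite addr_ge0//.
    rewrite mulr_ge0 ?(sa_h2_ge0 hS)// divr_ge0 ?mulr_ge0 ?invr_ge0// ?powR_ge0//.
    exact: ltW.
  by rewrite divr_ge0 ?defect_ge0// mulr_ge0 ?powR_ge0// ltW.
have mrest : measurable_fun (`[0, t]%classic : set R) rest.
  apply: measurable_funD; last exact: measurable_funM.
  apply: measurable_funM => //; apply: measurable_funM => //.
  exact: measurable_funM.
pose c2 := (eps + eps') * (p - 1) / p * a `^ p.
have c20 : 0 <= c2.
  by rewrite mulr_ge0 ?powR_ge0// divr_ge0 ?(ltW p0)// mulr_ge0 ?subr_ge0// ltW// addr_gt0.
rewrite /drift opprD opprK addrACA edotDr mulrDr.
rewrite -vintegralB//.
have diss : a `^ (p - 1) * edot e (- F (X i t) + F (Y i t)) <= - kappa * a `^ p.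
  rewrite -ap mulrCA ler_wpM2l ?powR_ge0// aE.
  by apply: dissipation.
have mem : ((a `^ (p - 1) * edot e (vintegral (u t) `[0, t]
      (fun s => (L t s (X i t) (empirical p hN (fun j => X j s)) - L t s (Y i t) (nu s))%R)))%:E <=
    \int[u t]_(s in `[0%R, t]) ((h1 t s * a `^ p + h2 t s * c2) + rest s)%:E)%E.
  rewrite -edotZl; apply: edot_vintegral_le => //.
  - exact: vintegrableB.
  - move=> s Ds; have s0 := sge s Ds; rewrite lee_fin addr_ge0 ?rest0//.
    by apply: addr_ge0; apply: mulr_ge0 => //; [exact: (sa_h1_ge0 hS)|exact: powR_ge0|
      exact: (sa_h2_ge0 hS)].
  - move=> s Ds; have s0 := sge s Ds.
    rewrite lee_fin edotZl.
    have Wm0 : 0 <= N%:R^-1 * W s by rewrite mulr_ge0 ?invr_ge0.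
    have := memory_term_le (mx := empirical p hN (fun j => X j s))
      (my := empirical p hN (fun j => Y j s)) (nu s) t0 s0 eps0 eps0' Wm0
      (Wp_empirical_le p0 hN _ _) aE.
    apply: le_trans; rewrite ler_wpM2l ?powR_ge0// (le_trans (edot_le _ _))//.
    by rewrite ler_piMl ?enorm_ge0.
have mh1 := measurable_h1 hS t0.
have h10 s : (`[0, t]%classic : set R) s -> (0 <= (h1 t s * a `^ p)%:E)%E.
  by move=> /sge s0; rewrite lee_fin mulr_ge0 ?powR_ge0// (sa_h1_ge0 hS).
have h20 s : (`[0, t]%classic : set R) s -> (0 <= (h2 t s * c2)%:E)%E.
  by move=> /sge s0; rewrite lee_fin mulr_ge0// (sa_h2_ge0 hS).
have mh1a : measurable_fun (`[0, t]%classic : set R) (fun s => (h1 t s * a `^ p)%:E).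
  by apply/measurable_EFinP; exact: measurable_funM.
have mh2a : measurable_fun (`[0, t]%classic : set R) (fun s => (h2 t s * c2)%:E).
  by apply/measurable_EFinP; exact: measurable_funM.
have c1E : (\int[u t]_(s in `[0%R, t]) ((h1 t s * a `^ p)%:E + (h2 t s * c2)%:E))%E =
    (Hker u h1 t * a `^ p + Hker u h2 t * c2)%:E.
  rewrite ge0_integralD// EFinD !EFinM -(Hker_fin1 hS)// -(Hker_fin2 hS)//.
  rewrite -!ge0_integralZr ?lee_fin ?powR_ge0//.
  - exact/measurable_EFinP.
  - by move=> s /sge s0; rewrite lee_fin (sa_h2_ge0 hS).
  - exact/measurable_EFinP.
  - by move=> s /sge s0; rewrite lee_fin (sa_h1_ge0 hS).
have sumE s : (h1 t s * a `^ p + h2 t s * c2 + rest s)%:E =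
    ((h1 t s * a `^ p)%:E + (h2 t s * c2)%:E + (rest s)%:E)%E by rewrite -!EFinD.
move: mem; under [in leRHS]eq_integral do rewrite sumE.
rewrite ge0_integralD//; last 3 first.
- by move=> s Ds; apply: adde_ge0; [exact: h10|exact: h20].
- exact: emeasurable_funD.
- exact/measurable_EFinP.
rewrite c1E => mem; rewrite [in leLHS]EFinD.
rewrite -lee_fin in diss; apply: (le_trans (leeD diss mem)).
rewrite addeA leeD2r// -EFinD lee_fin le_eqVlt; apply/orP; left; apply/eqP.
by rewrite /c2; ring.
Qed.

End pathwise.

(** * Comparison with the integro-differential equation *)

Section comparison.
Context (R : realType).
Implicit Types (x y w : R -> R) (t s T : R).

Lemma derivative_within_continuous (D : set R) x t l :
  derivative_within D x t l -> x s @[s --> within D (nbhs t)] --> x t.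
Proof.
move=> hx; apply/cvgrPdist_lt => e e0.
have {}hx : \forall s \near within D t^', `|l - (x s - x t) / (s - t)| < 1.
  by move/cvgrPdist_lt : hx; exact.
move: hx; rewrite near_withinE near_withinE => /nbhs_ballP[r /= r0 hr].
have c0 : 0 < `|l| + 1 by rewrite ltr_wpDl.
apply/nbhs_ballP; exists (Num.min r (e / (`|l| + 1))) => /=.
  by rewrite lt_min r0 divr_gt0.
move=> s; rewrite /ball/= lt_min => /andP[sr se] Ds.
have [->|st] := eqVneq s t; first by rewrite subrr normr0.
have := hr s sr st Ds => h1.
have st0 : s - t != 0 by rewrite subr_eq0.
have -> : x t - x s = (x s - x t) / (s - t) * (t - s) by field.
rewrite normrM; apply: (@le_lt_trans _ _ ((`|l| + 1) * `|t - s|)).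
  rewrite ler_wpM2r//; set Q := _ / _ in h1 *.
  rewrite -[Q](subrK l) addrC (le_trans (ler_normD _ _))// lerD2l.
  by rewrite distrC ltW.
by rewrite mulrC -ltr_pdivlMr.
Qed.

Lemma derivative_within_seq (D : set R) x t l (h : nat -> R) :
  derivative_within D x t l -> (forall k, D (t + h k)) -> (forall k, 0 < h k) ->
  h k @[k --> \oo] --> 0 ->
  (h k)^-1 * (x (t + h k) - x t) @[k --> \oo] --> l.
Proof.
move=> hx Dh h0 hk.
have st : t + h k @[k --> \oo] --> within D t^'.
  have st : t + h k @[k --> \oo] --> t.
    by rewrite -[X in _ --> X]addr0; apply: cvgD => //; exact: cvg_cst.
  move=> B hB; have {}hB : nbhs t (fun s => s != t -> D s -> B s) := hB.
  have {}st : \forall k \near \oo, t + h k != t -> D (t + h k) -> B (t + h k) := st _ hB.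
  change (\forall k \near \oo, B (t + h k)); apply: filterS st => k; apply; last exact: Dh.
  by rewrite gt_eqF// ltrDl.
have := cvg_comp _ _ st hx; apply: cvg_trans; apply: near_eq_cvg; apply: nearW => k /=.
by rewrite mulrC addrAC subrr add0r.
Qed.

(** The crossing time is the infimum of the times at which [w] is positive;
    the sequence [h] approaches it from the right through such times. *)
Lemma first_crossing T w t1 :
  (forall t, 0 <= t <= T -> w s @[s --> within `[0, T] (nbhs t)] --> w t) ->
  w 0 < 0 -> 0 <= t1 <= T -> 0 < w t1 ->
  exists t (h : nat -> R), [/\ 0 <= t < T, w t = 0,
    forall s, 0 <= s <= t -> w s <= 0, h k @[k --> \oo] --> 0 &
    forall k, [/\ 0 < h k, t + h k <= T & 0 < w (t + h k)]].
Proof.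
move=> cw w0 /andP[t10 t1T] wt1.
pose E := [set s | 0 <= s <= t1 /\ 0 < w s].
have E1 : E t1 by split => //; rewrite t10 lexx.
have infE : has_inf E.
  by split; [exists t1|exists 0 => s [/andP[]]].
pose t := inf E.
have tge0 : 0 <= t by apply: lb_le_inf; [exists t1|move=> s [/andP[]]].
have tle1 : t <= t1 by apply: ge_inf => //; case: infE.
have tT : 0 <= t <= T by rewrite tge0 (le_trans tle1).
have before s : 0 <= s -> s < t -> w s <= 0.
  move=> s0 st; rewrite leNgt; apply/negP => ws.
  have : t <= s.
    apply: ge_inf; [by case: infE|split => //].
    by rewrite s0 (le_trans (ltW st)).
  by rewrite leNgt st.
have /choice[s hs] : forall k : nat, exists s, E s /\ s < t + k.+1%:R^-1.
  move=> k; have k0 : 0 < k.+1%:R^-1 :> R by rewrite invr_gt0.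
  have [s Es st] := inf_adherent k0 infE.
  by exists s.
have sE k : E (s k) := (hs k).1.
have ts k : t <= s k by apply: ge_inf; [case: infE|exact: sE].
have st : s k @[k --> \oo] --> t.
  apply/cvgrPdist_lt => e e0; near=> k.
  rewrite distrC ger0_norm ?subr_ge0 ?ts// ltrBlDl.
  apply: (lt_trans (hs k).2); rewrite ltrD2l; near: k.
  exact: near_infty_natSinv_lt (PosNum e0).
have sD k : (`[0, T]%classic : set R) (s k).
  by rewrite /= in_itv/=; have [/andP[-> s1] _] := sE k; rewrite (le_trans s1).
have wst : w (s k) @[k --> \oo] --> w t.
  exact: (cvg_within_comp_seq (cw t tT)).
have wt0 : 0 <= w t.
  by apply: (ler_cvg_to (cvg_cst (0 : R)) wst); apply: nearW => k; have [_ /ltW] := sE k.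
have wt : w t = 0.
  apply/eqP; rewrite eq_le wt0 andbT leNgt; apply/negP => wtp.
  have t0 : 0 < t.
    by rewrite lt_def tge0 andbT; apply: contraTneq wtp => ->; rewrite -leNgt ltW.
  have : \forall s \near within `[0, T]%classic (nbhs t), 0 < w s.
    exact: cvgr_gt (cw t tT) _ wtp.
  rewrite near_withinE => /nbhs_ballP[r /= r0 hr].
  pose s' := Num.max 0 (t - r / 2).
  have s't : s' < t by rewrite gt_max t0 ltrBlDr ltrDl divr_gt0.
  have s'0 : 0 <= s' by rewrite le_max lexx.
  have : 0 < w s'.
    apply: hr; last by rewrite /= in_itv/= s'0 (le_trans (ltW s't))//; case/andP: tT.
    rewrite /ball/= ger0_norm ?subr_ge0 1?ltW// ltrBlDr -ltrBlDl.
    by rewrite lt_max; apply/orP; right; rewrite ltrD2l ltrN2 ltr_pdivrMr// ltr_pMr// ltr1n.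
  by rewrite ltNge before.
exists t, (fun k => s k - t); split => //.
- rewrite tge0/= (lt_le_trans _ t1T)// lt_def tle1 andbT.
  by apply: contraTneq wt1 => ->; rewrite wt ltxx.
- move=> r /andP[r0]; rewrite le_eqVlt => /predU1P[->|]; first by rewrite wt.
  exact: before.
- by rewrite -(subrr t); apply: cvgB => //; exact: cvg_cst.
- move=> k; rewrite (addrC t) subrK; split; last by have [] := sE k.
    rewrite subr_gt0 lt_def ts andbT; have [_] := sE k.
    by apply: contraTneq => ->; rewrite wt ltxx.
  by have := sD k; rewrite /= in_itv/= => /andP[].
Unshelve. all: by end_near. Qed.

Context (u : R -> {measure set R -> \bar R}).

(** If [y] grows at most as fast as the equation allows, then it stays below
    [x + delta e^(lambda t)], which grows strictly faster once [lambda] exceeds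
    the total rate [A + M]: at the first crossing time the two upper
    derivatives would contradict each other. *)
Lemma comparison (T A M : R) (alpha : R -> R) (beta : R -> R -> R)
    (c : R -> \bar R) x y : 0 < T ->
  (forall t, 0 <= t <= T -> alpha t <= A) ->
  (forall t s, 0 <= t <= T -> 0 <= s <= t -> 0 <= beta t s) ->
  (forall t, 0 <= t <= T -> measurable_fun (`[0, t]%classic : set R) (beta t)) ->
  (forall t, 0 <= t <= T -> (\int[u t]_(s in `[0%R, t]) (beta t s)%:E <= M%:E)%E) ->
  (forall t, 0 <= t <= T -> (0 <= c t)%E) ->
  (forall t, 0 <= t -> 0 <= x t) -> (forall t, 0 <= y t) ->
  (forall t, 0 <= t <= T -> exists2 dx : R, derivative_within `[0, T] x t dx &
     dx%:E = ((alpha t * x t)%:E + \int[u t]_(s in `[0%R, t]) (beta t s * x s)%:E + c t)%E) ->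
  (forall t, 0 <= t <= T -> y s @[s --> within `[0, T] (nbhs t)] --> y t) ->
  (forall t (h : nat -> R), 0 <= t < T -> (forall k, 0 < h k) -> (forall k, t + h k <= T) ->
     h k @[k --> \oo] --> 0 ->
     exists2 l : R, (h k)^-1 * (y (t + h k) - y t) @[k --> \oo] --> l &
       (l%:E <= (alpha t * y t)%:E + (\int[u t]_(s in `[0%R, t]) (beta t s * y s)%:E + c t))%E) ->
  y 0 <= x 0 ->
  forall t, 0 <= t <= T -> y t <= x t.
Proof.
move=> T0 alphaA beta0 mb bM c0 x0 y0 hx cy hy yx0 t1 t1T.
have cx t : 0 <= t <= T -> x s @[s --> within `[0, T] (nbhs t)] --> x t.
  by move=> tT; have [dx /derivative_within_continuous] := hx t tT.
rewrite leNgt; apply/negP => xy1.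
pose lam := `|A| + `|M| + 1.
have lam0 : 0 <= lam by rewrite !addr_ge0.
pose g s := expR (lam * s).
(* half of the gap at [t1], so that [w] is still positive there *)
pose del := (y t1 - x t1) / (2 * g t1).
have del0 : 0 < del by rewrite divr_gt0 ?subr_gt0// mulr_gt0// expR_gt0.
pose w s := y s - x s - del * g s.
have cg : continuous g.
  move=> s; apply: (@continuous_comp _ _ _ (fun s => lam * s) expR); last exact: continuous_expR.
  exact: mulrl_continuous.
have [t [h [tT wt wle hk hw]]] : exists t (h : nat -> R), [/\ 0 <= t < T, w t = 0,
    forall s, 0 <= s <= t -> w s <= 0, h k @[k --> \oo] --> 0 &
    forall k, [/\ 0 < h k, t + h k <= T & 0 < w (t + h k)]].
  apply: (@first_crossing T w t1) => //.
  - move=> t tT; apply: cvgB; first by apply: cvgB; [exact: cy|exact: cx].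
    apply: cvgM; first exact: cvg_cst.
    by apply: cvg_trans (cg t); apply: cvg_app; exact: cvg_within.
  - by rewrite /w /g mulr0 expR0 mulr1 subr_lt0 (le_lt_trans _ del0)// subr_le0.
  - have -> : w t1 = (y t1 - x t1) / 2.
      by rewrite /w /del; field; rewrite gt_eqF// expR_gt0.
    by rewrite divr_gt0// subr_gt0.
have {tT} [tT0 tT] : 0 <= t <= T /\ 0 <= t < T.
  by split => //; case/andP: tT => -> /ltW.
have h0 k : 0 < h k by have [] := hw k.
have hT k : t + h k <= T by have [] := hw k.
have [l ly hl] := hy t h tT h0 hT hk.
have [dx ddx dxE] := hx t tT0.
pose G := del * g t.
have G0 : 0 < G by rewrite mulr_gt0// expR_gt0.
have ytE : y t = x t + G by move/eqP : wt; rewrite /w subr_eq0 subr_eq addrC => /eqP.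
have lower : dx + lam * G <= l.
  have Dh k : (`[0, T]%classic : set R) (t + h k).
    rewrite /= in_itv/= hT andbT addr_ge0//; last exact: ltW.
    by case/andP: tT.
  have qx : (h k)^-1 * (x (t + h k) - x t) + lam * G @[k --> \oo] --> dx + lam * G.
    by apply: cvgD; [exact: derivative_within_seq ddx Dh h0 hk|exact: cvg_cst].
  apply: (ler_cvg_to qx ly); apply: nearW => k.
  have [_ _ wk] := hw k.
  rewrite -(ler_pM2l (h0 k)) mulrDr !mulVKf ?gt_eqF// ytE.
  have gk : g t * (1 + lam * h k) <= g (t + h k).
    by rewrite /g [lam * (t + _)]mulrDr expRD ler_wpM2l ?expR_ge0// expR_ge1Dx.
  have : del * (g t * (1 + lam * h k)) <= del * g (t + h k) by rewrite ler_wpM2l// ltW.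
  move: wk; rewrite /w subr_gt0 /G => wk.
  lra.
have Ix0 : (0 <= \int[u t]_(s in `[0%R, t]) (beta t s * x s)%:E)%E.
  apply: integral_ge0 => s; rewrite /= in_itv/= => /andP[s0 st].
  by rewrite lee_fin mulr_ge0 ?x0// beta0// s0.
have upper : (l%:E <= dx%:E + ((`|A| + `|M|) * G)%:E)%E.
  apply: (le_trans hl).
  have Iy : (\int[u t]_(s in `[0%R, t]) (beta t s * y s)%:E <=
      \int[u t]_(s in `[0%R, t]) (beta t s * x s)%:E + (`|M| * G)%:E)%E.
    apply: (@le_trans _ _ (\int[u t]_(s in `[0%R, t])
        ((beta t s * x s)%:E + (beta t s)%:E * G%:E))%E).
      apply: ge0_le_integral_nonmeasurable => s; rewrite /= in_itv/= => /andP[s0 st].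
        by rewrite lee_fin mulr_ge0 ?y0// beta0// s0.
      rewrite -EFinM -EFinD lee_fin -mulrDr ler_wpM2l ?beta0 ?s0//.
      have := wle s; rewrite s0 st => /(_ isT); rewrite /w subr_le0 lerBlDl => /le_trans; apply.
      by rewrite lerD2l; apply: ler_wpM2l; [exact: ltW|rewrite /g ler_expR ler_wpM2l].
    have mx : measurable_fun (`[0, t]%classic : set R) x.
      apply: (@measurable_funS _ _ _ _ `[0, T]%classic) => //.
        by apply: subset_itvl; rewrite bnd_simp; case/andP: tT0.
      apply: subspace_continuous_measurable_fun => //.
      by apply/subspace_continuousP => s; rewrite /= in_itv/=; exact: cx.
    rewrite ge0_integralD//; last 4 first.
    - move=> s; rewrite /= in_itv/= => /andP[s0 st].
      by rewrite lee_fin mulr_ge0 ?x0// beta0// s0.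
    - by apply/measurable_EFinP; apply: measurable_funM => //; exact: mb.
    - move=> s; rewrite /= in_itv/= => /andP[s0 st].
      by rewrite -EFinM lee_fin mulr_ge0 ?beta0 ?s0// ltW.
    - by apply: emeasurable_funM => //; apply/measurable_EFinP; exact: mb.
    rewrite leeD2l// ge0_integralZr// ?lee_fin ?(ltW G0)//; last 2 first.
    - by apply/measurable_EFinP; exact: mb.
    - by move=> s; rewrite /= in_itv/= => /andP[s0 st]; rewrite lee_fin beta0// s0.
    rewrite (EFinM `|M|) lee_wpmul2r ?lee_fin ?(ltW G0)// (le_trans (bM t tT0))// lee_fin.
    exact: ler_norm.
  have aG : ((alpha t * G)%:E <= (`|A| * G)%:E)%E.
    by rewrite lee_fin ler_wpM2r ?(ltW G0)// (le_trans (alphaA t tT0))// ler_norm.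
  rewrite dxE ytE mulrDr mulrDl !EFinD.
  move: Iy aG Ix0 (c0 t tT0); set I := (\int[u t]_(s in _) (beta t s * x s)%:E)%E.
  set J := (\int[u t]_(s in _) (beta t s * y s)%:E)%E.
  move=> Iy aG I0 ct0.
  have ac (a b r e f : \bar R) : (a + b + r + (e + f) = a + e + (b + f + r))%E.
    by rewrite addeACA [(a + b + e)%E]addeAC -(addeA (a + e)%E b) [(r + f)%E]addeC (addeA b).
  rewrite ac.
  apply: leeD; first by rewrite leeD2l.
  by rewrite leeD2r.
move: upper; rewrite -EFinD lee_fin /lam in lower *.
by move=> upper; lra.
Qed.

End comparison.

(** * Growth of the truncated mean distance *)

Section bounded_integrals.
Local Open Scope ereal_scope.
Context (R : realType) (d : measure_display) (T : measurableType d)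
  (P : probability T R).

Lemma integrable_le_cst (A : set T) (f : T -> R) (c : R) : measurable A ->
  measurable_fun A f -> (forall w, A w -> `|f w|%R <= c)%R -> P.-integrable A (EFin \o f).
Proof.
move=> mA mf fc; apply: (@le_integrable _ _ _ _ _ mA _ (EFin \o cst c)).
- exact/measurable_EFinP.
- by move=> w Aw /=; rewrite lee_fin (le_trans (fc w Aw))// ler_norm.
- exact: finite_measure_integrable_cst.
Qed.

Lemma norm_Rintegral_le_cst (A : set T) (f : T -> R) (c : R) : measurable A ->
  measurable_fun A f -> (0 <= c)%R -> (forall w, A w -> `|f w| <= c)%R ->
  (`|\int[P]_(w in A) f w| <= c)%R.
Proof.
move=> mA mf c0 fc; have intf := integrable_le_cst mA mf fc.
rewrite -lee_fin EFin_normr_Rintegral// (le_trans (le_abse_integral _ _ _))//.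
  exact/measurable_EFinP.
apply: (@le_trans _ _ (\int[P]_(w in A) (cst c%:E) w)).
  by apply: ge0_le_integral_nonmeasurable => // w Aw; rewrite lee_fin fc.
rewrite integral_cst// -[leRHS]mule1 lee_wpmul2l ?lee_fin//.
exact: probability_le1.
Qed.

End bounded_integrals.

Section truncated.
Context (R : realType) (d N : nat) (hN : (0 < N)%N) (p : R) (F : 'rV[R]_d -> 'rV[R]_d)
  (L : R -> R -> 'rV[R]_d -> Pp d p -> 'rV[R]_d)
  (u : R -> {measure set R -> \bar R}) (h1 h2 : R -> R -> R) (kappa : R)
  (hS : structural_assumption F L u h1 h2 kappa)
  (disp : measure_display) (Omega : measurableType disp) (P : probability Omega R).
Local Notation V := 'rV[R]_d.
Local Notation clip := (Num.max (0 : R)).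

Context (X Y : 'I_N -> R -> Omega -> V) (nu : R -> Pp d p) (T eps eps' K n : R)
  (A : set Omega).
Local Notation Z i s w := (X i s w - Y i s w).
Context (K0 : 0 <= K) (eps0 : 0 < eps) (eps0' : 0 < eps') (n0 : 0 <= n)
  (mX : forall i s, measurable_fun setT (X i s))
  (cX : forall i w, continuous (fun s => X i s w))
  (mY : forall i s, measurable_fun setT (Y i s))
  (cY : forall i w, continuous (fun s => Y i s w))
  (cnu : Pp_continuous nu) (mA : measurable A)
  (Zle : forall w i s, A w -> 0 <= s <= T -> enorm (Z i s w) <= n)
  (Zlip : forall w i s r, A w -> 0 <= s <= T -> 0 <= r <= T ->
     enorm (Z i s w - Z i r w) <= n * `|s - r|)
  (intX : forall w i t, A w -> 0 <= t <= T ->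
     vintegrable (u t) `[0, t] (fun s => L t s (X i t w) (empirical p hN (fun j => X j s w))))
  (intY : forall w i t, A w -> 0 <= t <= T ->
     vintegrable (u t) `[0, t] (fun s => L t s (Y i t w) (nu s)))
  (dZ : forall w i t (h : nat -> R), A w -> 0 <= t < T -> (forall k, 0 < h k) ->
     (forall k, t + h k <= T) -> h k @[k --> \oo] --> 0 ->
     (h k)^-1 *: (Z i (t + h k) w - Z i t w) @[k --> \oo] -->
       drift F L u (fun s => empirical p hN (fun j => X j s w)) t (X i t w) -
       drift F L u nu t (Y i t w))
  (Kdef : forall i t, 0 <= t <= T -> {ae u t, forall s, 0 <= s <= t ->
     (\int[P]_(w in A) (defect p h2 t s (enorm (L t s (Y i t w) (empirical p hN (fun j => Y j s w)) -
        L t s (Y i t w) (nu s))))%:E <= (h2 t s * K)%:E)%E}).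

Local Notation q i s w := (enorm (X i s w - Y i s w) `^ p / p).
Local Notation r i s := (\int[P]_(w in A) (enorm (X i s w - Y i s w) `^ p / p)).

Let p0 : 0 < p := p_gt0 hS.
Let p1 : 1 <= p := sa_p_ge1 hS.

Let measurable_q i s : measurable_fun setT (fun w => q i s w).
Proof.
by apply: measurable_funM => //; apply: measurable_enorm_powR => //; exact: measurable_rowB.
Qed.

Let q_ge0 i s w : 0 <= q i s w.
Proof. by rewrite divr_ge0 ?powR_ge0// ltW. Qed.

Let q_lipschitz w i s t : A w -> 0 <= s <= T -> 0 <= t <= T ->
  `|q i s w - q i t w| <= n `^ (p - 1) * (n * `|s - t|).
Proof.
move=> Aw sT tT.
have h (a b : R) : 0 <= a <= n -> 0 <= b <= n ->
    (b `^ p - a `^ p) / p <= n `^ (p - 1) * `|b - a|.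
  move=> /andP[a0 an] /andP[b0 bn].
  have := powR_tangent_le p1 b0 a0; rewrite -(opprB b a) -(opprB (b `^ p)) mulrN mulNr lerN2.
  move=> /le_trans; apply; rewrite (le_trans (ler_wpM2l (powR_ge0 _ _) (ler_norm _)))//.
  by rewrite ler_wpM2r// ler_powR_base// subr_ge0.
have zs := Zle i Aw sT; have zt := Zle i Aw tT.
have -> : q i s w - q i t w = (enorm (Z i s w) `^ p - enorm (Z i t w) `^ p) / p.
  by rewrite mulrBl.
apply: (@le_trans _ _ (n `^ (p - 1) * `|enorm (Z i s w) - enorm (Z i t w)|)).
  rewrite ler_norml h ?enorm_ge0// andbT lerNl -mulNr opprB distrC.
  by rewrite h ?enorm_ge0.
rewrite ler_wpM2l ?powR_ge0// (le_trans _ (Zlip i Aw sT tT))//.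
exact: ler_dist_enorm.
Qed.

Lemma truncated_integrable i s : 0 <= s <= T -> P.-integrable A (EFin \o (fun w => q i s w)).
Proof.
move=> sT.
have qn w : A w -> `|q i s w| <= n `^ p / p.
  move=> Aw; rewrite ger0_norm// ler_wpM2r ?invr_ge0 ?(ltW p0)//.
  by apply: ler_powR_base; [exact: ltW|exact: enorm_ge0|exact: Zle].
by apply: (integrable_le_cst P _ _ qn) => //; exact: measurable_funTS.
Qed.

Lemma truncated_continuous i t : 0 <= t <= T -> r i s @[s --> within `[0, T] (nbhs t)] --> r i t.
Proof.
move=> tT.
pose c := n `^ (p - 1) * n.
have c0 : 0 <= c by rewrite mulr_ge0 ?powR_ge0.
have hlip s : 0 <= s <= T -> `|r i t - r i s| <= c * `|t - s|.
  move=> sT; rewrite -RintegralB//; try exact: truncated_integrable.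
  apply: norm_Rintegral_le_cst => //.
  - by apply: measurable_funTS; apply: measurable_funB; exact: measurable_q.
  - by rewrite mulr_ge0.
  - by move=> w Aw; rewrite -mulrA; exact: q_lipschitz.
apply/cvgrPdist_lt => e e0.
have c1 : 0 < c + 1 by rewrite ltr_wpDl.
have small : \forall s \near within `[0, T]%classic (nbhs t), `|t - s| < e / (c + 1).
  by apply/nbhs_ballP; exists (e / (c + 1)); [exact: divr_gt0|move=> ? ? _].
near=> s.
have sT : 0 <= s <= T.
  by near: s; apply: filterS (withinT _ (nbhs_filter t)) => s /=; rewrite in_itv.
rewrite (le_lt_trans (hlip s sT))//.
apply: (@le_lt_trans _ _ ((c + 1) * `|t - s|)); first by rewrite ler_wpM2r// lerDl.
by rewrite -ltr_pdivlMl// mulrC; near: s; exact: small.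
Unshelve. all: by end_near. Qed.


(** Young's inequality splits the memory term into a part proportional to the
    distance now, a part proportional to the mean distance in the past, and
    the defect; only the last one involves the distance between the empirical
    measure of the limit particles and their law. *)
Lemma truncated_growth i t (h : nat -> R) : 0 <= t < T -> (forall k, 0 < h k) ->
  (forall k, t + h k <= T) -> h k @[k --> \oo] --> 0 ->
  exists2 l : R, (h k)^-1 * (r i (t + h k) - r i t) @[k --> \oo] --> l &
    (l%:E <= ((p * (Hker u h1 t - kappa) + Hker u h2 t * (eps + eps') * (p - 1)) * r i t)%:E +
      (\int[u t]_(s in `[0%R, t])
         ((eps' `^ (p - 1))^-1 * h2 t s * (N%:R^-1 * \sum_j r j s))%:E +
       (Hker u h2 t / (p * eps `^ (p - 1)) * K)%:E))%E.
Proof.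
move=> tT h0 hT hk.
have [t0 tT'] : 0 <= t /\ 0 <= t <= T by case/andP: tT => -> /ltW ->.
have thT k : 0 <= t + h k <= T by rewrite hT andbT addr_ge0// ltW.
pose b w := drift F L u (fun s => empirical p hN (fun j => X j s w)) t (X i t w) -
       drift F L u nu t (Y i t w).
(* [e w] is a direction of the difference at time [t]; the limit [f] of the
   quotients inherits their measurability *)
have /choice[e he] : forall w, exists e : V, A w -> [/\ enorm e <= 1,
    enorm (Z i t w) *: e = Z i t w &
    (h k)^-1 * ((enorm (Z i (t + h k) w) `^ p - enorm (Z i t w) `^ p) / p) @[k --> \oo] -->
      enorm (Z i t w) `^ (p - 1) * edot e (b w)].
  move=> w; have [Aw|nAw] := pselect (A w); last by exists 0.
  have [e he] := enorm_powR_right_derivative p1 h0 hk (@dZ w i t h Aw tT h0 hT hk).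
  by exists e.
pose f w := enorm (Z i t w) `^ (p - 1) * edot (e w) (b w).
pose fk k w := (h k)^-1 * (q i (t + h k) w - q i t w).
have fkf w : A w -> fk k w @[k --> \oo] --> f w.
  move=> /he[_ _].
  by under eq_fun do rewrite mulrBl.
have mfk k : measurable_fun A (fk k).
  by apply: measurable_funTS; apply: measurable_funM => //; apply: measurable_funB; exact: measurable_q.
have mf : measurable_fun A f by exact: measurable_fun_cvg mfk fkf.
pose c := n `^ (p - 1) * n.
have c0 : 0 <= c by rewrite mulr_ge0 ?powR_ge0.
have fkc k w : A w -> `|fk k w| <= c.
  move=> Aw; rewrite normrM ger0_norm ?invr_ge0 ?(ltW (h0 k))//.
  rewrite mulrC ler_pdivrMr ?h0// (le_trans (q_lipschitz i Aw (thT k) tT'))//.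
  by rewrite (_ : t + h k - t = h k) ?ger0_norm ?(ltW (h0 k)) ?mulrA// addrC addKr.
have [] := @dominated_convergence _ _ _ P A mA (fun k w => (fk k w)%:E)
  (EFin \o f) (EFin \o cst c).
- by move=> k; apply/measurable_EFinP.
- by apply/measurable_EFinP.
- by apply: aeW => w Aw; apply: cvg_EFin; [exact: nearW|exact: fkf].
- exact: finite_measure_integrable_cst.
- by apply: aeW => w k Aw; rewrite /= lee_fin; exact: fkc.
move=> intf _ cvgf.
have intB (f1 f2 : Omega -> R) : P.-integrable A (EFin \o f1) -> P.-integrable A (EFin \o f2) ->
    P.-integrable A (EFin \o (fun w => f1 w - f2 w)).
  move=> i1 i2; under [X in _.-integrable _ X]eq_fun do rewrite /= EFinB.
  exact: integrableB.
have intZ a (f1 : Omega -> R) : P.-integrable A (EFin \o f1) ->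
    P.-integrable A (EFin \o (fun w => a * f1 w)).
  move=> i1; under [X in _.-integrable _ X]eq_fun do rewrite /= EFinM.
  exact: integrableZl.
have rE k : (h k)^-1 * (r i (t + h k) - r i t) = \int[P]_(w in A) fk k w.
  rewrite /fk RintegralZl//; last first.
    by apply: intB; exact: truncated_integrable.
  by rewrite RintegralB//; exact: truncated_integrable.
exists (\int[P]_(w in A) f w).
  under eq_fun do rewrite rE.
  by apply: fine_cvg; rewrite fineK//; exact: integrable_fin_num.
pose al := p * (Hker u h1 t - kappa) + Hker u h2 t * (eps + eps') * (p - 1).
(* Past times are clipped at 0 to have functions that are jointly measurable in
   time and chance on the whole product space, as Tonelli's theorem requires. *)
pose k2 s := h2 t (clip s).
pose W (z : R * Omega) := \sum_j enorm (Z j z.1 z.2) `^ p.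
pose lX (z : R * Omega) := enorm (L t (clip z.1) (Y i t z.2) (empirical p hN (fun j => Y j z.1 z.2)) -
  L t (clip z.1) (Y i t z.2) (nu (clip z.1))).
pose D z := defect p h2 t (clip z.1) (lX z).
pose rest z := k2 z.1 * (N%:R^-1 * W z / (p * eps' `^ (p - 1))) + D z / (p * eps `^ (p - 1)).
have ge0s (s : R) : (`[0, t]%classic : set R) s -> 0 <= s by rewrite /= in_itv/= => /andP[].
have k20 s : 0 <= k2 s by apply: (sa_h2_ge0 hS) => //; exact: clip_ge0.
have W0 z : 0 <= W z by apply: sumr_ge0 => j _; exact: powR_ge0.
have D0 z : 0 <= D z by apply: (defect_ge0 hS) => //; exact: clip_ge0.
have ce0 : 0 < p * eps `^ (p - 1) by rewrite mulr_gt0 ?powR_gt0.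
have ce0' : 0 < p * eps' `^ (p - 1) by rewrite mulr_gt0 ?powR_gt0.
have rest0 z : 0 <= rest z.
  rewrite addr_ge0 ?divr_ge0 ?(ltW ce0)// mulr_ge0// divr_ge0 ?(ltW ce0')//.
  by rewrite mulr_ge0.
have mXY (U : 'I_N -> R -> Omega -> V) : (forall i s, measurable_fun setT (U i s)) ->
    (forall i w, continuous (fun s => U i s w)) ->
    forall j, measurable_fun setT (fun z : R * Omega => U j z.1 z.2).
  move=> mU cU j; apply: measurable_row => // l.
  apply: (@measurable_continuous_process _ _ _ (fun s w => U j s w 0 l)).
    by move=> s; exact: (measurableT_comp (measurable_coord 0 l) (mU j s)).
  by move=> w s; exact: cvg_coord (cU j w s).
have mW : measurable_fun setT W.
  apply: measurable_sum => j; apply: measurable_enorm_powR => //.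
  by apply: measurable_rowB => //; exact: mXY.
have mk2 : measurable_fun setT k2 := measurable_h2_clip hS t0.
have mc1 : measurable_fun setT (fun z : R * Omega => clip z.1).
  by apply: measurableT_comp; [exact: measurable_clip|exact: measurable_fst].
have mY2 : measurable_fun setT (fun z : R * Omega => Y i t z.2).
  by apply: measurableT_comp; [exact: mY|exact: measurable_snd].
have mlX : measurable_fun setT lX.
  apply: (measurableT_comp (@measurable_enorm R d)); apply: measurable_rowB => //.
    apply: (measurable_L_comp hS) => //; first by move=> z; exact: clip_ge0.
    by apply: (measurable_empirical p0) => j; exact: mXY.
  apply: (measurable_L_comp hS) => //; first by move=> z; exact: clip_ge0.
  apply: (measurableT_comp (f := nu \o clip)) => //.
  have mnu := Pp_continuous_measurable p0 cnu.
  exact: (measurable_flow_clip mnu).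
have mD : measurable_fun setT D.
  have -> : D = (fun z => k2 z.1 * (lX z * k2 z.1 `^ (-1)) `^ p).
    by apply/funext => z; rewrite /D /defect -/(k2 z.1) powR_inv1.
  have mk21 : measurable_fun setT (fun z : R * Omega => k2 z.1) by exact: measurableT_comp.
  apply: measurable_funM => //; apply: (measurableT_comp (measurable_powR p)).
  by apply: measurable_funM => //; exact: (measurableT_comp (measurable_powR _) mk21).
have mrest : measurable_fun setT rest.
  apply: measurable_funD; last exact: measurable_funM.
  apply: measurable_funM; first exact: measurableT_comp.
  by do 2 apply: measurable_funM => //.
have pairw (w : Omega) : measurable_fun setT (fun s : R => (s, w)).
  exact: measurable_fun_pair.
have pairs (s : R) : measurable_fun setT (fun w : Omega => (s, w)).
  exact: measurable_fun_pair.
(* the constant [al] may be negative, so its term goes to the left and a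
   nonnegative integral remains on the right *)
have growth w : A w -> ((f w - al * q i t w)%:E <=
    \int[u t]_(s in `[0%R, t]) (rest (s, w))%:E)%E.
  move=> Aw; have [e1 ea _] := he w Aw.
  rewrite EFinB leeBlDl//.
  have mDs : measurable_fun (`[0, t]%classic : set R) (fun s => defect p h2 t s
      (enorm (L t s (Y i t w) (empirical p hN (fun j => Y j s w)) - L t s (Y i t w) (nu s)))).
    have : measurable_fun (`[0, t]%classic : set R) (fun s => D (s, w)).
      by apply: measurable_funTS; exact: measurableT_comp (pairw w).
    apply: eq_measurable_fun => s; rewrite inE => /ge0s s0.
    by rewrite /D /lX /= clip_id.
  have := @pathwise_growth R d N hN p F L u h1 h2 kappa hS t i (fun j s => X j s w)
    (fun j s => Y j s w) nu (e w) (enorm (Z i t w)) eps eps' t0 eps0 eps0'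
    (intX i Aw tT') (intY i Aw tT') (measurable_funTS (measurableT_comp mW (pairw w))) mDs
    e1 ea erefl.
  have -> : (Hker u h1 t - kappa + Hker u h2 t * ((eps + eps') * (p - 1) / p)) *
      enorm (Z i t w) `^ p = al * q i t w.
    by rewrite /al; field; rewrite gt_eqF.
  set I1 := (\int[u t]_(s in _) _)%E => H.
  have -> // : (\int[u t]_(s in `[0%R, t]) (rest (s, w))%:E)%E = I1.
  apply: eq_integral => s; rewrite inE => /ge0s s0.
  by rewrite /rest /D /lX /k2 /= clip_id.
have step1 : ((\int[P]_(w in A) f w - al * r i t)%:E <=
    \int[u t]_(s in `[0%R, t]) \int[P]_(w in A) (rest (s, w))%:E)%E.
  have intq := truncated_integrable i tT'.
  have intqf : P.-integrable A (EFin \o (fun w => f w - al * q i t w)).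
    by apply: intB => //; exact: intZ.
  rewrite -RintegralZl// -RintegralB//; last exact: intZ.
  rewrite fineK; last exact: integrable_fin_num.
  rewrite -(@tonelli_restricted _ _ _ _ _ (u t) P _ _ (fun z => (rest z)%:E))//.
  - apply: integral_le_ge0 => //.
    by move=> w Aw; apply: integral_ge0 => s _; rewrite lee_fin.
  - exact: sa_u_finite hS _ t0.
  - exact/measurable_EFinP.
pose y s := N%:R^-1 * \sum_j r j s.
have y0 s : 0 <= y s.
  by rewrite mulr_ge0// sumr_ge0// => j _; apply: Rintegral_ge0.
have my : measurable_fun (`[0, t]%classic : set R) y.
  apply: measurable_funM => //; apply: measurable_sum => j.
  apply: (@measurable_funS _ _ _ _ `[0, T]%classic) => //.
    by apply: subset_itvl; rewrite bnd_simp; case/andP: tT'.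
  apply: subspace_continuous_measurable_fun => //.
  by apply/subspace_continuousP => s; rewrite /= in_itv/=; exact: truncated_continuous.
have Kc0 : 0 <= K / (p * eps `^ (p - 1)) by rewrite divr_ge0// ltW.
have h2E s : 0 <= s -> k2 s = h2 t s by move=> s0; rewrite /k2 clip_id.
have h20 s : (`[0, t]%classic : set R) s -> 0 <= h2 t s by move=> /ge0s s0; rewrite -h2E.
have b0 s : (`[0, t]%classic : set R) s -> 0 <= (eps' `^ (p - 1))^-1 * h2 t s * y s.
  move=> Ds; apply: mulr_ge0 => //; apply: mulr_ge0; last exact: h20.
  by rewrite invr_ge0 powR_ge0.
have mb : measurable_fun (`[0, t]%classic : set R)
    (fun s => ((eps' `^ (p - 1))^-1 * h2 t s * y s)%:E).
  apply/measurable_EFinP; apply: measurable_funM => //; apply: measurable_funM => //.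
  exact: (measurable_h2 hS).
have mK : measurable_fun (`[0, t]%classic : set R)
    (fun s => (h2 t s * (K / (p * eps `^ (p - 1))))%:E).
  by apply/measurable_EFinP; apply: measurable_funM => //; exact: (measurable_h2 hS).
have step2 : (\int[u t]_(s in `[0%R, t]) \int[P]_(w in A) (rest (s, w))%:E <=
  \int[u t]_(s in `[0%R, t]) (((eps' `^ (p - 1))^-1 * h2 t s * y s)%:E +
     (h2 t s * (K / (p * eps `^ (p - 1))))%:E))%E.
  apply: ae_ge0_le_integral => //.
  - by move=> s _; apply: integral_ge0 => w _; rewrite lee_fin.
  - apply: measurable_funTS; apply: (@measurable_section_integral _ _ _ _ _ _ _ (fun z => (rest z)%:E)) => //.
    exact/measurable_EFinP.
  - by move=> s Ds; rewrite adde_ge0// lee_fin ?b0// mulr_ge0// h20.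
  - by apply: emeasurable_funD; [exact: mb|exact: mK].
  apply: filterS (Kdef i tT') => s Ks Ds; have s0 := ge0s _ Ds.
  have st : 0 <= s <= t by move: Ds; rewrite /= in_itv.
  have sT : 0 <= s <= T by rewrite s0; case/andP: st => _ /le_trans -> //; case/andP: tT'.
  have mDs : measurable_fun setT (fun w => (D (s, w))%:E).
    by apply/measurable_EFinP; exact: measurableT_comp (pairs s).
  have mWs : measurable_fun setT (fun w => W (s, w)) by exact: measurableT_comp (pairs s).
  under eq_integral do rewrite EFinD.
  rewrite ge0_integralD//; last 4 first.
  - move=> w _; rewrite lee_fin mulr_ge0// divr_ge0 ?(ltW ce0')// mulr_ge0//.
  - apply/measurable_EFinP; apply: measurable_funTS; apply: measurable_funM.
      exact: (@measurable_cst _ _ _ _ _ (k2 s)).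
    by do 2 apply: measurable_funM => //.
  - by move=> w _; rewrite lee_fin divr_ge0// ltW.
  - by apply: measurable_funTS; apply/measurable_EFinP; apply: measurable_funM => //; exact/measurable_EFinP.
  apply: leeD.
    rewrite le_eqVlt; apply/orP; left; apply/eqP.
    pose c' := (eps' `^ (p - 1))^-1 * h2 t s * N%:R^-1.
    rewrite (eq_integral (fun w => c'%:E * \sum_(j < N) (q j s w)%:E)%E); last first.
      move=> w _; rewrite sumEFin -EFinM /= h2E// -mulr_suml /c'; congr EFin.
      by rewrite /W /=; field; rewrite !gt_eqF ?powR_gt0 ?ltr0n.
    have intqs j : P.-integrable A (fun w => (q j s w)%:E) by exact: truncated_integrable.
    rewrite ge0_integralZl//; last 3 first.
    - by apply: emeasurable_sum => j; exact: measurable_int (intqs j).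
    - by move=> w _; apply: sume_ge0 => j _; rewrite lee_fin.
    - by rewrite lee_fin /c' !mulr_ge0 ?invr_ge0 ?powR_ge0 ?h20.
    rewrite integral_sum//.
    under eq_bigr => j _ do rewrite -(fineK (integrable_fin_num mA (intqs j))).
    by rewrite sumEFin -EFinM /c' /y mulrA.
  under eq_integral do rewrite EFinM.
  rewrite ge0_integralZr//; last 3 first.
  - exact: measurable_funTS.
  - by move=> w _; rewrite lee_fin.
  - by rewrite lee_fin invr_ge0 ltW.
  rewrite mulrA EFinM lee_wpmul2r ?lee_fin ?invr_ge0 ?(ltW ce0)//.
  apply: le_trans (Ks st).
  rewrite le_eqVlt; apply/orP; left; apply/eqP; apply: eq_integral => w _.
  by rewrite /D /lX /= clip_id.
rewrite EFinB leeBlDl// in step1.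
apply: (le_trans step1); rewrite leeD2l// (le_trans step2)//.
rewrite ge0_integralD//; last by move=> s Ds; rewrite lee_fin mulr_ge0// h20.
rewrite leeD2l//.
under eq_integral do rewrite EFinM.
rewrite ge0_integralZr//; last by apply/measurable_EFinP; exact: (measurable_h2 hS).
by rewrite (Hker_fin2 hS)// -EFinM lee_fin mulrA mulrAC.
Qed.

End truncated.

(** * The difference of two particles *)

Section particle_difference.
Context (R : realType) (d : nat) (p : R) (F : 'rV[R]_d -> 'rV[R]_d)
  (L : R -> R -> 'rV[R]_d -> Pp d p -> 'rV[R]_d)
  (u : R -> {measure set R -> \bar R}) (h1 h2 : R -> R -> R) (kappa : R)
  (hS : structural_assumption F L u h1 h2 kappa) (T : R).
Local Notation V := 'rV[R]_d.
Local Notation leb := (@lebesgue_measure R).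
Implicit Types (b x y : R -> V) (nu : R -> Pp d p).

Lemma solves_difference b nu1 nu2 x y t : solves_on F L u T b nu1 x -> solves_on F L u T b nu2 y ->
  0 <= t <= T ->
  x t - y t = x 0 - y 0 + (vintegral leb `[0, t] (fun s => drift F L u nu1 s (x s)) -
    vintegral leb `[0, t] (fun s => drift F L u nu2 s (y s))).
Proof.
move=> [_ _ _ ex] [_ _ _ ey] tT; rewrite (ex t tT) (ey t tT).
set v1 := vintegral _ _ _; set v2 := vintegral _ _ _.
by rewrite opprD addrACA; congr (_ + _); rewrite opprD addrACA subrr addr0.
Qed.

(** The noise [b] is common to the two particles and cancels. *)
Lemma solves_difference_derivative b nu1 nu2 x y t (h : nat -> R) :
  Pp_continuous nu1 -> Pp_continuous nu2 -> solves_on F L u T b nu1 x -> solves_on F L u T b nu2 y ->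
  0 <= t < T -> (forall k, 0 < h k) -> (forall k, t + h k <= T) -> h k @[k --> \oo] --> 0 ->
  (h k)^-1 *: ((x (t + h k) - y (t + h k)) - (x t - y t)) @[k --> \oo] -->
    drift F L u nu1 t (x t) - drift F L u nu2 t (y t).
Proof.
move=> c1 c2 sx sy tT h0 hT hk.
have [t0 tT'] : 0 <= t /\ 0 <= t <= T by case/andP: tT => -> /ltW ->.
have thT k : 0 <= t + h k <= T by rewrite hT andbT addr_ge0// ltW.
have dx := vintegral_right_derivative t0 (solves_drift sx)
  (solves_drift_continuous hS c1 sx tT') h0 hT hk.
have dy := vintegral_right_derivative t0 (solves_drift sy)
  (solves_drift_continuous hS c2 sy tT') h0 hT hk.
have alg (c a1 a2 a3 a4 : V) : c + (a1 - a2) - (c + (a3 - a4)) = a1 - a3 - (a2 - a4).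
  by rewrite opprD addrACA subrr add0r !opprD !opprK addrACA.
suff -> : (fun k => (h k)^-1 *: ((x (t + h k) - y (t + h k)) - (x t - y t))) =
  (fun k => (h k)^-1 *: (vintegral leb `[0, t + h k] (fun s => drift F L u nu1 s (x s)) -
     vintegral leb `[0, t] (fun s => drift F L u nu1 s (x s))) -
   (h k)^-1 *: (vintegral leb `[0, t + h k] (fun s => drift F L u nu2 s (y s)) -
     vintegral leb `[0, t] (fun s => drift F L u nu2 s (y s)))) by exact: cvgB.
apply/funext => k; rewrite -scalerBr; congr (_ *: _).
rewrite (solves_difference sx sy (thT k)) (solves_difference sx sy tT').
exact: alg.
Qed.

(** On a compact interval the derivative of the difference is bounded. *)
Lemma solves_difference_bounded b nu1 nu2 x y : 0 < T ->
  Pp_continuous nu1 -> Pp_continuous nu2 -> solves_on F L u T b nu1 x -> solves_on F L u T b nu2 y ->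
  exists n : nat,
    (forall s, 0 <= s <= T -> enorm (x s - y s) <= n%:R) /\
    (forall s r, 0 <= s <= T -> 0 <= r <= T ->
       enorm ((x s - y s) - (x r - y r)) <= n%:R * `|s - r|).
Proof.
move=> T0 c1 c2 sx sy.
pose g s := drift F L u nu1 s (x s) - drift F L u nu2 s (y s).
have cg (t : R) : 0 <= t <= T -> g s @[s --> within `[0, T] (nbhs t)] --> g t.
  move=> tT; apply: cvgB; first exact: (solves_drift_continuous hS c1 sx tT).
  exact: (solves_drift_continuous hS c2 sy tT).
have [M M0 hM] : exists2 M : R, 0 <= M & forall s : R, 0 <= s <= T -> enorm (g s) <= M.
  have cng : {within `[0, T], continuous (fun s => enorm (g s))}.
    by apply/subspace_continuousP => s; rewrite /= in_itv/= => sT; exact: cvg_enorm (cg s sT).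
  have [c _ hc] := EVT_max (ltW T0) cng.
  exists (enorm (g c)); first exact: enorm_ge0.
  by move=> s sT; apply: hc; rewrite in_itv.
have intg (t : R) : 0 <= t <= T -> vintegrable leb `[0, t] g.
  by move=> tT; apply: vintegrableB => //; [exact: solves_drift sx _ tT|exact: solves_drift sy _ tT].
have dE t : 0 <= t <= T -> x t - y t = x 0 - y 0 + vintegral leb `[0, t] g.
  move=> tT; rewrite (solves_difference sx sy tT) vintegralB//.
    exact: solves_drift sx _ tT.
  exact: solves_drift sy _ tT.
have incr r s : 0 <= r -> r <= s -> s <= T ->
    enorm ((x s - y s) - (x r - y r)) <= M * (s - r).
  move=> r0 rs sT; have sT' : 0 <= s <= T by rewrite sT (le_trans r0).
  have rT' : 0 <= r <= T by rewrite r0 (le_trans rs).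
  have := vintegral_increment_le (c := 0) (eta := M) r0 rs (intg s sT').
  rewrite scaler0 subr0 (dE s sT') (dE r rT') opprD addrACA subrr add0r; apply.
  move=> a /andP[ra as_]; rewrite subr0; apply: hM.
  by rewrite (le_trans r0)//= (le_trans as_).
pose n := (Num.Def.archi_bound (enorm (x 0 - y 0) + M * T + M)).
have nM : M <= n%:R /\ enorm (x 0 - y 0) + M * T <= n%:R.
  have MT : 0 <= M * T by rewrite mulr_ge0// ltW.
  have : enorm (x 0 - y 0) + M * T + M <= n%:R.
    by apply: ltW; apply: archi_boundP; rewrite !addr_ge0 ?enorm_ge0.
  by have := enorm_ge0 (x 0 - y 0); split; lra.
exists n; split=> [s sT|s r sT rT].
  have /andP[s0 sT'] := sT.
  have := incr 0 s (lexx 0) s0 sT'; rewrite subr0 => h.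
  rewrite -[x s - y s](subrK (x 0 - y 0)) (le_trans (enormD _ _))//.
  apply: le_trans nM.2; rewrite addrC lerD2l (le_trans h)//.
  by rewrite ler_wpM2l.
have [rs|/ltW sr] := leP r s.
  rewrite ger0_norm ?subr_ge0//; apply: (@le_trans _ _ (M * (s - r))).
    by apply: incr => //; [case/andP: rT|case/andP: sT].
  by rewrite ler_wpM2r ?subr_ge0//; case: nM.
rewrite enormB distrC ger0_norm ?subr_ge0//; apply: (@le_trans _ _ (M * (r - s))).
  by apply: incr => //; [case/andP: sT|case/andP: rT].
by rewrite ler_wpM2r ?subr_ge0//; case: nM.
Qed.

(** The coupling of equal indices reduces continuity for [Wp] to that of the
    paths. *)
Lemma empirical_flow_continuous (N : nat) (hN : (0 < N)%N) (x : 'I_N -> R -> V) :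
  (forall i, {within `[0, +oo[, continuous (x i)}) ->
  Pp_continuous (fun s => empirical p hN (fun j => x j s)).
Proof.
move=> cx; have p0 := p_gt0 hS.
apply: (@Pp_continuousP R d p p0 _
  (fun s t => N%:R^-1 * \sum_(i < N) enorm (x i s - x i t) `^ p)).
- by move=> s t _ _; rewrite mulr_ge0 ?invr_ge0// sumr_ge0// => j _; exact: powR_ge0.
- by move=> s t _ _; exact: (Wp_empirical_le p0).
- move=> t t0; rewrite -[X in _ --> X](mulr0 N%:R^-1); apply: cvgM; first exact: cvg_cst.
  have e0 : 0 = \sum_(i < N) (0 : R) by rewrite big1.
  rewrite [X in _ --> X]e0.
  apply: cvg_sumr => j.
  have /subspace_continuousP /(_ t) : {within `[0, +oo[, continuous (x j)} by [].
  rewrite /= in_itv/= t0 => /(_ isT) cxt.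
  rewrite -[X in _ --> X](@powR0 R p) ?gt_eqF//; apply: cvg_powR => //.
  + exact: ltW.
  + by apply: nearW => s; exact: enorm_ge0.
  + by under eq_fun do rewrite enormB; apply/cvg_enormB.
Qed.

End particle_difference.

(** * Truncation and passage to the limit *)

Section regular_events.
Context (R : realType) (d N : nat) (disp : measure_display)
  (Omega : measurableType disp) (T : R) (G : set Omega) (Z : 'I_N -> R -> Omega -> 'rV[R]_d).
Local Notation V := 'rV[R]_d.

Definition rat_time (q : rat) : R := Num.min (Num.max 0 (ratr q)) T.

Lemma rat_time_bound q : 0 < T -> 0 <= rat_time q <= T.
Proof.
by move=> T0; rewrite le_min le_max lexx/= ltW//= ge_min lexx orbT.
Qed.

Lemma rat_time_dense s : 0 <= s <= T ->
  exists q : nat -> rat, rat_time (q k) @[k --> \oo] --> s.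
Proof.
move=> /andP[s0 sT].
have /choice[q hq] : forall k : nat, exists q : rat,
    (ratr q : R) \in `]s - k.+1%:R^-1, s + k.+1%:R^-1[.
  by move=> k; apply: rat_in_itvoo; rewrite ltrBlDr -addrA ltrDl addr_gt0// invr_gt0.
exists q; have qs : (ratr (q k) : R) @[k --> \oo] --> s.
  apply/cvgrPdist_lt => e e0; near=> k.
  have := hq k; rewrite in_itv/= => /andP[a b].
  have ke : k.+1%:R^-1 < e by near: k; exact: near_infty_natSinv_lt (PosNum e0).
  apply: (lt_trans _ ke); move: (ratr (q k)) (k.+1%:R^-1) a b => v z a b.
  by rewrite ltr_norml; apply/andP; split; lra.
have c : {for s, continuous (fun r : R => Num.min (Num.max 0 r) T)}.
  apply: continuous_min; last exact: cst_continuous.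
  by apply: continuous_max; [exact: cst_continuous|exact: cvg_id].
have {c} : rat_time (q k) @[k --> \oo] --> Num.min (Num.max 0 s) T.
  exact: (continuous_cvg _ c qs).
by rewrite (max_r s0) (min_l sT).
Unshelve. all: by end_near. Qed.

(** The paths of [Z] are bounded by [n] and [n]-Lipschitz on [[0, T]].  It is
    enough to say so at rational times, which makes the event measurable. *)
Definition regular_event (n : nat) : set Omega :=
  G `&` \bigcap_(z in [set: 'I_N * rat * rat]) [set w |
    enorm (Z z.1.1 (rat_time z.1.2) w) <= n%:R /\
    enorm (Z z.1.1 (rat_time z.1.2) w - Z z.1.1 (rat_time z.2) w) <=
      n%:R * `|rat_time z.1.2 - rat_time z.2| ].

Lemma measurable_regular_event n : 0 < T -> measurable G ->
  (forall i s, 0 <= s <= T -> measurable_fun setT (Z i s)) -> measurable (regular_event n).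
Proof.
move=> T0 mG mZ; apply: measurableI => //.
rewrite -[X in measurable X]setCK setC_bigcap; apply: measurableC.
apply: countable_bigcupT_measurable => // -[[i q1] q2]; apply: measurableC => /=.
have m1 := mZ i _ (rat_time_bound q1 T0).
have m12 := measurable_rowB measurableT m1 (mZ i _ (rat_time_bound q2 T0)).
have me (f : Omega -> V) (c : R) : measurable_fun setT f -> measurable [set w | enorm (f w) <= c].
  move=> mf; rewrite -[X in measurable X]setTI.
  apply: (measurableT_comp (@measurable_enorm R d) mf measurableT
    (measurable_itv `]-oo, c])) => //.
by apply: measurableI; exact: me.
Qed.

Lemma regular_event_nondecreasing : {homo regular_event : m n / (m <= n)%N >-> (m <= n)%O}.
Proof.
move=> m n mn; apply/subsetPset => w [Gw hw]; split=> // z _.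
have [a b] := hw z Logic.I; have mnR : m%:R <= n%:R :> R by rewrite ler_nat.
split; first exact: le_trans mnR.
by rewrite (le_trans b)// ler_wpM2r.
Qed.

Lemma bigcup_regular_event :
  (forall w, G w -> forall i, exists n : nat,
     (forall s, 0 <= s <= T -> enorm (Z i s w) <= n%:R) /\
     (forall s r, 0 <= s <= T -> 0 <= r <= T -> enorm (Z i s w - Z i r w) <= n%:R * `|s - r|)) ->
  0 < T -> \bigcup_n regular_event n = G.
Proof.
move=> hZ T0; apply/seteqP; split=> [w [n _ []]//|w Gw].
have /choice[n hn] := hZ w Gw.
pose M := (\max_(i < N) n i)%N; exists M => //; split=> // -[[i q1] q2] _ /=.
have nM : (n i)%:R <= M%:R :> R by rewrite ler_nat; exact: leq_bigmax.
have [a b] := hn i; have b1 := rat_time_bound q1 T0; have b2 := rat_time_bound q2 T0.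
split; first exact: le_trans (a _ b1) nM.
by rewrite (le_trans (b _ _ b1 b2))// ler_wpM2r.
Qed.

Context (T0 : 0 < T)
  (cZ : forall w i (t : R), G w -> 0 <= t <= T ->
     Z i s w @[s --> within `[0, T] (nbhs t)] --> Z i t w).

Let rat_timeD q : (`[0, T]%classic : set R) (rat_time q).
Proof. by rewrite /= in_itv/=; exact: rat_time_bound. Qed.

Lemma regular_event_bounded n w i s : regular_event n w -> 0 <= s <= T ->
  enorm (Z i s w) <= n%:R.
Proof.
move=> [Gw hw] sT; have [q qs] := rat_time_dense sT.
have h : enorm (Z i (rat_time (q k)) w) @[k --> \oo] --> enorm (Z i s w).
  exact: cvg_enorm (cvg_within_comp_seq (@cZ w i s Gw sT) (fun k => rat_timeD (q k)) qs).
apply: (ler_cvg_to h (cvg_cst (n%:R : R))); apply: nearW => k.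
by have [] := hw (i, q k, q k) Logic.I.
Qed.

Lemma regular_event_lipschitz n w i s r : regular_event n w -> 0 <= s <= T -> 0 <= r <= T ->
  enorm (Z i s w - Z i r w) <= n%:R * `|s - r|.
Proof.
move=> [Gw hw] sT rT.
have [q qs] := rat_time_dense sT; have [q' qr] := rat_time_dense rT.
have hs := cvg_within_comp_seq (@cZ w i s Gw sT) (fun k => rat_timeD (q k)) qs.
have hr := cvg_within_comp_seq (@cZ w i r Gw rT) (fun k => rat_timeD (q' k)) qr.
have h1 : n%:R * `|rat_time (q k) - rat_time (q' k)| @[k --> \oo] --> n%:R * `|s - r|.
  by apply: cvgM; [exact: cvg_cst|apply: cvg_norm; exact: cvgB].
have h2 : enorm (Z i (rat_time (q k)) w - Z i (rat_time (q' k)) w) @[k --> \oo] -->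
    enorm (Z i s w - Z i r w) by exact: cvg_enorm (cvgB hs hr).
apply: (ler_cvg_to h2 h1); apply: nearW => k.
by have [] := hw (i, q k, q' k) Logic.I.
Qed.

End regular_events.

Section extended_process.
Context (R : realType) (d : nat) (disp : measure_display)
  (Omega : measurableType disp) (G : set Omega) (X : R -> Omega -> 'rV[R]_d).
Local Notation clip := (Num.max (0 : R)).

(** The process stopped before time [0] and set to [0] off [G], so that all of
    its paths are continuous on the whole line. *)
Definition extended (s : R) (w : Omega) : 'rV[R]_d := if w \in G then X (clip s) w else 0.

Lemma extendedE s w : G w -> 0 <= s -> extended s w = X s w.
Proof. by move=> Gw s0; rewrite /extended mem_set// clip_id. Qed.

Lemma measurable_extended s : measurable G ->
  (forall t, 0 <= t -> measurable_fun setT (X t)) -> measurable_fun setT (extended s).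
Proof.
move=> mG mX; apply: measurable_fun_ifT => //; last exact: mX (clip_ge0 s).
apply: (@measurable_fun_bool _ _ _ _ true) => //.
rewrite setTI; have -> // : (fun w => w \in G) @^-1` [set true] = G.
by apply/seteqP; split => w /=; [exact: set_mem|exact: mem_set].
Qed.

Lemma continuous_extended w :
  (G w -> {within `[0, +oo[, continuous (fun t => X t w)}) ->
  continuous (fun s => extended s w).
Proof.
move=> cX; rewrite /extended; case: (boolP (w \in G)) => [|_]; last exact: cst_continuous.
rewrite inE => /cX /subspace_continuousP {}cX s.
have cD (r : R) : (`[0, +oo[%classic : set R) (clip r) by rewrite /= in_itv/= clip_ge0.
apply: (cvg_comp _ _ _ (cX _ (cD s))) => B hB.
have {}hB : \forall r \near nbhs (clip s), (`[0, +oo[%classic : set R) r -> B r := hB.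
have h : \forall r \near nbhs s, (`[0, +oo[%classic : set R) (clip r) -> B (clip r) :=
  @clip_continuous R s _ hB.
by change (\forall r \near nbhs s, B (clip r)); apply: filterS h => r; apply; exact: cD.
Qed.

End extended_process.

Section mean_distance.
Context (R : realType) (d k N : nat) (hN : (0 < N)%N) (p T : R)
  (disp : measure_display) (Omega : measurableType disp)
  (P : probability Omega R) (Ft : R -> set (set Omega)) (hFt : filtration Ft)
  (sigma : 'M[R]_(d, k)) (F : 'rV[R]_d -> 'rV[R]_d)
  (L : R -> R -> 'rV[R]_d -> Pp d p -> 'rV[R]_d)
  (u : R -> {measure set R -> \bar R}) (h1 h2 : R -> R -> R) (kappa : R)
  (hS : structural_assumption F L u h1 h2 kappa) (T0 : 0 < T).
Local Notation V := 'rV[R]_d.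

Context (B : 'I_N -> R -> Omega -> 'rV[R]_k) (X Xbar : 'I_N -> R -> Omega -> V)
  (mu nu : R -> Pp d p)
  (hX : forall i, sde_solution P Ft sigma F L u (B i)
     (fun w s => empirical p hN (fun j => X j s w)) (X i))
  (hXbar : forall i, sde_solution P Ft sigma F L u (B i) (fun=> mu) (Xbar i))
  (cnu : Pp_continuous nu) (smn : same_memory L u T mu nu)
  (eps eps' K : R) (eps0 : 0 < eps) (eps0' : 0 < eps') (K0 : 0 <= K)
  (hK : forall t, 0 <= t <= T -> {ae u t, forall s, 0 <= s <= t -> h2 t s = 0 \/
     (\int[P]_w (Wp p (empirical_prob (fun j => Xbar j s w) hN) (nu s) `^ p) <= K%:E)%E}).

Let p0 : 0 < p := p_gt0 hS.
Let p1 : 1 <= p := sa_p_ge1 hS.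

Let mX i s : 0 <= s -> measurable_fun setT (X i s).
Proof. by move=> s0; exact: (adapted_measurable hFt (sde_adapted (hX i)) s0). Qed.

Let mXbar i s : 0 <= s -> measurable_fun setT (Xbar i s).
Proof. by move=> s0; exact: (adapted_measurable hFt (sde_adapted (hXbar i)) s0). Qed.

Let good_event : exists G, [/\ measurable G, P (~` G) = 0%E &
  forall w i, G w -> [/\ {within `[0, +oo[, continuous (fun t => X i t w)},
    {within `[0, +oo[, continuous (fun t => Xbar i t w)},
    solves_on F L u T (fun t => B i t w *m sigma^T)
      (fun s => empirical p hN (fun j => X j s w)) (fun t => X i t w) &
    solves_on F L u T (fun t => B i t w *m sigma^T) nu (fun t => Xbar i t w)]].
Proof.
have [Nul [mNul PNul sub]] := filterI (filter_forall _ (fun i => sde_solves_on T (hX i)))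
  (filter_forall _ (fun i => sde_solves_on T (hXbar i))).
exists (~` Nul); split; [exact: measurableC|by rewrite setCK|].
move=> w i nNw; have [hXw hXbarw] := contrapT (fun h => nNw (sub w h)).
have [cX sX] := hXw i; have [cXbar sXbar] := hXbarw i.
split=> //; exact: (solves_on_same_memory hS cnu smn sXbar).
Qed.

(** The ratio of the increment of [L] to [h2 t s] is at most the Wasserstein
    distance.  The ratio is measurable in [w], and the factor [h2 t s] is taken
    out of its integral before it is compared with that of the distance. *)
Let defect_expectation (A : set Omega) i t s (Y : 'I_N -> R -> Omega -> V) :
  measurable A -> 0 <= t -> 0 <= s -> (forall i s, measurable_fun setT (Y i s)) ->
  (forall w j r, A w -> 0 <= r -> Y j r w = Xbar j r w) ->
  (h2 t s = 0 \/
   (\int[P]_w (Wp p (empirical_prob (fun j => Xbar j s w) hN) (nu s) `^ p) <= K%:E)%E) ->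
  (\int[P]_(w in A) (defect p h2 t s (enorm (L t s (Y i t w) (empirical p hN (fun j => Y j s w)) -
        L t s (Y i t w) (nu s))))%:E <= (h2 t s * K)%:E)%E.
Proof.
move=> mA t0 s0 mY YE [h20|hW].
  rewrite h20 mul0r integral0_eq// => w _.
  by rewrite /defect h20 mul0r.
have [h20|h2n] := eqVneq (h2 t s) 0.
  rewrite h20 mul0r integral0_eq// => w _.
  by rewrite /defect h20 mul0r.
have h2p : 0 < h2 t s by rewrite lt_def h2n (sa_h2_ge0 hS).
pose l w := enorm (L t s (Y i t w) (empirical p hN (fun j => Y j s w)) - L t s (Y i t w) (nu s)).
have ml : measurable_fun setT l.
  apply: (measurableT_comp (@measurable_enorm R d)); apply: measurable_rowB => //.
    apply: (measurable_L_comp hS) => //.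
    by apply: (measurable_empirical p0) => j.
  by apply: (measurable_L_comp hS).
under eq_integral do rewrite /defect EFinM.
rewrite ge0_integralZl//; last 3 first.
- apply: measurable_funTS; apply/measurable_EFinP; apply: (measurableT_comp (measurable_powR p)).
  exact: measurable_funM.
- by move=> w _; rewrite lee_fin powR_ge0.
- by rewrite lee_fin ltW.
rewrite EFinM lee_wpmul2l ?lee_fin ?(ltW h2p)//; apply: le_trans hW.
rewrite integral_mkcond [leRHS]integral_mkcond.
apply: ge0_le_integral_nonmeasurable => w _; rewrite !patchE.
  by case: ifP => // _; rewrite lee_fin powR_ge0.
rewrite in_setT; case: ifPn => [wA|_]; last exact: poweR_ge0.
rewrite inE in wA; rewrite -poweR_EFin.
have -> : (fun j => Xbar j s w) = (fun j => Y j s w) by apply/funext => j; rewrite YE.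
apply: gt0_ler_poweR.
- exact: ltW.
- by rewrite in_itv/= leey andbT lee_fin divr_ge0 ?enorm_ge0// ltW.
- by rewrite in_itv/= leey andbT Wp_ge0.
rewrite mulrC EFinM lee_pdivrMl//.
exact: (sa_L_lipschitz_mu hS (Y i t w) (empirical p hN (fun j => Y j s w)) (nu s) t0 s0).
Qed.

Local Notation alpha t :=
  (p * (Hker u h1 t - kappa) + Hker u h2 t * (eps + eps') * (p - 1)).
Local Notation err t := ((N%:R^-1)%:E *
  \sum_(i < N) 'E_P[fun w => (enorm (X i t w - Xbar i t w) `^ p)%R] * (p^-1)%:E)%E.

(** Here [nu] is a continuous flow that the drift of the limit particles cannot
    distinguish from their law, and [K] bounds the sampling error at the times
    that the memory charges. *)
Lemma mean_distance_le (x : R -> R) (c : R -> \bar R) :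
  (forall t, 0 <= t -> 0 <= x t) ->
  (forall t, 0 <= t <= T -> ((Hker u h2 t / (p * eps `^ (p - 1)) * K)%:E <= c t)%E) ->
  (forall t, 0 <= t <= T -> exists2 dx : R, derivative_within `[0, T] x t dx &
     dx%:E = ((alpha t * x t)%:E +
       \int[u t]_(s in `[0%R, t]) ((eps' `^ (p - 1))^-1 * h2 t s * x s)%:E + c t)%E) ->
  (err 0%R <= (x 0)%:E)%E ->
  forall t, 0 <= t <= T -> (err t <= (x t)%:E)%E.
Proof.
move=> x0 Kc hx init.
have [G [mG PG hG]] := good_event.
pose Xe i := extended G (X i); pose Ye i := extended G (Xbar i).
pose Z i s w := Xe i s w - Ye i s w.
pose A n := regular_event T G Z n.
have mXe i s : measurable_fun setT (Xe i s) by apply: measurable_extended => // t; exact: mX.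
have mYe i s : measurable_fun setT (Ye i s) by apply: measurable_extended => // t; exact: mXbar.
have cXe i w : continuous (fun s => Xe i s w).
  by apply: continuous_extended => /(hG w i)[].
have cYe i w : continuous (fun s => Ye i s w).
  by apply: continuous_extended => /(hG w i)[].
have sX w i : G w -> solves_on F L u T (fun t => B i t w *m sigma^T)
    (fun s => empirical p hN (fun j => Xe j s w)) (fun t => Xe i t w).
  move=> Gw; have [_ _ sX _] := hG w i Gw; apply: solves_on_eq sX => s s0.
    by congr (empirical p hN _); apply/funext => j; rewrite /Xe extendedE.
  by rewrite /Xe extendedE.
have sY w i : G w -> solves_on F L u T (fun t => B i t w *m sigma^T) nu (fun t => Ye i t w).
  move=> Gw; have [_ _ _ sY] := hG w i Gw; apply: solves_on_eq sY => s s0 //.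
  by rewrite /Ye extendedE.
have cemp w : Pp_continuous (fun s => empirical p hN (fun j => Xe j s w)).
  apply: (empirical_flow_continuous hS) => i.
  by apply: continuous_subspaceT; exact: cXe.
have cZ w i (t : R) : G w -> 0 <= t <= T -> Z i s w @[s --> within `[0, T] (nbhs t)] --> Z i t w.
  move=> Gw tT; have cw (f : R -> V) : continuous f -> f s @[s --> within `[0, T] (nbhs t)] --> f t.
    by move=> cf; apply: cvg_trans (cf t); apply: cvg_app; exact: cvg_within.
  by apply: cvgB; apply: cw; [exact: cXe|exact: cYe].
have mA n : measurable (A n).
  by apply: measurable_regular_event => // i s _; exact: measurable_rowB.
have AG n w : A n w -> G w by case.
have UA : \bigcup_n A n = G.
  apply: bigcup_regular_event => // w Gw i.
  exact: (solves_difference_bounded hS T0 (cemp w) cnu (sX w i Gw) (sY w i Gw)).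
pose D t w := N%:R^-1 * \sum_(i < N) (enorm (X i t w - Xbar i t w) `^ p / p).
pose r n i t := \int[P]_(w in A n) (enorm (Xe i t w - Ye i t w) `^ p / p).
pose y n t := N%:R^-1 * \sum_(i < N) r n i t.
have q0 i t w : 0 <= enorm (Xe i t w - Ye i t w) `^ p / p.
  by rewrite divr_ge0 ?powR_ge0// ltW.
have mD t : 0 <= t -> measurable_fun setT (D t).
  move=> t0; apply: measurable_funM => //; apply: measurable_sum => i.
  apply: measurable_funM => //; apply: measurable_enorm_powR => //.
  by apply: measurable_rowB; [by []|exact: mX|exact: mXbar].
have D0 t w : 0 <= D t w.
  by rewrite mulr_ge0// sumr_ge0// => i _; rewrite divr_ge0 ?powR_ge0// ltW.
have Zle n w i s : A n w -> 0 <= s <= T -> enorm (Z i s w) <= n%:R.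
  by move=> Aw; apply: regular_event_bounded Aw.
have Zlip n w i s a : A n w -> 0 <= s <= T -> 0 <= a <= T ->
    enorm (Z i s w - Z i a w) <= n%:R * `|s - a|.
  by move=> Aw; apply: regular_event_lipschitz Aw.
have DE (E : set Omega) t : measurable E -> 0 <= t -> (\int[P]_(w in E) (D t w)%:E = N%:R^-1%:E *
    \sum_(i < N) \int[P]_(w in E) (enorm (X i t w - Xbar i t w) `^ p / p)%:E)%E.
  move=> mE t0.
  have mq i : measurable_fun E (fun w => (enorm (X i t w - Xbar i t w) `^ p / p)%:E).
    apply: measurable_funTS; apply/measurable_EFinP; apply: measurable_funM => //.
    by apply: measurable_enorm_powR => //; apply: measurable_rowB; [by []|exact: mX|exact: mXbar].
  have q0' i w : (0 <= (enorm (X i t w - Xbar i t w) `^ p / p)%:E)%E.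
    by rewrite lee_fin divr_ge0 ?powR_ge0// ltW.
  rewrite -ge0_integral_sum// -ge0_integralZl//; last 2 first.
  - exact: emeasurable_sum.
  - by move=> w _; exact: sume_ge0.
  by apply: eq_integral => w _; rewrite sumEFin -EFinM.
have errE t : 0 <= t -> err t = (\int[P]_w (D t w)%:E)%E.
  move=> t0; rewrite DE//; congr (_ * _)%E; apply: eq_bigr => i _.
  rewrite unlock -ge0_integralZr//.
  - apply/measurable_EFinP; apply: measurable_enorm_powR => //.
    by apply: measurable_rowB; [by []|exact: mX|exact: mXbar].
  - by move=> w _; rewrite lee_fin powR_ge0.
  - by rewrite lee_fin invr_ge0 ltW.
have intq n i t : 0 <= t <= T ->
    P.-integrable (A n) (EFin \o (fun w => enorm (Xe i t w - Ye i t w) `^ p / p)).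
  move=> tT; apply: (@truncated_integrable _ _ _ _ _ _ _ _ _ _ hS _ _ P Xe Ye T n%:R (A n)) => //.
  exact: Zle.
have yE n t : 0 <= t <= T -> (y n t)%:E = (\int[P]_(w in A n) (D t w)%:E)%E.
  move=> tT; have /andP[t0 _] := tT; rewrite DE// EFinM -sumEFin; congr (_ * _)%E.
  apply: eq_bigr => i _; rewrite fineK; last exact: integrable_fin_num (intq n i t tT).
  apply: eq_integral => w; rewrite inE => /AG Gw.
  by rewrite /Xe /Ye !extendedE.
have yx n t : 0 <= t <= T -> y n t <= x t.
  have [H H0 hH] := sa_H_bounded hS T.
  pose beta t s := (eps' `^ (p - 1))^-1 * h2 t s.
  have h20 a s : 0 <= a -> (`[0, a]%classic : set R) s -> 0 <= h2 a s.
    by move=> a0; rewrite /= in_itv/= => /andP[s0 _]; exact: (sa_h2_ge0 hS).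
  have H20 a : 0 <= a -> 0 <= Hker u h2 a by move=> a0; apply: Rintegral_ge0 => s /(h20 a s a0).
  have e0' : 0 <= (eps' `^ (p - 1))^-1 by rewrite invr_ge0 powR_ge0.
  have y0 a : 0 <= y n a.
    by rewrite mulr_ge0// sumr_ge0// => i _; apply: Rintegral_ge0.
  have dZ w i a (h : nat -> R) : A n w -> 0 <= a < T -> (forall k, 0 < h k) ->
     (forall k, a + h k <= T) -> h k @[k --> \oo] --> 0 ->
     (h k)^-1 *: (Z i (a + h k) w - Z i a w) @[k --> \oo] -->
       drift F L u (fun s => empirical p hN (fun j => Xe j s w)) a (Xe i a w) -
       drift F L u nu a (Ye i a w).
    move=> /AG Gw.
    exact: (solves_difference_derivative hS (cemp w) cnu (sX w i Gw) (sY w i Gw)).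
  have intX w i a : A n w -> 0 <= a <= T ->
     vintegrable (u a) `[0, a] (fun s => L a s (Xe i a w) (empirical p hN (fun j => Xe j s w))).
    by move=> /AG Gw; exact: (solves_inner (sX w i Gw)).
  have intY w i a : A n w -> 0 <= a <= T ->
     vintegrable (u a) `[0, a] (fun s => L a s (Ye i a w) (nu s)).
    by move=> /AG Gw; exact: (solves_inner (sY w i Gw)).
  have Kdef i a : 0 <= a <= T -> {ae u a, forall s, 0 <= s <= a ->
     (\int[P]_(w in A n) (defect p h2 a s (enorm (L a s (Ye i a w)
       (empirical p hN (fun j => Ye j s w)) - L a s (Ye i a w) (nu s))))%:E <= (h2 a s * K)%:E)%E}.
    move=> aT; have /andP[a0 _] := aT.
    apply: filterS (hK aT) => s Ks sa; have /andP[s0 _] := sa.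
    apply: defect_expectation => //; last exact: Ks.
    by move=> w j b /AG Gw b0; rewrite /Ye extendedE.
  apply: (@comparison R u T (p * (H - kappa) + H * (eps + eps') * (p - 1))
    ((eps' `^ (p - 1))^-1 * H) (fun t => alpha t) beta c x (y n)) => //.
  - move=> a aT; have [H1 H2] := hH a aT.
    apply: lerD; first by rewrite ler_wpM2l ?(ltW p0)// lerD2r.
    rewrite ler_wpM2r ?subr_ge0// ler_wpM2r// ltW// addr_gt0//.
  - by move=> a s /andP[a0 _] sa; apply: mulr_ge0 => //; apply: h20 => //; rewrite /= in_itv.
  - move=> a /andP[a0 _]; apply: measurable_funM => //; exact: (measurable_h2 hS).
  - move=> a aT; have /andP[a0 _] := aT; have [_ H2] := hH a aT.
    under eq_integral do rewrite EFinM.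
    rewrite ge0_integralZl//; last 2 first.
    - by apply/measurable_EFinP; exact: (measurable_h2 hS).
    - by move=> s /(h20 a s a0); rewrite lee_fin.
    by rewrite (Hker_fin2 hS)// -EFinM lee_fin ler_wpM2l.
  - move=> a aT; apply: le_trans (Kc a aT); have /andP[a0 _] := aT.
    by rewrite lee_fin mulr_ge0// divr_ge0 ?H20// mulr_ge0 ?powR_ge0// ltW.
  - move=> a aT; apply: cvgM; first exact: cvg_cst.
    apply: cvg_sumr => i.
    apply: (@truncated_continuous _ _ _ _ _ _ _ _ _ _ hS _ _ P Xe Ye T n%:R (A n)) => //.
    + exact: Zle.
    + exact: Zlip.
  - move=> a h aT h0 hT hk.
    have growth i := @truncated_growth _ _ _ hN _ _ _ _ _ _ _ hS _ _ P Xe Ye nu T eps eps' K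
      n%:R (A n) K0 eps0 eps0' (ler0n _ n) mXe cXe mYe cYe cnu (mA n)
      (Zle n) (Zlip n) intX intY dZ Kdef i a h aT h0 hT hk.
    have /choice[l hl] : forall i, exists l : R,
        (h k)^-1 * (r n i (a + h k) - r n i a) @[k --> \oo] --> l /\
        (l%:E <= (alpha a * r n i a)%:E + (\int[u a]_(s in `[0%R, a]) (beta a s * y n s)%:E +
           (Hker u h2 a / (p * eps `^ (p - 1)) * K)%:E))%E.
      by move=> i; have [l ? ?] := growth i; exists l.
    have aT' : 0 <= a <= T by case/andP: aT => -> /ltW ->.
    exists (N%:R^-1 * \sum_(i < N) l i).
      have -> : (fun k => (h k)^-1 * (y n (a + h k) - y n a)) =
          (fun k => N%:R^-1 * \sum_(i < N) (h k)^-1 * (r n i (a + h k) - r n i a)).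
        by apply/funext => j; rewrite /y -mulrBr -sumrB mulrCA mulr_sumr.
      apply: cvgM; first exact: cvg_cst.
      by apply: cvg_sumr => i; have [] := hl i.
    set I := (\int[u a]_(s in _) (beta a s * _)%:E)%E in hl *.
    apply: (@le_trans _ _ ((alpha a * y n a)%:E +
        (I + (Hker u h2 a / (p * eps `^ (p - 1)) * K)%:E))%E); last first.
      by rewrite leeD2l// leeD2l// Kc.
    have : (0 <= I + (Hker u h2 a / (p * eps `^ (p - 1)) * K)%:E)%E.
      have a0 : 0 <= a by case/andP: aT'.
      rewrite adde_ge0//; last first.
        by rewrite lee_fin mulr_ge0// divr_ge0 ?H20// mulr_ge0 ?powR_ge0// ltW.
      by apply: integral_ge0 => s Ds; rewrite lee_fin mulr_ge0//; apply: mulr_ge0 => //; exact: h20.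
    move: hl; set b := (I + _)%E => hl; move: b hl => [b||] hl b0; last 2 first.
    - by rewrite [leRHS]addey// leey.
    - by rewrite leNgt ltNy0 in b0.
    have hb i : l i <= alpha a * r n i a + b by have [_] := hl i; rewrite -EFinD lee_fin.
    have Nb : b = N%:R^-1 * \sum_(i < N) b.
      by rewrite sumr_const card_ord -[b *+ N]mulr_natl mulKf// pnatr_eq0 -lt0n.
    rewrite -EFinD lee_fin {1}Nb /y mulrCA -mulrDr ler_wpM2l// mulr_sumr -big_split/=.
    by apply: ler_sum => i _.
  - have T00 : 0 <= (0 : R) <= T by rewrite lexx ltW.
    rewrite -lee_fin yE//; apply: (le_trans _ init); rewrite errE//.
    apply: ge0_subset_integral => //; first exact/measurable_EFinP/mD.
    by move=> w _; rewrite lee_fin.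
move=> t tT; have /andP[t0 _] := tT.
rewrite errE// (@ge0_negligible_integral _ _ _ P setT (~` G))//; last 3 first.
- exact: measurableC.
- exact/measurable_EFinP/mD.
- by move=> w _; rewrite lee_fin.
rewrite setTD setCK -UA.
have h := @ge0_nondecreasing_set_cvg_integral _ _ _ A (fun w => (D t w)%:E) P
  (@regular_event_nondecreasing _ _ _ _ _ _ _ _) mA.
apply: (cvge_to_le (h _ _)).
- by move=> n; apply: measurable_funTS; exact/measurable_EFinP/mD.
- by move=> n w _; rewrite lee_fin.
- by apply: nearW => n; rewrite -yE// lee_fin yx.
Qed.

End mean_distance.

(** * The flow of laws and the sampling error *)

Section sampling.
Context (R : realType) (d : nat) (p : R) (F : 'rV[R]_d -> 'rV[R]_d)
  (L : R -> R -> 'rV[R]_d -> Pp d p -> 'rV[R]_d)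
  (u : R -> {measure set R -> \bar R}) (h1 h2 : R -> R -> R) (kappa : R)
  (hS : structural_assumption F L u h1 h2 kappa).
Local Notation V := 'rV[R]_d.

Let p0 : 0 < p := p_gt0 hS.

Lemma Pp_continuous_cst (mu : Pp d p) : Pp_continuous (fun=> mu).
Proof.
apply: (@Pp_continuousP R d p p0 _ (fun _ _ => 0)) => //.
- move=> s t _ _.
  have mid : measurable_fun [set: V] (@id V) by exact: measurable_id.
  have := @Wp_le_expectation R d p p0 mu mu _ _ mu id id mid mid (fun _ _ => erefl) (fun _ _ => erefl).
  rewrite integral0_eq// => y _.
  by rewrite subrr enorm0 powR0// gt_eqF.
- by move=> t _; exact: cvg_cst.
Qed.

(** Where the memory has no mass in [h2], the law is irrelevant to the drift. *)
Lemma same_memory_of_Hker0 (T : R) (mu nu : R -> Pp d p) :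
  (forall t, 0 <= t <= T -> Hker u h2 t = 0) ->
  same_memory L u T mu nu /\
  (forall t, 0 <= t <= T -> {ae u t, forall s, 0 <= s <= t -> h2 t s = 0}).
Proof.
move=> H20.
have h20 t : 0 <= t <= T -> {ae u t, forall s, 0 <= s <= t -> h2 t s = 0}.
  move=> tT; have /andP[t0 _] := tT.
  have : ae_eq (u t) (`[0, t]%classic : set R) (fun s => (h2 t s)%:E) (cst 0%E).
    apply/ae_eq_integral_abs => //.
      by apply/measurable_EFinP; exact: (measurable_h2 hS).
    rewrite (eq_integral (fun s => (h2 t s)%:E)).
      by rewrite (Hker_fin2 hS)// (H20 t tT).
    move=> s; rewrite inE/= in_itv/= => /andP[s0 _].
    by rewrite ger0_norm// (sa_h2_ge0 hS).
  apply: filterS => s hs st; apply: EFin_inj; apply: hs.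
  by rewrite /= in_itv.
split=> // t tT; have /andP[t0 _] := tT.
apply: filterS (h20 t tT) => s hs st x; have /andP[s0 _] := st.
apply/eqP; rewrite -subr_eq0; apply/eqP/enorm_eq0/eqP.
rewrite eq_le enorm_ge0 andbT -lee_fin.
by have := sa_L_lipschitz_mu hS x (mu s) (nu s) t0 s0; rewrite hs// mul0e.
Qed.

End sampling.

Theorem theorem2p3 (R : realType) (d k N : nat)
  (hd : (0 < d)%N) (hk : (0 < k)%N) (hN : (0 < N)%N) (p q T : R)
  (disp : measure_display) (Omega : measurableType disp)
  (P : probability Omega R) (Ft : R -> set (set Omega)) (hFt : filtration Ft)
  (sigma : 'M[R]_(d, k)) (F : 'rV[R]_d -> 'rV[R]_d)
  (L : R -> R -> 'rV[R]_d -> Pp d p -> 'rV[R]_d)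
  (u : R -> {measure set R -> \bar R}) (h1 h2 : R -> R -> R) (kappa : R)
  (hS : structural_assumption F L u h1 h2 kappa)
  (hT : 0 < T) (hq : p < q)
  (hcase : rate_case p d q)
  (C0 : R) (hC0 : fournier_guillin_constant p d q C0)
  (B : 'I_N -> R -> Omega -> 'rV[R]_k)
  (hB : forall i, brownian_motion P Ft (B i))
  (X Xbar : 'I_N -> R -> Omega -> 'rV[R]_d) (mu : R -> Pp d p)
  (hindep : mutually_independent P (fun o : option 'I_N =>
     if o is Some i then process_sigma_algebra (B i)
     else <<s \bigcup_(i in [set: 'I_N]) (g_sigma_algebra_preimage (X i 0) `|`
                                g_sigma_algebra_preimage (Xbar i 0)) >>))
  (hX0 : forall i, g_sigma_algebra_preimage (X i 0) `<=` Ft 0)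
  (m : R) (hm : Num.max p 2 <= m)
  (hX0m : forall i, ('E_P[fun w => (enorm (X i 0 w) `^ m)%R] < +oo)%E)
  (hX : forall i, sde_solution P Ft sigma F L u (B i)
     (fun w s => empirical p hN (fun j => X j s w)) (X i))
  (hXbar0 : forall i, g_sigma_algebra_preimage (Xbar i 0) `<=` Ft 0)
  (hXbar0iid : iid P (fun i => Xbar i 0))
  (hXbar0q : forall i, ('E_P[fun w => (enorm (Xbar i 0 w) `^ q)%R] < +oo)%E)
  (hXbar : forall i, sde_solution P Ft sigma F L u (B i) (fun=> mu) (Xbar i))
  (hmu : forall i t, 0 <= t -> has_law P (Xbar i t) (mu t))
  (eps eps' : R) (heps : 0 < eps) (heps' : 0 < eps') :
  let H1 := Hker u h1 in
  let H2 := Hker u h2 in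
  let alpha t := p * (H1 t - kappa) + H2 t * (eps + eps') * (p - 1) in
  let beta t s := (eps' `^ (p - 1))^-1 * h2 t s in
  let C t := ((H2 t / (p * eps `^ (p - 1)))%:E *
    ereal_sup [set 'E_P[fun w => (enorm (Xbar (Ordinal hN) r w) `^ q)%R] `^ (p / q)
                | r in `[0%R, T]])%E in
  let err t := ((N%:R^-1)%:E *
    \sum_(i < N) 'E_P[fun w => (enorm (X i t w - Xbar i t w) `^ p)%R] * (p^-1)%:E)%E
  in
  forall (x : R -> R) (hx_ge0 : forall t, 0 <= t -> 0 <= x t)
    (hx_ode : forall t, 0 <= t <= T ->
       exists2 dx : R, derivative_within `[0, T] x t dx &
         dx%:E = ((alpha t * x t)%:E +
           \int[u t]_(s in `[0%R, t]) (beta t s * x s)%:E +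
           (rate C0 p d q N)%:E * C t)%E)
    (hx_init : (x 0)%:E = err 0),
  forall t, 0 <= t <= T -> (err t <= (x t)%:E)%E.
Proof.
move=> H1 H2 alpha beta C err x x0 hx init.
have p0 : 0 < p := p_gt0 hS.
have q0 : 0 < q by exact: lt_trans hq.
pose rt := rate C0 p d q N.
have rt0 : 0 < rt by apply: rate_gt0 => //; exact: fournier_guillin_constant_gt0 hC0.
have mXbar i s : 0 <= s -> measurable_fun setT (Xbar i s).
  by move=> s0; exact: (adapted_measurable hFt (sde_adapted (hXbar i)) s0).
pose i0 := Ordinal hN.
pose E s := ('E_P[fun w => (enorm (Xbar i0 s w) `^ q)%R])%E.
have E0 s : (0 <= E s)%E.
  by rewrite /E unlock; apply: integral_ge0 => w _; rewrite lee_fin powR_ge0.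
have EE s : 0 <= s -> E s = moment q (mu s).
  move=> s0; rewrite /E unlock.
  by rewrite (moment_has_law q (mXbar i0 s s0) (hmu i0 s s0)).
(* the supremum in [C] *)
pose M := ereal_sup [set (E r `^ (p / q))%E | r in `[0%R, T]].
have EM s : 0 <= s <= T -> (E s `^ (p / q) <= M)%E.
  by move=> sT; apply: ereal_sup_ubound; exists s => //=; rewrite in_itv.
have M0 : (0 <= M)%E by apply: le_trans (EM 0 _); rewrite ?poweR_ge0 ?lexx ?ltW.
have CE t : C t = ((H2 t / (p * eps `^ (p - 1)))%:E * M)%E by [].
have H20 t : 0 <= t -> 0 <= H2 t.
  move=> t0; apply: Rintegral_ge0 => s; rewrite /= in_itv/= => /andP[s0 _].
  exact: (sa_h2_ge0 hS).
have ce0 : 0 < p * eps `^ (p - 1) by rewrite mulr_gt0 ?powR_gt0.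
have C_ge0 t : 0 <= t -> (0 <= C t)%E.
  by move=> t0; rewrite CE mule_ge0// lee_fin divr_ge0 ?H20// ltW.
suff [nu [K [K0 cnu smn hK KC]]] : exists (nu : R -> Pp d p) (K : R),
    [/\ 0 <= K, Pp_continuous nu, same_memory L u T mu nu,
      forall t, 0 <= t <= T -> {ae u t, forall s, 0 <= s <= t -> h2 t s = 0 \/
        (\int[P]_w (Wp p (empirical_prob (fun j => Xbar j s w) hN) (nu s) `^ p) <= K%:E)%E} &
      forall t, 0 <= t <= T ->
        ((H2 t / (p * eps `^ (p - 1)) * K)%:E <= rt%:E * C t)%E].
  apply: (@mean_distance_le R d k N hN p T disp Omega P Ft hFt sigma F L u h1 h2 kappa hS hT
    B X Xbar mu nu hX hXbar cnu smn eps eps' K heps heps' K0 hK x (fun t => (rt%:E * C t)%E)) => //.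
  by rewrite init.
have [Mfin|Minf] := ltP M +oo%E; last first.
  (* a real derivative leaves no room for an infinite [C t] *)
  have {}H20 t : 0 <= t <= T -> Hker u h2 t = 0.
    move=> tT; have /andP[t0 _] := tT.
    apply/eqP; rewrite eq_le [X in _ && X]H20// andbT leNgt; apply/negP => H2p.
    have [dx _] := hx t tT; rewrite CE; move: Minf; rewrite leye_eq => /eqP ->.
    rewrite !gt0_muley ?lte_fin ?divr_gt0// addey//.
    have : (0 <= \int[u t]_(s in `[0%R, t]) (beta t s * x s)%:E)%E.
      apply: integral_ge0 => s; rewrite /= in_itv/= => /andP[s0 _].
      by rewrite lee_fin mulr_ge0 ?x0// mulr_ge0 ?invr_ge0 ?powR_ge0// (sa_h2_ge0 hS).
    by case: (\int[u t]_(s in _) _)%E.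
  have [smn h20] := same_memory_of_Hker0 hS mu (fun=> mu 0) H20.
  exists (fun=> mu 0), 0; split=> //.
  - exact: Pp_continuous_cst hS _.
  - by move=> t tT; apply: filterS (h20 t tT) => s hs st; left; exact: hs.
  - by move=> t /andP[t0 _]; rewrite mulr0 mule_ge0 ?C_ge0// lee_fin ltW.
pose m0 := fine M.
have ME : M = m0%:E by rewrite fineK// ge0_fin_numE.
have m00 : 0 <= m0 by rewrite fine_ge0.
(* the flow is frozen after [T], since the moments are bounded only before *)
pose nu s := mu (Num.min s T).
have EA s : 0 <= s <= T -> (E s <= (m0 `^ (q / p))%:E)%E.
  move=> sT; have qp : p / q * (q / p) = 1 by field; rewrite !gt_eqF.
  have -> : E s = ((E s `^ (p / q)) `^ (q / p))%E by rewrite -poweRrM qp poweRe1.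
  rewrite -poweR_EFin; apply: gt0_ler_poweR.
  - by rewrite divr_ge0// ltW.
  - by rewrite in_itv/= leey andbT poweR_ge0.
  - by rewrite in_itv/= leey andbT lee_fin.
  - by rewrite -ME EM.
have cnu : Pp_continuous nu.
  apply: (@flow_continuous R d p q p0 hq disp Omega P (Xbar i0) mu T (m0 `^ (q / p))) => //.
  - exact: powR_ge0.
  - exact: mXbar.
  - exact: sde_continuous (hXbar i0).
  - move=> s s0; exact: hmu.
  - move=> s sT; have /andP[s0 _] := sT; rewrite -EE//; exact: EA.
have smn : same_memory L u T mu nu.
  move=> t /andP[t0 tT]; apply: aeW => s /andP[s0 st] y.
  by rewrite /nu min_l// (le_trans st).
exists nu, (rt * m0); split=> //.
- by rewrite mulr_ge0// ltW.
- move=> t /andP[t0 tT]; apply: aeW => s /andP[s0 st]; right.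
  have sT : 0 <= s <= T by rewrite s0 (le_trans st).
  have -> : nu s = mu s by rewrite /nu min_l//; case/andP: sT.
  have mfin : (moment q (mu s) < +oo)%E.
    by rewrite -EE// (le_lt_trans (EA s sT))// ltry.
  have indep : iid P (fun i => Xbar i s).
    split; last by move=> i j A mA; rewrite (hmu i s s0 A mA) (hmu j s s0 A mA).
    (* at time 0 independence is assumed; later it is that of the Euler limits *)
    move: s0; rewrite le_eqVlt => /predU1P[<-|s0]; first by case: hXbar0iid.
    apply: (@sde_mutually_independent R d k N p disp Omega P Ft hFt sigma F L u h1 h2 kappa hS
      B hB _ Xbar mu nu hindep _ _ hXbar _ s s0 cnu) => //.
    + by move=> i A hA; apply: sub_sigma_algebra; exists i => //; right.
    + by case: hXbar0iid.
    + by move=> r /andP[r0 rs]; apply: smn; rewrite r0 (le_trans rs)//; case/andP: sT.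
  have := hC0 disp Omega P (mu s) N hN (fun i => Xbar i s) mfin
    (fun i => mXbar i s s0) (fun i => hmu i s s0) indep.
  move=> /le_trans; apply; rewrite (EFinM rt m0) lee_wpmul2l ?lee_fin ?(ltW rt0)//.
  by rewrite -EE// -ME EM.
- move=> t tT; rewrite CE ME -!EFinM lee_fin le_eqVlt; apply/orP; left; apply/eqP.
  by rewrite mulrCA.
Qed.
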